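(* Let $\{\alpha_n\}_{n\ge 1}$ be a Blaschke sequence of points in the open unit disk $\mathbb{D}$, with associated numbers $\delta_n$ and Gram matrix $G$. For $2 \le p < \infty$, the operator $G - I$ belongs to the Schatten class $\mathcal{S}_p$ if and only if $\sum_n (1 - \delta_n^2)^{p/2} < \infty$.
   Context: $\mathbb{D}$ is the open unit disk in $\mathbb{C}$ and $H^2$ is the Hardy space on $\mathbb{D}$. A Blaschke sequence is an (infinite) sequence $\{\alpha_j\}$ in $\mathbb{D}$ with $\sum_j (1-|\alpha_j|)<\infty$. For such a sequence, $B_j$ denotes the Blaschke product with zeros at all the points of the sequence except that the zero $\alpha_j$ is removed, and $\delta_j = |B_j(\alpha_j)| = \prod_{k\ne j}\left|\frac{\alpha_k-\alpha_j}{1-\overline{\alpha_k}\alpha_j}\right|$. Let $k_j(z) = \frac{1}{1-\overline{\alpha_j}z}$ be the Szegő kernel (the reproducing kernel of $H^2$ at $\alpha_j$), let $g_j = k_j/\|k_j\|_{H^2}$, and let $G$ be the Gram matrix, the infinite matrix with entries $G_{ij} = \langle g_j, g_i\rangle_{H^2}$, regarded as an operator on $\ell^2$ with respect to the standard orthonormal basis. $I$ is the identity operator on $\ell^2$. For $1\le p<\infty$, $\mathcal{S}_p$ is the space of compact operators whose sequence of singular values is in $\ell^p$; the assertion $G-I\in\mathcal{S}_p$ means that the matrix $G-I$ defines a bounded operator on $\ell^2$ which lies in $\mathcal{S}_p$. *)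

(* Defs.v *)
From Stdlib Require Export Reals List ClassicalEpsilon.
From Coquelicot Require Export Coquelicot.
Open Scope R_scope.

(** * The complex sequence space l^2 *)

Definition CSeries (a : nat -> C) : C :=
  (Series (fun n => Re (a n)), Series (fun n => Im (a n))).

Definition l2 (x : nat -> C) : Prop := ex_series (fun n => Cmod (x n) ^ 2).

Definition l2_inner (x y : nat -> C) : C :=
  CSeries (fun n => (x n * Cconj (y n))%C).

Definition l2_norm (x : nat -> C) : R :=
  sqrt (Series (fun n => Cmod (x n) ^ 2)).

Definition std_basis (j : nat) : nat -> C :=
  fun n => if Nat.eq_dec n j then RtoC 1 else RtoC 0.

(** * Operators on l^2

    An operator is a map on all sequences of which only the restriction to
    [l2] matters; its values outside [l2] are arbitrary and never used. *)

Definition bounded_operator (T : (nat -> C) -> (nat -> C)) : Prop :=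
  (forall x, l2 x -> l2 (T x)) /\
  (forall x y, l2 x -> l2 y ->
     forall n, T (fun m => (x m + y m)%C) n = (T x n + T y n)%C) /\
  (forall (c : C) x, l2 x ->
     forall n, T (fun m => (c * x m)%C) n = (c * T x n)%C) /\
  (exists K : R, forall x, l2 x -> l2_norm (T x) <= K * l2_norm x).

Definition compact_operator (T : (nat -> C) -> (nat -> C)) : Prop :=
  bounded_operator T /\
  forall x : nat -> nat -> C,
    (forall n, l2 (x n)) ->
    (exists K : R, forall n, l2_norm (x n) <= K) ->
    exists (phi : nat -> nat) (y : nat -> C),
      (forall n, (phi n < phi (S n))%nat) /\
      l2 y /\
      is_lim_seq (fun n => l2_norm (fun m => (T (x (phi n)) m - y m)%C)) 0.

Definition is_adjoint (T Tstar : (nat -> C) -> (nat -> C)) : Prop :=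
  bounded_operator Tstar /\
  forall x y, l2 x -> l2 y -> l2_inner (T x) y = l2_inner x (Tstar y).

Definition lin_comb (d : nat) (c : nat -> C) (v : nat -> nat -> C) : nat -> C :=
  fun n => sum_n_m (fun i => (c i * v i n)%C) 1 d.

(* [v 1, ..., v d] is a basis of [V]; for [d = 0] the sum is empty. *)
Definition has_dim (V : (nat -> C) -> Prop) (d : nat) : Prop :=
  exists v : nat -> nat -> C,
    (forall i, (1 <= i <= d)%nat -> V (v i)) /\
    (forall c, (forall n, lin_comb d c v n = 0%C) ->
       forall i, (1 <= i <= d)%nat -> c i = 0%C) /\
    (forall x, V x -> exists c, forall n, x n = lin_comb d c v n).

Definition eigenspace (A : (nat -> C) -> (nat -> C)) (lambda : R) :
    (nat -> C) -> Prop :=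
  fun x => l2 x /\ forall n, A x n = (RtoC lambda * x n)%C.

(* The singular values are the square roots of the eigenvalues of [T^* T],
   listed in nonincreasing order and repeated according to multiplicity
   (padded with zeros when [T] has finite rank): each [mu > 0] occurs in [s]
   exactly [dim ker (T^* T - mu^2)] times.  This determines [s] for compact
   [T]. *)
Definition singular_values (T : (nat -> C) -> (nat -> C)) (s : nat -> R) : Prop :=
  (forall n, 0 <= s (S n) <= s n) /\
  exists Tstar, is_adjoint T Tstar /\
    forall mu, 0 < mu ->
      exists l : list nat,
        NoDup l /\ (forall n, In n l <-> s n = mu) /\
        has_dim (eigenspace (fun x => Tstar (T x)) (mu ^ 2)) (length l).

(* [x ^ p] for [x >= 0] and real [p > 0]; the case split is needed because
   [Rpower 0 p = 1] in the standard library. *)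
Definition rpow (x p : R) : R := if Rlt_dec 0 x then Rpower x p else 0.

Definition schatten_class (p : R) (T : (nat -> C) -> (nat -> C)) : Prop :=
  compact_operator T /\
  exists s, singular_values T s /\ ex_series (fun n => rpow (s n) p).

(* [<T e_j, e_i> = M i j]; the left-hand side is the [i]-th coordinate of
   [T e_j]. *)
Definition is_matrix_of (M : nat -> nat -> C) (T : (nat -> C) -> (nat -> C)) : Prop :=
  bounded_operator T /\ forall i j, T (std_basis j) i = M i j.

Definition matrix_in_schatten (p : R) (M : nat -> nat -> C) : Prop :=
  exists T, is_matrix_of M T /\ schatten_class p T.

(** * The Hardy space H^2 of the unit disk *)

Definition H2_coeffs (f : C -> C) (a : nat -> C) : Prop :=
  l2 a /\
  forall z : C, Cmod z < 1 ->
    is_pseries (K := C_AbsRing) (V := C_NormedModule) a z (f z).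

Definition H2 (f : C -> C) : Prop := exists a, H2_coeffs f a.

(* The Taylor coefficients of [f] at 0; meaningful when [H2 f]. *)
Definition taylor (f : C -> C) : nat -> C :=
  epsilon (inhabits (fun _ : nat => RtoC 0)) (H2_coeffs f).

Definition H2_inner (f g : C -> C) : C := l2_inner (taylor f) (taylor g).

Definition H2_norm (f : C -> C) : R := sqrt (Re (H2_inner f f)).

(** * Blaschke sequences and their Gram matrices

    Sequences are indexed from 0. *)

Definition blaschke_sequence (alpha : nat -> C) : Prop :=
  (forall j, Cmod (alpha j) < 1) /\ ex_series (fun j => 1 - Cmod (alpha j)).

(* The partial products are nonincreasing in [0, 1], so the limit exists. *)
Definition delta (alpha : nat -> C) (j : nat) : R :=
  real (Lim_seq (prod_f_R0 (fun k =>
    if Nat.eq_dec k j then 1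
    else Cmod ((alpha k - alpha j) / (1 - Cconj (alpha k) * alpha j))%C))).

Definition szego (alpha : nat -> C) (j : nat) : C -> C :=
  fun z => (1 / (1 - Cconj (alpha j) * z))%C.

Definition normalized_szego (alpha : nat -> C) (j : nat) : C -> C :=
  fun z => (szego alpha j z / RtoC (H2_norm (szego alpha j)))%C.

Definition gram (alpha : nat -> C) (i j : nat) : C :=
  H2_inner (normalized_szego alpha j) (normalized_szego alpha i).

Definition id_matrix (i j : nat) : C :=
  if Nat.eq_dec i j then RtoC 1 else RtoC 0.

(* Main.v *)
Require Import Defs.
From Stdlib Require Import ssreflect Arith Lra Lia.
From Stdlib Require Import FunctionalExtensionality ProofIrrelevance Permutation.
Open Scope R_scope.
Open Scope general_if_scope.

(** Write [g_j] for the normalized kernels, [d_j = 1 - delta_j^2] and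
    [X = G - I].  The squared moduli of the entries of [X] off the diagonal are
    [1 - rho(a_i, a_j)^2], so the squared norm of the [j]-th column of [X] is
    [sum_(i <> j) (1 - rho(a_i, a_j)^2)], while [delta_j^2] is the product of the
    [rho(a_i, a_j)^2].  Hence [d_j] is at most the squared norm of the column, and
    the two are comparable once [d_j] is small ([delta_upper], [delta_lower]).

    Necessity.  For [p >= 2], convexity bounds the sum of the [p]-th powers of
    the norms of the columns of a compact operator by a multiple of the sum of the
    [p]-th powers of its singular values ([column_powers]).

    Sufficiency rests on a quantitative form of the theorem that thin sequences
    have Gram matrices close to the identity: if every column sum above is at most
    [e^2], then [|X| <= 42 e] ([synth_bound]).  Granting this, list the indices by
    decreasing [d_j].  Off the first [N] of them, for large [N], [X] has norm at
    most a constant times the square root of the next [d_j], so a vector in the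
    span of the first [2 N + 1] singular vectors that vanishes on these [N]
    coordinates together with its image shows that the singular value of index
    [2 N] obeys the same bound ([sing_rank_bound]).  Summing [p]-th powers finishes the proof.

    The norm estimate has an upper and a lower half.  The upper half is a Carleson
    embedding [sum (1 - |a_j|^2) |f(a_j)|^2 <= (1 + O(e)) |f|^2].  It follows from
    families [Q_j] of analytic multipliers with [sum_j |Q_j|^2 <= 1] on the circle
    and [|Q_j(a_j)|^2 >= 1 - O(e)], by evaluating [Q_j f] at [a_j].  They are
    built by a lottery on the circle: each [i] claims a point of the circle with
    probability [s_i], close to one well within distance [(1 - |a_i|) / e] of
    [a_i] and decaying beyond it; two claimants fight a duel which the nearer one tends to win; [j] gets the
    point if it claims it and beats all other claimants.  At most one index gets
    the point, so the probabilities [q_j] of success add up to at most one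
    ([tournament], [claims_le]).  All the probabilities involved are squared moduli
    of quotients of polynomials of degree one ([claim_mult], [pass_mult],
    [duel]), and at [a_j] the competitor [a_i] costs [j] only
    [O(1 - rho(a_i, a_j)^2) / e] ([claim_factor]).  Integrals over
    the circle are never formed: a weight on the circle is represented by a
    quadratic form invariant under the shift ([Toeplitz]).

    The lower half follows from the upper one by duality: the functions
    [h_j], equal to [g_j] times the Blaschke product of the other points, are
    biorthogonal to the [g_j] up to factors of modulus near one, and their Gram
    matrix is the conjugate of [G] ([inner_dual_vec], [synth_lower]).

    The singular values of a compact operator are produced by maximizing
    [|T x|] on successive orthogonal complements ([singular_system]); counting
    dimensions identifies them with the ones in the definition of the Schatten
    class ([sing_le], [sing_multiplicities]). *)

(** * The Hilbert space of square-summable sequences *)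

Lemma Cmod_sqr_plus_le (a b : C) :
  Cmod (a + b)%C ^ 2 <= 2 * Cmod a ^ 2 + 2 * Cmod b ^ 2.
Proof.
have h := Cmod_triangle a b.
have h0 := Cmod_ge_0 (a + b)%C.
have : Cmod (a + b)%C ^ 2 <= (Cmod a + Cmod b) ^ 2.
  by apply: pow_incr; split.
have := pow2_ge_0 (Cmod a - Cmod b); nra.
Qed.

Lemma l2_plus (x y : nat -> C) :
  l2 x -> l2 y -> l2 (fun n => (x n + y n)%C).
Proof.
move=> hx hy.
apply: (@ex_series_le R_AbsRing R_CompleteNormedModule _
          (fun n => 2 * Cmod (x n) ^ 2 + 2 * Cmod (y n) ^ 2)).
- move=> n; rewrite /norm /= /abs /=.
  rewrite Rabs_pos_eq; first by exact: Cmod_sqr_plus_le.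
  exact: pow2_ge_0.
- by apply: ex_series_plus; apply: (ex_series_scal_l 2).
Qed.

Lemma l2_scal (c : C) (x : nat -> C) : l2 x -> l2 (fun n => (c * x n)%C).
Proof.
move=> hx.
apply: (ex_series_ext (fun n => Cmod c ^ 2 * Cmod (x n) ^ 2)).
- by move=> n; rewrite Cmod_mult Rpow_mult_distr.
- exact: (ex_series_scal_l (Cmod c ^ 2)).
Qed.

Lemma l2_finite (x : nat -> C) (N : nat) :
  (forall n, (N <= n)%nat -> x n = 0%C) -> l2 x.
Proof.
move=> h; apply/(ex_series_incr_n _ N).
apply: (ex_series_ext (fun _ => 0)).
- move=> n; rewrite h; [by rewrite Cmod_0 pow_i; [|lia] | lia].
- apply: (ex_series_ext (fun n => 0 * 0 ^ n)); first by move=> n; rewrite Rmult_0_l.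
  apply: (ex_series_scal_l 0 (fun n => 0 ^ n)); exists (/ (1 - 0)).
  by apply: is_series_geom; rewrite Rabs_R0; lra.
Qed.

(** Bundling the summability proof with the sequence turns vector identities into
    Leibniz equalities. *)
Record H := mkH { hv :> nat -> C; hv_l2 : l2 hv }.

Lemma H_ext (x y : H) : (forall n, x n = y n) -> x = y.
Proof.
case: x => x hx; case: y => y hy /= h.
have e : x = y by apply: functional_extensionality.
by subst y; rewrite (proof_irrelevance _ hx hy).
Qed.

Definition hadd (x y : H) : H := mkH _ (l2_plus x y (hv_l2 x) (hv_l2 y)).
Definition hscal (c : C) (x : H) : H := mkH _ (l2_scal c x (hv_l2 x)).
Definition hzero : H := mkH (fun _ => 0%C) (l2_finite _ 0 (fun _ _ => eq_refl)).
Definition hsub (x y : H) : H := hadd x (hscal (-(1))%C y).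

Declare Scope H_scope.
Delimit Scope H_scope with H.
Bind Scope H_scope with H.
Notation "x + y" := (hadd x y) : H_scope.
Notation "x - y" := (hsub x y) : H_scope.
Notation "c *: x" := (hscal c x) (at level 40, left associativity) : H_scope.

Ltac hring := apply: H_ext => ?; rewrite /= ?/hsub /=; ring.

Definition inner (x y : H) : C := l2_inner x y.
Definition nrm2 (x : H) : R := Series (fun n => Cmod (x n) ^ 2).
Definition nrm (x : H) : R := l2_norm x.

Lemma Rabs_coord_inner (a b : C) :
  Rabs (Re (a * Cconj b)%C) <= Cmod a ^ 2 + Cmod b ^ 2 /\
  Rabs (Im (a * Cconj b)%C) <= Cmod a ^ 2 + Cmod b ^ 2.
Proof.
have hm : Cmod (a * Cconj b)%C <= Cmod a ^ 2 + Cmod b ^ 2.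
  by rewrite Cmod_mult Cmod_conj; have := Cmod_ge_0 a; have := Cmod_ge_0 b; nra.
have := Rmax_Cmod (a * Cconj b)%C.
have := Rmax_l (Rabs (fst (a * Cconj b)%C)) (Rabs (snd (a * Cconj b)%C)).
have := Rmax_r (Rabs (fst (a * Cconj b)%C)) (Rabs (snd (a * Cconj b)%C)).
by rewrite /Re /Im; lra.
Qed.

Lemma ex_series_inner (x y : H) :
  ex_series (fun n => Re (x n * Cconj (y n))%C) /\
  ex_series (fun n => Im (x n * Cconj (y n))%C).
Proof.
have hs : ex_series (fun n => Cmod (x n) ^ 2 + Cmod (y n) ^ 2).
  exact: ex_series_plus (hv_l2 x) (hv_l2 y).
by split; apply: (@ex_series_le R_AbsRing R_CompleteNormedModule _ _ _ hs) => n;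
   have [h1 h2] := Rabs_coord_inner (x n) (y n).
Qed.

Lemma C_eq (a b : C) : Re a = Re b -> Im a = Im b -> a = b.
Proof. by case: a => a1 a2; case: b => b1 b2 /= -> ->. Qed.

Lemma Cconj_RtoC (t : R) : Cconj (RtoC t) = RtoC t.
Proof. apply: C_eq => /=; ring. Qed.

Lemma inner_add_l (x y z : H) : inner (x + y)%H z = (inner x z + inner y z)%C.
Proof.
have [rx ix] := ex_series_inner x z; have [ry iy] := ex_series_inner y z.
apply: C_eq; rewrite /= -Series_plus //; apply: Series_ext => n /=; ring.
Qed.

Lemma inner_scal_l (c : C) (x z : H) : inner (c *: x)%H z = (c * inner x z)%C.
Proof.
have [rx ix] := ex_series_inner x z.
apply: C_eq; rewrite /=.
- rewrite -!Series_scal_l -Series_minus;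
    [|exact: (ex_series_scal_l (fst c)) | exact: (ex_series_scal_l (snd c))].
  by apply: Series_ext => n /=; ring.
- rewrite -!Series_scal_l -Series_plus;
    [|exact: (ex_series_scal_l (fst c)) | exact: (ex_series_scal_l (snd c))].
  by apply: Series_ext => n /=; ring.
Qed.

Lemma inner_conj (x y : H) : inner y x = Cconj (inner x y).
Proof.
apply: C_eq; rewrite /=.
- by apply: Series_ext => n /=; ring.
- by rewrite -Series_opp; apply: Series_ext => n /=; ring.
Qed.

Lemma inner_add_r (x y z : H) : inner z (x + y)%H = (inner z x + inner z y)%C.
Proof. by rewrite inner_conj inner_add_l Cplus_conj -!inner_conj. Qed.

Lemma inner_scal_r (c : C) (x z : H) :
  inner z (c *: x)%H = (Cconj c * inner z x)%C.
Proof. by rewrite inner_conj inner_scal_l Cmult_conj -!inner_conj. Qed.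

Lemma inner_sub_l (x y z : H) : inner (x - y)%H z = (inner x z - inner y z)%C.
Proof. by rewrite /hsub inner_add_l inner_scal_l; ring. Qed.

Lemma inner_sub_r (x y z : H) : inner z (x - y)%H = (inner z x - inner z y)%C.
Proof.
rewrite /hsub inner_add_r inner_scal_r.
have -> : Cconj (-(1))%C = (-(1))%C by apply: C_eq => /=; ring.
ring.
Qed.

Lemma inner_self (x : H) : inner x x = RtoC (nrm2 x).
Proof.
apply: C_eq; rewrite /= /nrm2.
- by apply: Series_ext => n; rewrite Cmod2_alt /=; rewrite /Re /Im; ring.
- rewrite (Series_ext _ (fun n => 0 * 0)); first by rewrite Series_scal_l; ring.
  by move=> n /=; ring.
Qed.

Lemma Re_inner_self (x : H) : Re (inner x x) = nrm2 x.
Proof. by rewrite inner_self. Qed.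

Lemma inner_zero_l (x : H) : inner hzero x = 0%C.
Proof.
have -> : hzero = (0%C *: hzero)%H by hring.
by rewrite inner_scal_l; ring.
Qed.

Lemma inner_zero_r (x : H) : inner x hzero = 0%C.
Proof. by rewrite inner_conj inner_zero_l; apply: C_eq => /=; ring. Qed.

Lemma Series_ge_0 (a : nat -> R) :
  (forall n, 0 <= a n) -> ex_series a -> 0 <= Series a.
Proof.
move=> h0 ha.
have <- : Series (fun _ => 0 * 0) = 0 by rewrite Series_scal_l; ring.
by apply: Series_le => // n; have := h0 n; lra.
Qed.

Lemma Series_term_le (a : nat -> R) (k : nat) :
  (forall n, 0 <= a n) -> ex_series a -> a k <= Series a.
Proof.
move=> h0 ha.
rewrite (Series_incr_n a (S k)) //; last by lia.
have h1 : 0 <= Series (fun j => a (S k + j)%nat).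
  apply: Series_ge_0 => //; exact/(ex_series_incr_n a (S k)).
have h2 : a k <= sum_f_R0 a k.
  case: k {h1} => [|k] /=; first by lra.
  have := cond_pos_sum a k h0; lra.
by rewrite [Init.Nat.pred _]/=; lra.
Qed.

Lemma nrm2_ge0 (x : H) : 0 <= nrm2 x.
Proof. apply: Series_ge_0; [move=> n; exact: pow2_ge_0 | exact: hv_l2]. Qed.

Lemma coord_le_nrm2 (x : H) (n : nat) : Cmod (x n) ^ 2 <= nrm2 x.
Proof.
apply: (Series_term_le (fun n => Cmod (x n) ^ 2)); [move=> k; exact: pow2_ge_0 | exact: hv_l2].
Qed.

Lemma nrm2_eq0 (x : H) : nrm2 x <= 0 -> x = hzero.
Proof.
move=> h; apply: H_ext => n /=; apply: Cmod_eq_0.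
have := coord_le_nrm2 x n; have := Cmod_ge_0 (x n); nra.
Qed.

Lemma nrm_sqr (x : H) : nrm x ^ 2 = nrm2 x.
Proof. rewrite /nrm /l2_norm pow2_sqrt //; exact: nrm2_ge0. Qed.

Lemma nrm_ge0 (x : H) : 0 <= nrm x.
Proof. exact: sqrt_pos. Qed.

Lemma nrm2_add (x y : H) :
  nrm2 (x + y)%H = nrm2 x + nrm2 y + 2 * Re (inner x y).
Proof.
rewrite -!Re_inner_self inner_add_l !inner_add_r (inner_conj x y) /=; ring.
Qed.

Lemma nrm2_scal (c : C) (x : H) : nrm2 (c *: x)%H = Cmod c ^ 2 * nrm2 x.
Proof.
rewrite -!Re_inner_self inner_scal_l inner_scal_r inner_self Cmod2_alt /=.
rewrite /Re /Im /=; ring.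
Qed.

Lemma nrm2_sub (x y : H) :
  nrm2 (x - y)%H = nrm2 x + nrm2 y - 2 * Re (inner x y).
Proof.
rewrite -!Re_inner_self inner_sub_l !inner_sub_r (inner_conj x y) /=; ring.
Qed.

Lemma nrm2_zero : nrm2 hzero = 0.
Proof. by rewrite -Re_inner_self inner_zero_l. Qed.

Lemma nrm_scal (c : C) (x : H) : nrm (c *: x)%H = Cmod c * nrm x.
Proof.
apply: Rsqr_inj; [exact: nrm_ge0| |].
- apply: Rmult_le_pos; [exact: Cmod_ge_0|exact: nrm_ge0].
- by rewrite !Rsqr_pow2 Rpow_mult_distr !nrm_sqr nrm2_scal.
Qed.

Lemma Re_le_Cmod (z : C) : Re z <= Cmod z.
Proof. have := re_le_Cmod z; have := Rle_abs (Re z); lra. Qed.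

Lemma Cphase (z : C) : exists c : C, Cmod c = 1 /\ (c * z)%C = RtoC (Cmod z).
Proof.
case: (Req_dec (Cmod z) 0) => h.
- exists 1%C; rewrite Cmod_1 h (Cmod_eq_0 z h); split=> //; ring.
- have hz : RtoC (Cmod z) <> 0%C by move/RtoC_inj.
  have hz0 : z <> 0%C by move=> e; apply: h; rewrite e Cmod_0.
  exists (Cconj z / Cmod z)%C; split.
  + rewrite Cmod_div // Cmod_conj Cmod_R Rabs_pos_eq; [by field | exact: Cmod_ge_0].
  + have e : (Cconj z * z)%C = (RtoC (Cmod z) * RtoC (Cmod z))%C.
      by rewrite Cmult_comm -Cmod2_conj -RtoC_mult; congr RtoC; ring.
    have -> : (Cconj z / Cmod z * z)%C = (Cconj z * z / Cmod z)%C by field.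
    by rewrite e; field.
Qed.

Lemma Re_inner_le (x y : H) : Re (inner x y) <= nrm x * nrm y.
Proof.
have h t : 0 <= nrm2 x + t ^ 2 * nrm2 y - 2 * t * Re (inner x y).
  have := nrm2_ge0 (x - (RtoC t *: y))%H.
  rewrite nrm2_sub nrm2_scal inner_scal_r Cmod_R -Rsqr_pow2 -Rsqr_abs Rsqr_pow2.
  have -> : Re (Cconj (RtoC t) * inner x y)%C = t * Re (inner x y).
    by rewrite /Re /=; ring.
  lra.
have hx := nrm_ge0 x; have hy := nrm_ge0 y.
move: h; rewrite -!nrm_sqr => h.
case: (Req_dec (nrm y) 0) => hy0.
- rewrite hy0 Rmult_0_r; apply: Rnot_lt_le => hr.
  have := h ((nrm x ^ 2 + 1) / Re (inner x y)); rewrite hy0.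
  have -> : 2 * ((nrm x ^ 2 + 1) / Re (inner x y)) * Re (inner x y)
            = 2 * (nrm x ^ 2 + 1) by field; lra.
  nra.
- have := h (nrm x / nrm y).
  have -> : nrm x ^ 2 + (nrm x / nrm y) ^ 2 * nrm y ^ 2 -
     2 * (nrm x / nrm y) * Re (inner x y)
     = 2 * (nrm x / nrm y) * (nrm x * nrm y - Re (inner x y)) by field.
  case: (Req_dec (nrm x) 0) => hx0.
  + move=> _; have := h 1; have := h (nrm x + 1).
    move: hx0 => e; rewrite e.
    move=> _ _; apply: Rnot_lt_le => hr.
    have := h (Re (inner x y) / nrm y ^ 2); rewrite e.
    have -> : 0 ^ 2 + (Re (inner x y) / nrm y ^ 2) ^ 2 * nrm y ^ 2 -
       2 * (Re (inner x y) / nrm y ^ 2) * Re (inner x y)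
       = - (Re (inner x y) / nrm y) ^ 2 by field.
    have : 0 < Re (inner x y) / nrm y by apply: Rdiv_lt_0_compat; lra.
    nra.
  + have : 0 < nrm x / nrm y by apply: Rdiv_lt_0_compat; lra.
    move=> hp hq; apply: Rnot_lt_le => hr.
    have : 0 < (nrm x / nrm y) * (Re (inner x y) - nrm x * nrm y).
      apply: Rmult_lt_0_compat => //; lra.
    lra.
Qed.

Lemma Cauchy_Schwarz (x y : H) : Cmod (inner x y) <= nrm x * nrm y.
Proof.
have [c [hc hz]] := Cphase (inner x y).
have <- : Re (inner (c *: x)%H y) = Cmod (inner x y).
  by rewrite inner_scal_l hz.
apply: Rle_trans (Re_inner_le _ _) _; rewrite nrm_scal hc; lra.
Qed.

Lemma Cauchy_Schwarz2 (x y : H) : Cmod (inner x y) ^ 2 <= nrm2 x * nrm2 y.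
Proof.
rewrite -!nrm_sqr -Rpow_mult_distr; apply: pow_incr.
by split; [exact: Cmod_ge_0 | exact: Cauchy_Schwarz].
Qed.

Lemma nrm_add_le (x y : H) : nrm (x + y)%H <= nrm x + nrm y.
Proof.
apply: Rsqr_incr_0_var; last by have := nrm_ge0 x; have := nrm_ge0 y; lra.
rewrite !Rsqr_pow2 nrm_sqr nrm2_add -!nrm_sqr; have := Re_inner_le x y; lra.
Qed.

Lemma nrm_sub_le (x y : H) : nrm (x - y)%H <= nrm x + nrm y.
Proof.
have := nrm_add_le x ((-(1))%C *: y)%H.
by rewrite nrm_scal Cmod_m1 Rmult_1_l.
Qed.

Lemma nrm_zero : nrm hzero = 0.
Proof. rewrite /nrm /l2_norm -/(nrm2 hzero) nrm2_zero sqrt_0 //. Qed.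

Lemma nrm_le_of_nrm2 (x : H) (M : R) : 0 <= M -> nrm2 x <= M ^ 2 -> nrm x <= M.
Proof.
move=> hM h; apply: Rsqr_incr_0_var => //; by rewrite !Rsqr_pow2 nrm_sqr.
Qed.

Lemma coord_le_nrm (x : H) (n : nat) : Cmod (x n) <= nrm x.
Proof.
apply: Rsqr_incr_0_var; last exact: nrm_ge0.
rewrite !Rsqr_pow2 nrm_sqr; exact: coord_le_nrm2.
Qed.

(** ** Finite sums over lists of indices *)

Fixpoint sumR {A : Type} (l : list A) (f : A -> R) : R :=
  match l with nil => 0 | i :: l' => f i + sumR l' f end.
Fixpoint sumC {A : Type} (l : list A) (f : A -> C) : C :=
  match l with nil => 0%C | i :: l' => (f i + sumC l' f)%C end.
Fixpoint sumH {A : Type} (l : list A) (f : A -> H) : H :=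
  match l with nil => hzero | i :: l' => (f i + sumH l' f)%H end.

Lemma sumR_ext {A} (l : list A) f g :
  (forall i, In i l -> f i = g i) -> sumR l f = sumR l g.
Proof.
elim: l => //= i l IH h; rewrite h; [by rewrite IH // => j hj; apply: h; right|by left].
Qed.

Lemma sumC_ext {A} (l : list A) f g :
  (forall i, In i l -> f i = g i) -> sumC l f = sumC l g.
Proof.
elim: l => //= i l IH h; rewrite h; [by rewrite IH // => j hj; apply: h; right|by left].
Qed.

Lemma sumH_ext {A} (l : list A) f g :
  (forall i, In i l -> f i = g i) -> sumH l f = sumH l g.
Proof.
elim: l => //= i l IH h; rewrite h; [by rewrite IH // => j hj; apply: h; right|by left].
Qed.

Lemma sumR_le {A} (l : list A) f g :
  (forall i, In i l -> f i <= g i) -> sumR l f <= sumR l g.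
Proof.
elim: l => /= [_|i l IH h]; first by lra.
have := h i (or_introl eq_refl); have := IH (fun j hj => h j (or_intror hj)); lra.
Qed.

Lemma sumR_ge0 {A} (l : list A) f :
  (forall i, In i l -> 0 <= f i) -> 0 <= sumR l f.
Proof.
elim: l => /= [_|i l IH h]; first by lra.
have := h i (or_introl eq_refl); have := IH (fun j hj => h j (or_intror hj)); lra.
Qed.

Lemma sumR_scal {A} (l : list A) c f : sumR l (fun i => c * f i) = c * sumR l f.
Proof. elim: l => /= [|i l ->]; ring. Qed.

Lemma sumC_scal {A} (l : list A) c f :
  sumC l (fun i => (c * f i)%C) = (c * sumC l f)%C.
Proof. elim: l => /= [|i l ->]; ring. Qed.

Lemma sumR_plus {A} (l : list A) f g :
  sumR l (fun i => f i + g i) = sumR l f + sumR l g.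
Proof. elim: l => /= [|i l ->]; ring. Qed.

Lemma sumC_plus {A} (l : list A) f g :
  sumC l (fun i => (f i + g i)%C) = (sumC l f + sumC l g)%C.
Proof. elim: l => /= [|i l ->]; ring. Qed.

Lemma sumR_const {A} (l : list A) c : sumR l (fun _ => c) = INR (length l) * c.
Proof.
elim: l => [|i l IH]; first by rewrite /=; ring.
by rewrite [length _]/= S_INR /= IH; ring.
Qed.

Lemma sumR_swap {A B} (l : list A) (m : list B) f :
  sumR l (fun i => sumR m (fun j => f i j)) =
  sumR m (fun j => sumR l (fun i => f i j)).
Proof.
elim: l => /= [|i l ->]; last by rewrite sumR_plus.
by elim: m => //= j m <-; ring.
Qed.

Lemma sumC_swap {A B} (l : list A) (m : list B) f :
  sumC l (fun i => sumC m (fun j => f i j)) =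
  sumC m (fun j => sumC l (fun i => f i j)).
Proof.
elim: l => /= [|i l ->]; last by rewrite sumC_plus.
by elim: m => //= j m <-; ring.
Qed.

Lemma sumC_conj {A} (l : list A) f :
  Cconj (sumC l f) = sumC l (fun i => Cconj (f i)).
Proof.
elim: l => /= [|i l <-]; first by apply: C_eq => /=; ring.
by rewrite Cplus_conj.
Qed.

Lemma sumC_RtoC {A} (l : list A) f : sumC l (fun i => RtoC (f i)) = RtoC (sumR l f).
Proof. by elim: l => //= i l ->; rewrite RtoC_plus. Qed.

Lemma sumR_cauchy_schwarz {A} (l : list A) a b :
  sumR l (fun i => a i * b i) ^ 2 <=
  sumR l (fun i => a i ^ 2) * sumR l (fun i => b i ^ 2).
Proof.
have h2 := fun f : A -> R => sumR_ge0 l (fun i => f i ^ 2) (fun i _ => pow2_ge_0 (f i)).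
elim: l {h2} (h2 a) (h2 b) => /= [|i l IH] ha hb; first by lra.
have ha' := sumR_ge0 l (fun i => a i ^ 2) (fun i _ => pow2_ge_0 (a i)).
have hb' := sumR_ge0 l (fun i => b i ^ 2) (fun i _ => pow2_ge_0 (b i)).
have := IH ha' hb'.
move: ha' hb'; rewrite /=.
set p := sumR l (fun i => a i * b i).
set u := sumR l (fun i => a i * (a i * 1)).
set v := sumR l (fun i => b i * (b i * 1)).
move=> hu hv h.
(* the cross term: [2 a_i b_i p <= a_i^2 v + b_i^2 u] follows from [p^2 <= u v] *)
have : (2 * a i * b i * p) <= a i ^ 2 * v + b i ^ 2 * u.
  case: (Req_dec u 0) => hu0.
    have : p = 0 by nra.
    by move=> ->; nra.
  have hup : 0 < u by lra.
  have : 0 <= (b i * u - a i * p) ^ 2 by exact: pow2_ge_0.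
  move=> hq.
  have : 0 <= u * (a i ^ 2 * v + b i ^ 2 * u - 2 * a i * b i * p) by nra.
  by move=> hr; nra.
by nra.
Qed.

Lemma inner_sumH_l {A} (l : list A) f z :
  inner (sumH l f) z = sumC l (fun i => inner (f i) z).
Proof. elim: l => /= [|i l IH]; [exact: inner_zero_l|by rewrite inner_add_l IH]. Qed.

Lemma inner_sumH_r {A} (l : list A) f z :
  inner z (sumH l f) = sumC l (fun i => inner z (f i)).
Proof. elim: l => /= [|i l IH]; [exact: inner_zero_r|by rewrite inner_add_r IH]. Qed.

Lemma sumH_coord {A} (l : list A) f n : (sumH l f) n = sumC l (fun i => (f i) n).
Proof. by elim: l => //= i l <-. Qed.

Lemma nrm_sumH_le {A} (l : list A) f : nrm (sumH l f) <= sumR l (fun i => nrm (f i)).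
Proof.
elim: l => /= [|i l IH]; first by rewrite nrm_zero; lra.
have := nrm_add_le (f i) (sumH l f); lra.
Qed.

(** * Multiplication by z and division by 1 - conj(g) z on coefficient sequences *)

Definition shift_seq (x : nat -> C) (n : nat) : C :=
  match n with O => 0%C | S k => x k end.

Lemma l2_shift (x : nat -> C) : l2 x -> l2 (shift_seq x).
Proof. by move=> hx; apply/ex_series_incr_1. Qed.

Definition shift (x : H) : H := mkH _ (l2_shift x (hv_l2 x)).

Lemma inner_shift (x y : H) : inner (shift x) (shift y) = inner x y.
Proof.
have [rx ix] := ex_series_inner (shift x) (shift y).
apply: C_eq; rewrite /= Series_incr_1 //=; ring.
Qed.

Lemma nrm2_shift (x : H) : nrm2 (shift x) = nrm2 x.
Proof. by rewrite -!Re_inner_self inner_shift. Qed.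

Fixpoint div_seq (g : C) (x : nat -> C) (n : nat) : C :=
  match n with
  | O => x O
  | S k => (x (S k) + Cconj g * div_seq g x k)%C
  end.

Lemma sum_f_R0_pos_incr (a : nat -> R) : (forall n, 0 <= a n) ->
  forall M, (forall n, sum_f_R0 a n <= M) -> ex_series a.
Proof.
move=> h0 M hM.
have : ex_finite_lim_seq (sum_n a).
  apply: (ex_finite_lim_seq_incr _ M).
  - by move=> n; rewrite sum_Sn /plus /=; have := h0 (S n); lra.
  - by move=> n; rewrite sum_n_Reals.
by move=> [l hl]; exists l.
Qed.

Lemma sum_le_Series (a : nat -> R) : (forall n, 0 <= a n) -> ex_series a ->
  forall n, sum_f_R0 a n <= Series a.
Proof.
move=> h0 ha n; rewrite (Series_incr_n a (S n)) //; last by lia.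
have : 0 <= Series (fun k => a (S n + k)%nat).
  apply: Series_ge_0 => //; exact/(ex_series_incr_n a (S n)).
by rewrite [Init.Nat.pred _]/=; lra.
Qed.

(** With [t = 1 - |g|] one has [(a + |g| b)^2 <= a^2 / t + |g| b^2], so the partial
    sums of the quotient bound themselves with a factor [|g| < 1]. *)
Lemma l2_div (g : C) (x : nat -> C) : Cmod g < 1 -> l2 x -> l2 (div_seq g x).
Proof.
move=> hg hx.
have hg0 := Cmod_ge_0 g.
set a := fun n => Cmod (x n) ^ 2.
set b := fun n => Cmod (div_seq g x n) ^ 2.
have step k : b (S k) <= a (S k) / (1 - Cmod g) + Cmod g * b k.
  rewrite /a /b /=.
  set u := x (S k); set w := div_seq g x k.
  have h := Cmod_triangle u (Cconj g * w)%C.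
  rewrite Cmod_mult Cmod_conj in h.
  have h1 : Cmod (u + Cconj g * w)%C ^ 2 <= (Cmod u + Cmod g * Cmod w) ^ 2.
    by apply: pow_incr; split; [exact: Cmod_ge_0|].
  have h2 : (Cmod u + Cmod g * Cmod w) ^ 2 <=
            Cmod u ^ 2 / (1 - Cmod g) + Cmod g * Cmod w ^ 2.
    have -> : Cmod u ^ 2 / (1 - Cmod g) + Cmod g * Cmod w ^ 2 =
       (Cmod u + Cmod g * Cmod w) ^ 2 +
       Cmod g / (1 - Cmod g) * (Cmod u - (1 - Cmod g) * Cmod w) ^ 2
       by field; lra.
    have : 0 <= Cmod g / (1 - Cmod g) by apply: Rdiv_le_0_compat; lra.
    have := pow2_ge_0 (Cmod u - (1 - Cmod g) * Cmod w); nra.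
  by move: h1 h2; rewrite /=; lra.
apply: (sum_f_R0_pos_incr b (fun n => pow2_ge_0 _) (Series a / (1 - Cmod g) ^ 2)) => n.
have hb0 : b 0%nat <= a 0%nat / (1 - Cmod g).
  rewrite /a /b /=; apply: (Rmult_le_reg_r (1 - Cmod g)); first by lra.
  have -> : Cmod (x 0%nat) * (Cmod (x 0%nat) * 1) / (1 - Cmod g) * (1 - Cmod g)
            = Cmod (x 0%nat) * (Cmod (x 0%nat) * 1) by field; lra.
  have := pow2_ge_0 (Cmod (x 0%nat)); nra.
have hs m : sum_f_R0 b m <= sum_f_R0 a m / (1 - Cmod g) + Cmod g * sum_f_R0 b m.
  have : sum_f_R0 b m + Cmod g * b m <=
         sum_f_R0 a m / (1 - Cmod g) + Cmod g * sum_f_R0 b m.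
    elim: m => [|m IH] /=; first by lra.
    have := step m; rewrite Rdiv_plus_distr; lra.
  have : 0 <= b m by exact: pow2_ge_0.
  nra.
have hsn := hs n.
have ha : sum_f_R0 a n <= Series a by apply: sum_le_Series => // k; exact: pow2_ge_0.
have -> : Series a / (1 - Cmod g) ^ 2 = (Series a / (1 - Cmod g)) / (1 - Cmod g)
  by field; lra.
apply/Rle_div_r; first by lra.
apply: (Rle_trans _ (sum_f_R0 a n / (1 - Cmod g))); first by lra.
by apply: Rmult_le_compat_r => //; apply: Rlt_le; apply: Rinv_0_lt_compat; lra.
Qed.

Definition Disc := { g : C | Cmod g < 1 }.
Definition disc_val (g : Disc) : C := proj1_sig g.
Coercion disc_val : Disc >-> C.
Lemma disc_lt (g : Disc) : Cmod g < 1.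
Proof. exact: proj2_sig g. Qed.

Definition divide (g : Disc) (x : H) : H := mkH _ (l2_div g x (disc_lt g) (hv_l2 x)).

Definition lin (u v : C) (x : H) : H := (u *: x + v *: shift x)%H.

Lemma lin_divide (g : Disc) (x : H) : lin 1%C (- Cconj g)%C (divide g x) = x.
Proof. by apply: H_ext; case=> [|n] /=; ring. Qed.

Lemma lin_inj (g : Disc) (x y : H) :
  lin 1%C (- Cconj g)%C x = lin 1%C (- Cconj g)%C y -> x = y.
Proof.
move=> h; apply: H_ext.
have hn n : (lin 1%C (- Cconj g)%C x) n = (lin 1%C (- Cconj g)%C y) n by rewrite h.
elim=> [|n IH].
- have := hn 0%nat; rewrite /= => e.
  have -> : x 0%nat = (1 * x 0%nat + - Cconj g * 0)%C by ring.
  by rewrite e; ring.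
- have := hn (S n); rewrite /= IH => e.
  have -> : x (S n) = ((1 * x (S n) + - Cconj g * y n) + Cconj g * y n)%C by ring.
  by rewrite e; ring.
Qed.

Lemma lin_comm u v u' v' x : lin u v (lin u' v' x) = lin u' v' (lin u v x).
Proof. by apply: H_ext; case=> [|[|n]] /=; ring. Qed.

Lemma divide_lin g u v x : divide g (lin u v x) = lin u v (divide g x).
Proof. by apply: (lin_inj g); rewrite lin_comm !lin_divide. Qed.

Lemma divide_comm g g' x : divide g (divide g' x) = divide g' (divide g x).
Proof. by apply: (lin_inj g); rewrite lin_divide -divide_lin lin_divide. Qed.

(** The function [(num0 + num1 z) / (1 - conj(pole) z)]; the field [pole] is the
    reflection in the unit circle of its actual pole. *)
Record mult := Mult { num0 : C; num1 : C; pole : Disc }.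
Definition act (m : mult) (x : H) : H := lin (num0 m) (num1 m) (divide (pole m) x).
Definition mval (m : mult) (z : C) : C := ((num0 m + num1 m * z) / (1 - Cconj (pole m) * z))%C.

Lemma act_lin m u v x : act m (lin u v x) = lin u v (act m x).
Proof. by rewrite /act divide_lin lin_comm. Qed.

Lemma act_comm m m' x : act m (act m' x) = act m' (act m x).
Proof. by rewrite /act !divide_lin lin_comm (divide_comm (pole m)). Qed.

(** ** Point evaluations *)

Definition basis (k : nat) : H.
refine (mkH (std_basis k) (l2_finite _ (S k) _)).
by move=> n hn; rewrite /std_basis; case: Nat.eq_dec => // e; lia.
Defined.

Lemma is_series_single (a : nat -> R) (k : nat) :
  (forall n, n <> k -> a n = 0) -> is_series a (a k).
Proof.
move=> h.
apply: (filterlim_ext_loc (fun _ => a k)); last exact: filterlim_const.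
exists k => n hn; rewrite sum_n_Reals.
elim: n hn => [|n IH] hn; first by have -> : k = 0%nat by lia.
case: (Nat.eq_dec k (S n)) => [e|ne] /=.
- rewrite -e.
  suff -> : sum_f_R0 a n = 0 by ring.
  have : forall m, (m < k)%nat -> sum_f_R0 a m = 0.
    elim=> [|m IHm] hm /=; first by apply: h; lia.
    by rewrite IHm; [rewrite h; [ring|lia]|lia].
  by apply; lia.
- by rewrite -IH; [rewrite (h (S n)); [ring|lia]|lia].
Qed.

Lemma inner_basis (x : H) (k : nat) : inner x (basis k) = x k.
Proof.
have hk : std_basis k k = RtoC 1 by rewrite /std_basis; case: Nat.eq_dec.
have hn n : n <> k -> std_basis k n = RtoC 0 by rewrite /std_basis; case: Nat.eq_dec.
apply: C_eq; rewrite /=.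
- rewrite (is_series_unique _ _ (is_series_single _ k _)).
    by rewrite hk /=; rewrite /Re /Im; ring.
  by move=> n /hn -> /=; ring.
- rewrite (is_series_unique _ _ (is_series_single _ k _)).
    by rewrite hk /=; rewrite /Re /Im; ring.
  by move=> n /hn -> /=; ring.
Qed.

(** The reproducing kernel at [a]: the constant 1 divided by [1 - conj(a) z]. *)
Definition kern (a : Disc) : H := divide a (basis 0).
Definition ev (a : Disc) (x : H) : C := inner x (kern a).

Lemma inner_lin_l u v x y : inner (lin u v x) y = (u * inner x y + v * inner (shift x) y)%C.
Proof. by rewrite /lin inner_add_l !inner_scal_l. Qed.

Lemma inner_lin_r u v x y :
  inner y (lin u v x) = (Cconj u * inner y x + Cconj v * inner y (shift x))%C.
Proof. by rewrite /lin inner_add_r !inner_scal_r. Qed.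

(** The backward shift multiplies the kernel at [a] by [conj(a)]. *)
Lemma ev_shift (a : Disc) (x : H) : ev a (shift x) = (a * ev a x)%C.
Proof.
have : inner (shift x) (lin 1%C (- Cconj a)%C (kern a)) = RtoC 0.
  by rewrite lin_divide inner_basis.
rewrite inner_lin_r inner_shift /ev => h.
rewrite Cconj_RtoC Copp_conj Cconj_conj in h.
have -> : inner (shift x) (kern a) = ((1 * inner (shift x) (kern a) + - a * inner x (kern a))
   + a * inner x (kern a))%C by ring.
by rewrite h; ring.
Qed.

Lemma ev_lin a u v x : ev a (lin u v x) = ((u + v * a) * ev a x)%C.
Proof. by rewrite {1}/ev inner_lin_l -/(ev a x) -/(ev a (shift x)) ev_shift; ring. Qed.

Lemma one_minus_neq0 (z w : C) : Cmod z < 1 -> Cmod w < 1 -> (1 - Cconj z * w)%C <> 0%C.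
Proof.
move=> hz hw e.
have : Cmod (Cconj z * w)%C = 1.
  have -> : (Cconj z * w)%C = 1%C.
    have -> : (Cconj z * w)%C = (1 - (1 - Cconj z * w))%C by ring.
    by rewrite e; ring.
  by rewrite Cmod_1.
rewrite Cmod_mult Cmod_conj.
have := Cmod_ge_0 z; have := Cmod_ge_0 w; nra.
Qed.

Lemma disc_neq0 (g a : Disc) : (1 - Cconj g * a)%C <> 0%C.
Proof. exact: one_minus_neq0 (disc_lt g) (disc_lt a). Qed.

Lemma ev_divide (a g : Disc) x : ev a (divide g x) = (ev a x / (1 - Cconj g * a))%C.
Proof.
rewrite -{2}(lin_divide g x) ev_lin.
have h := disc_neq0 g a.
by field.
Qed.

Lemma ev_act (a : Disc) m x : ev a (act m x) = (mval m a * ev a x)%C.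
Proof. rewrite /act ev_lin ev_divide /mval; have h := disc_neq0 (pole m) a; by field. Qed.

Lemma ev_basis0 (a : Disc) : ev a (basis 0) = 1%C.
Proof.
rewrite /ev inner_conj inner_basis /=.
by rewrite /std_basis /=; apply: C_eq => /=; ring.
Qed.

Lemma ev_kern (a b : Disc) : ev a (kern b) = (1 / (1 - Cconj b * a))%C.
Proof. by rewrite /kern ev_divide ev_basis0. Qed.

(** The inverse squared norm of the kernel at [a]. *)
Definition csq (a : C) : R := 1 - Cmod a ^ 2.

Lemma csq_gt0 (a : Disc) : 0 < csq a.
Proof. rewrite /csq; have := disc_lt a; have := Cmod_ge_0 a; nra. Qed.

Lemma nrm2_kern (a : Disc) : nrm2 (kern a) = / csq a.
Proof.
apply: RtoC_inj; rewrite -inner_self -/(ev a (kern a)) ev_kern.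
have h := csq_gt0 a.
rewrite Cmult_comm -Cmod2_conj.
rewrite RtoC_inv; last by lra.
by rewrite /csq RtoC_minus /Cdiv Cmult_1_l.
Qed.

Lemma ev_bound (a : Disc) (x : H) : csq a * Cmod (ev a x) ^ 2 <= nrm2 x.
Proof.
have := Cauchy_Schwarz2 x (kern a); rewrite nrm2_kern -/(ev a x).
have h := csq_gt0 a => h1.
have : csq a * Cmod (ev a x) ^ 2 <= csq a * (nrm2 x * / csq a).
  by apply: Rmult_le_compat_l; lra.
have -> : csq a * (nrm2 x * / csq a) = nrm2 x by field; lra.
by [].
Qed.

(** ** Toeplitz forms *)

(** Such a form is [x |-> integral of |x|^2] against a weight on the circle,
    described without integration: it sees [|u + v z|^2] only through its Fourier
    coefficients. *)
Definition Toeplitz (T : H -> R) : Prop :=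
  exists b : H -> C, forall u v x,
    T (lin u v x) = (Cmod u ^ 2 + Cmod v ^ 2) * T x + 2 * Re (u * Cconj v * b x)%C.

Definition nonneg (T : H -> R) : Prop := forall x, 0 <= T x.

Lemma Toeplitz_nrm2 : Toeplitz nrm2.
Proof.
exists (fun x => inner x (shift x)) => u v x.
rewrite /lin nrm2_add !nrm2_scal nrm2_shift inner_scal_l inner_scal_r Cmult_assoc.
ring.
Qed.

Lemma Toeplitz_act T m : Toeplitz T -> Toeplitz (fun x => T (act m x)).
Proof. by move=> [b hb]; exists (fun x => b (act m x)) => u v x; rewrite act_lin hb. Qed.

Lemma Toeplitz_plus T T' : Toeplitz T -> Toeplitz T' -> Toeplitz (fun x => T x + T' x).
Proof.
move=> [b hb] [b' hb']; exists (fun x => (b x + b' x)%C) => u v x.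
by rewrite hb hb' Cmult_plus_distr_l; rewrite /Re /=; ring.
Qed.

Lemma Toeplitz_minus T T' : Toeplitz T -> Toeplitz T' -> Toeplitz (fun x => T x - T' x).
Proof.
move=> [b hb] [b' hb']; exists (fun x => (b x - b' x)%C) => u v x.
rewrite hb hb'.
have -> : (u * Cconj v * (b x - b' x))%C = (u * Cconj v * b x - u * Cconj v * b' x)%C by ring.
by rewrite /Re /=; ring.
Qed.

Lemma Toeplitz_zero : Toeplitz (fun _ => 0).
Proof. exists (fun _ => 0%C) => u v x; rewrite Cmult_0_r /=; ring. Qed.

(** This expresses [|m1|^2 + |m2|^2 <= 1] on the unit circle: over the common
    denominator the two sides are trigonometric polynomials of degree one, which are compared
    coefficient by coefficient. *)
Definition circle_pair (m1 m2 : mult) : Prop :=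
  pole m1 = pole m2 /\
  (num0 m1 * Cconj (num1 m1) + num0 m2 * Cconj (num1 m2))%C = (- pole m1)%C /\
  Cmod (num0 m1) ^ 2 + Cmod (num1 m1) ^ 2 + Cmod (num0 m2) ^ 2 + Cmod (num1 m2) ^ 2
    <= 1 + Cmod (pole m1) ^ 2.

(** Write [x = (1 - conj(g) z) h]; then the difference of the two sides is a
    nonnegative multiple of [T h]. *)
Lemma circle_pair_le m1 m2 T : circle_pair m1 m2 -> Toeplitz T -> nonneg T ->
  forall x, T (act m1 x) + T (act m2 x) <= T x.
Proof.
case: m1 => u1 v1 g1; case: m2 => u2 v2 g2 [/= eg [hc hs]] [b hb] hT x; subst g2.
rewrite /act /= -{3}(lin_divide g1 x) !hb.
set h := divide g1 x.
have hh := hT h.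
have e1 : Cmod 1%C = 1 by exact: Cmod_1.
have e : Re (1 * Cconj (- Cconj g1) * b h)%C =
         Re (u1 * Cconj v1 * b h)%C + Re (u2 * Cconj v2 * b h)%C.
  have -> : (1 * Cconj (- Cconj g1) * b h)%C = (- g1 * b h)%C.
    by rewrite Copp_conj Cconj_conj; ring.
  by rewrite -hc /Re /=; ring.
rewrite e e1 Cmod_opp Cmod_conj; nra.
Qed.

Lemma circle_pair_contr m1 m2 T : circle_pair m1 m2 -> Toeplitz T -> nonneg T ->
  forall x, T (act m1 x) <= T x.
Proof.
move=> hp hT h0 x; have := circle_pair_le m1 m2 T hp hT h0 x; have := h0 (act m2 x); lra.
Qed.

(** ** Tournaments *)

(** [|w j i|^2] is thought of as the probability that [j] beats [i], and the product
    below as the amplitude for [j] to beat all other members of [M]. *)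
Fixpoint wins (w : nat -> nat -> mult) (j : nat) (M : list nat) (x : H) : H :=
  match M with
  | nil => x
  | i :: M' => if Nat.eq_dec i j then wins w j M' x else wins w j M' (act (w j i) x)
  end.

Definition fair (w : nat -> nat -> mult) : Prop :=
  forall i j, i <> j -> circle_pair (w i j) (w j i).

Lemma wins_act w j M m x : wins w j M (act m x) = act m (wins w j M x).
Proof.
elim: M x => //= i M IH x; case: Nat.eq_dec => _ //.
by rewrite act_comm IH.
Qed.

Lemma wins_lin w j M u v x : wins w j M (lin u v x) = lin u v (wins w j M x).
Proof.
elim: M x => //= i M IH x; case: Nat.eq_dec => _ //.
by rewrite act_lin IH.
Qed.

Lemma Toeplitz_wins w j M T : Toeplitz T -> Toeplitz (fun x => T (wins w j M x)).
Proof. by move=> [b hb]; exists (fun x => b (wins w j M x)) => u v x; rewrite wins_lin hb. Qed.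

Lemma Toeplitz_sumR (l : list nat) (F : nat -> H -> R) :
  (forall j, Toeplitz (F j)) -> Toeplitz (fun x => sumR l (fun j => F j x)).
Proof.
move=> h; elim: l => /= [|i l IH]; [exact: Toeplitz_zero | exact: Toeplitz_plus].
Qed.

Lemma wins_contr w j M T : fair w -> Toeplitz T -> nonneg T ->
  forall x, T (wins w j M x) <= T x.
Proof.
move=> hw hT h0; elim: M => /= [x|i M IH x]; first by lra.
case: Nat.eq_dec => [//|ne].
apply: Rle_trans (IH _) _.
by apply: (circle_pair_contr _ (w i j)) => //; apply: hw; auto.
Qed.

(** All factors of [wins w m M] but one are discarded as contractions. *)
Lemma wins_contr_one w m j M T : fair w -> m <> j -> In j M -> Toeplitz T -> nonneg T ->
  forall x, T (wins w m M x) <= T (act (w m j) x).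
Proof.
move=> hw hmj hin hT h0; elim: M hin => //= i M IH [e|hin] x.
- subst i; case: Nat.eq_dec => [e|_]; first by case: hmj.
  exact: wins_contr.
- case: Nat.eq_dec => [_|ne]; first exact: IH.
  apply: Rle_trans (IH hin _) _.
  apply: (circle_pair_contr (w m i) (w i m) (fun y => T (act (w m j) y))).
  + by apply: hw; auto.
  + exact: Toeplitz_act.
  + by move=> y; exact: h0.
Qed.

(** At most one player beats all the others, so the probabilities of doing so add
    up to at most one.  When a player [m] joins, the form left over by the
    tournament on [M] can only decrease under the amplitudes of [m], and this
    is exactly the room that [m] needs. *)
Lemma tournament w (M : list nat) : fair w -> NoDup M ->
  forall T, Toeplitz T -> nonneg T ->
  forall x, sumR M (fun j => T (wins w j M x)) <= T x.
Proof.
move=> hw; elim: M => [_ T _ h0 x|m M IH hnd T hT h0 x]; first exact: h0.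
have [hm hM] : ~ In m M /\ NoDup M by inversion hnd.
rewrite [sumR _ _]/=; case: Nat.eq_dec => [_|//].
have -> : sumR M (fun j => T (if Nat.eq_dec m j then wins w j M x
                              else wins w j M (act (w j m) x)))
        = sumR M (fun j => T (wins w j M (act (w j m) x))).
  apply: sumR_ext => j hj; case: Nat.eq_dec => // e; by subst j.
(* the leftover of the tournament on [M] is again a nonnegative Toeplitz form *)
set T' := fun y => T y - sumR M (fun j => T (wins w j M y)).
have hT' : Toeplitz T'.
  by apply: Toeplitz_minus => //; apply: Toeplitz_sumR => j; exact: Toeplitz_wins.
have h0' : nonneg T' by move=> y; rewrite /T'; have := IH hM T hT h0 y; lra.
have h1 := wins_contr w m M T' hw hT' h0' x.
have h2 : sumR M (fun j => T (wins w j M (act (w j m) x)) + T (wins w j M (wins w m M x)))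
          <= sumR M (fun j => T (wins w j M x)).
  apply: sumR_le => j hj.
  have hmj : m <> j by move=> e; subst j.
  have hTj : Toeplitz (fun y => T (wins w j M y)) by exact: Toeplitz_wins.
  have h0j : nonneg (fun y => T (wins w j M y)) by move=> y; exact: h0.
  have := circle_pair_le _ _ _ (hw j m (not_eq_sym hmj)) hTj h0j x.
  have := wins_contr_one w m j M _ hw hmj hj hTj h0j x.
  by rewrite /=; lra.
rewrite sumR_plus in h2.
by move: h1; rewrite /T'; lra.
Qed.

(** ** Claims and tournaments combined *)

(** Every [i] either claims, with amplitude [s i], or passes, with amplitude
    [r i].  This is the probability, weighted by [T] and [x], that [j] claims and
    beats every other claimant of [A]. *)
Fixpoint claims (s r : nat -> mult) (w : nat -> nat -> mult) (j : nat) (A : list nat)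
    (T : H -> R) (x : H) : R :=
  match A with
  | nil => T x
  | i :: A' =>
      if Nat.eq_dec i j then claims s r w j A' T (act (s i) x)
      else claims s r w j A' T (act (r i) x) +
           claims s r w j A' T (act (s i) (act (w j i) x))
  end.


(** The members of [M] are those already known to claim.  Deciding about the next
    index of [A] either removes it or moves it to [M]; when nothing is left to
    decide, a tournament on [M] remains. *)
Lemma claims_le (s r : nat -> mult) w T (A M : list nat) :
  fair w -> (forall i, circle_pair (s i) (r i)) -> Toeplitz T -> nonneg T ->
  NoDup A -> NoDup M -> (forall i, In i A -> ~ In i M) ->
  forall x, sumR A (fun j => claims s r w j A T (wins w j M x)) +
            sumR M (fun j => claims s r w j A T (wins w j M x)) <= T x.
Proof.
move=> hw hsr hT h0; elim: A M => [M _ hM _ x|i A IH M hA hM hd x].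
  by rewrite /= Rplus_0_l; exact: tournament.
have [hi hA'] : ~ In i A /\ NoDup A by inversion hA.
have hiM : ~ In i M by apply: hd; left.
have IH1 := IH M hA' hM (fun k hk => hd k (or_intror hk)) (act (r i) x).
have IH2 : sumR A (fun j => claims s r w j A T (wins w j (i :: M) (act (s i) x))) +
           sumR (i :: M) (fun j => claims s r w j A T (wins w j (i :: M) (act (s i) x)))
           <= T (act (s i) x).
  apply: IH => //; first by constructor.
  by move=> k hk [e|hk']; [subst k | exact: (hd k (or_intror hk))].
have h3 := circle_pair_le _ _ T (hsr i) hT h0 x.
have step j : j <> i ->
  claims s r w j (i :: A) T (wins w j M x) =
  claims s r w j A T (wins w j M (act (r i) x)) +
  claims s r w j A T (wins w j (i :: M) (act (s i) x)).
  move=> ne /=; case: Nat.eq_dec => [e|_]; first by subst j.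
  by rewrite !wins_act (act_comm (s i)).
have eA : sumR A (fun j => claims s r w j (i :: A) T (wins w j M x)) =
  sumR A (fun j => claims s r w j A T (wins w j M (act (r i) x))) +
  sumR A (fun j => claims s r w j A T (wins w j (i :: M) (act (s i) x))).
  by rewrite -sumR_plus; apply: sumR_ext => j hj; apply: step => e; subst j.
have eM : sumR M (fun j => claims s r w j (i :: A) T (wins w j M x)) =
  sumR M (fun j => claims s r w j A T (wins w j M (act (r i) x))) +
  sumR M (fun j => claims s r w j A T (wins w j (i :: M) (act (s i) x))).
  by rewrite -sumR_plus; apply: sumR_ext => j hj; apply: step => e; subst j.
have ei : claims s r w i (i :: A) T (wins w i M x) =
          claims s r w i A T (wins w i (i :: M) (act (s i) x)).
  by rewrite [claims _ _ _ _ (_ :: _) _ _]/= [wins _ _ (_ :: _) _]/=;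
     case: Nat.eq_dec => // _; rewrite wins_act.
move: IH2; rewrite [sumR (i :: M) _]/= [sumR (i :: A) _]/=.
move: ei eA eM; rewrite /=; lra.
Qed.

(** The same probability with every amplitude replaced by its value at [a]. *)
Fixpoint claim_val (s r : nat -> mult) (w : nat -> nat -> mult) (a : C) (j : nat)
    (A : list nat) : R :=
  match A with
  | nil => 1
  | i :: A' =>
      (if Nat.eq_dec i j then Cmod (mval (s i) a) ^ 2
       else Cmod (mval (r i) a) ^ 2 + Cmod (mval (s i) a) ^ 2 * Cmod (mval (w j i) a) ^ 2)
      * claim_val s r w a j A'
  end.

(** A multiplier acts on the value at [a] as a scalar. *)
Lemma claims_ge s r w (a : Disc) j A x :
  csq a * Cmod (ev a x) ^ 2 * claim_val s r w a j A <= claims s r w j A nrm2 x.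
Proof.
elim: A x => /= [x|i A IH x]; first by have := ev_bound a x; rewrite /=; lra.
case: Nat.eq_dec => _.
- have := IH (act (s i) x); rewrite ev_act Cmod_mult /=; lra.
- have := IH (act (r i) x); have := IH (act (s i) (act (w j i) x)).
  rewrite !ev_act !Cmod_mult /=; lra.
Qed.

Lemma weighted_bessel s r w (a : nat -> Disc) (L : list nat) x :
  fair w -> (forall i, circle_pair (s i) (r i)) -> NoDup L ->
  sumR L (fun j => csq (a j) * Cmod (ev (a j) x) ^ 2 * claim_val s r w (a j) j L)
  <= nrm2 x.
Proof.
move=> hw hsr hL.
have := claims_le s r w nrm2 L nil hw hsr Toeplitz_nrm2 nrm2_ge0 hL (NoDup_nil _)
          (fun _ _ h => h) x.
rewrite [sumR nil _]/= Rplus_0_r; apply: Rle_trans.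
apply: sumR_le => j _; exact: claims_ge.
Qed.

(** * Separation of points and the multipliers *)

Lemma csq_lt_2D (a z : Disc) : csq z <= 2 * Cmod (1 - Cconj a * z)%C.
Proof.
have h := Cmod_triangle (1 - Cconj a * z)%C (Cconj a * z)%C.
have e : (1 - Cconj a * z + Cconj a * z)%C = 1%C by ring.
rewrite e Cmod_1 Cmod_mult Cmod_conj in h.
have ha := disc_lt a; have hz := disc_lt z.
have ha0 := Cmod_ge_0 a; have hz0 := Cmod_ge_0 z.
by rewrite /csq; nra.
Qed.

Lemma Cmod_D_sym (a z : C) : Cmod (1 - Cconj a * z)%C = Cmod (1 - Cconj z * a)%C.
Proof.
rewrite -(Cmod_conj (1 - Cconj a * z)%C) Cminus_conj Cmult_conj Cconj_conj.
congr Cmod; rewrite Cconj_RtoC.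
ring.
Qed.

Lemma D_gt0 (a z : Disc) : 0 < Cmod (1 - Cconj a * z)%C.
Proof. apply/Cmod_gt_0; exact: disc_neq0. Qed.

(** This is [1 - rho(a,z)^2] for the pseudohyperbolic distance [rho], and also the
    squared modulus of a Gram entry. *)
Definition gram_sq (a z : C) : R := csq a * csq z / Cmod (1 - Cconj a * z)%C ^ 2.

Lemma gram_sq_gt0 (a z : Disc) : 0 < gram_sq a z.
Proof.
have := csq_gt0 a; have := csq_gt0 z; have := D_gt0 a z => h1 h2 h3.
apply: Rdiv_lt_0_compat; [exact: Rmult_lt_0_compat | exact: pow_lt].
Qed.

Lemma gram_sq_sym (a z : C) : gram_sq a z = gram_sq z a.
Proof. by rewrite /gram_sq Cmod_D_sym (Rmult_comm (csq a)). Qed.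

Lemma Cmod_sqr_D (a z : C) (t : R) :
  Cmod (1 - RtoC t * Cconj a * z)%C ^ 2 =
  1 - 2 * t * Re (Cconj a * z)%C + t ^ 2 * (Cmod a ^ 2 * Cmod z ^ 2).
Proof. rewrite !Cmod2_alt /Re /Im; case: a => a1 a2; case: z => z1 z2 /=; ring. Qed.

Lemma Cmod_sqr_D1 (a z : C) :
  Cmod (1 - Cconj a * z)%C ^ 2 = 1 - 2 * Re (Cconj a * z)%C + Cmod a ^ 2 * Cmod z ^ 2.
Proof.
have := Cmod_sqr_D a z 1; rewrite Cmult_1_l => ->; ring.
Qed.

(** Moving [a] radially to [blend e a * a] multiplies its distance from the circle
    by about [1 / e] when that distance is small compared with [e]; the precise
    value is the one for which [claim_self] holds. *)
Definition blend (e : R) (a : C) : R := e / (csq a + e * (1 - csq a)).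

Lemma blend_bounds (e : R) (a : Disc) : 0 < e < 1 ->
  0 < blend e a < 1 /\ 1 - blend e a <= csq a / e /\
  (1 - blend e a) = (1 - e) * (1 - blend e a * Cmod a ^ 2).
Proof.
move=> he.
have hc := csq_gt0 a.
have hc1 : csq a <= 1 by rewrite /csq; have := pow2_ge_0 (Cmod a); lra.
have hd : 0 < csq a + e * (1 - csq a) by nra.
have ea : Cmod a ^ 2 = 1 - csq a by rewrite /csq; ring.
rewrite ea /blend; split; [split|split].
- by apply: Rdiv_lt_0_compat; lra.
- by apply/Rlt_div_l; nra.
- apply/Rle_div_r; first by lra.
  have -> : (1 - e / (csq a + e * (1 - csq a))) * e =
    csq a * ((1 - e) * e / (csq a + e * (1 - csq a))) by field; lra.
  have : (1 - e) * e / (csq a + e * (1 - csq a)) <= 1 by apply/Rle_div_l; nra.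
  nra.
- by field; lra.
Qed.

Lemma blend_disc (e : R) (a : Disc) : 0 < e < 1 -> Cmod (RtoC (blend e a) * a)%C < 1.
Proof.
move=> he; have [[h1 h2] _] := blend_bounds e a he.
rewrite Cmod_mult Cmod_R Rabs_pos_eq; last by lra.
have := disc_lt a; have := Cmod_ge_0 a; nra.
Qed.

Definition shrink (e : R) (he : 0 < e < 1) (a : Disc) : Disc :=
  exist _ (RtoC (blend e a) * a)%C (blend_disc e a he).

(** On the circle [|claim_mult|^2 + |pass_mult|^2 = 1], and [pass_mult] is small
    only at distance less than about [(1 - |a|) / e] from [a]. *)
Definition claim_mult (e : R) (he : 0 < e < 1) (a : Disc) : mult :=
  Mult (RtoC (sqrt ((1 - blend e a) * (1 - blend e a * Cmod a ^ 2)))) 0%C (shrink e he a).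
Definition pass_mult (e : R) (he : 0 < e < 1) (a : Disc) : mult :=
  Mult (RtoC (sqrt (blend e a))) (- (RtoC (sqrt (blend e a)) * Cconj a))%C (shrink e he a).

Lemma claim_pass (e : R) (he : 0 < e < 1) (a : Disc) :
  circle_pair (claim_mult e he a) (pass_mult e he a).
Proof.
have [[h1 h2] _] := blend_bounds e a he.
have ha := disc_lt a; have ha0 := Cmod_ge_0 a.
split => //; split; rewrite /=.
- rewrite Copp_conj Cmult_conj Cconj_conj.
  rewrite Cconj_RtoC.
  rewrite Cconj_RtoC.
  have -> : RtoC (blend e a) = (RtoC (sqrt (blend e a)) * RtoC (sqrt (blend e a)))%C.
    by rewrite -RtoC_mult sqrt_sqrt //; lra.
  ring.
- rewrite Cmod_opp !Cmod_mult Cmod_conj !Cmod_R Rabs_R0.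
  have hs : 0 <= (1 - blend e a) * (1 - blend e a * Cmod a ^ 2) by apply: Rmult_le_pos; nra.
  rewrite (Rabs_pos_eq (sqrt _)); last exact: sqrt_pos.
  rewrite (Rabs_pos_eq (sqrt _)); last exact: sqrt_pos.
  rewrite (Rabs_pos_eq (blend e a)); last by lra.
  have e1 := sqrt_sqrt _ hs.
  have e2 := sqrt_sqrt (blend e a) (Rlt_le _ _ h1).
  move: e1 e2; rewrite /=.
  set s := sqrt ((1 - _) * _); set b := sqrt (blend e a) => e1 e2.
  nra.
Qed.

Lemma Cmod_div2 (a b : C) : b <> 0%C -> Cmod (a / b)%C ^ 2 = Cmod a ^ 2 / Cmod b ^ 2.
Proof.
move=> h; rewrite Cmod_div //; field.
by move/Cmod_eq_0.
Qed.

Lemma shrink_D (e : R) (he : 0 < e < 1) (a z : Disc) :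
  (1 - Cconj (shrink e he a) * z)%C = (1 - RtoC (blend e a) * Cconj a * z)%C.
Proof.
rewrite /= Cmult_conj.
rewrite Cconj_RtoC.
by [].
Qed.

Lemma claim_val_sqr e he (a z : Disc) :
  Cmod (mval (claim_mult e he a) z) ^ 2 =
  (1 - blend e a) * (1 - blend e a * Cmod a ^ 2) /
  Cmod (1 - RtoC (blend e a) * Cconj a * z)%C ^ 2.
Proof.
have [[h1 h2] _] := blend_bounds e a he.
have ha := disc_lt a; have ha0 := Cmod_ge_0 a.
rewrite /mval Cmod_div2 /=; last exact: (disc_neq0 (shrink e he a) z).
have -> : (1 - Cconj (RtoC (blend e a) * a) * z)%C = (1 - RtoC (blend e a) * Cconj a * z)%C.
  exact: (shrink_D e he a z).
congr Rdiv.
rewrite Cmult_0_l Cplus_0_r Cmod_R Rabs_pos_eq; last exact: sqrt_pos.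
have hs : 0 <= (1 - blend e a) * (1 - blend e a * Cmod a ^ 2) by apply: Rmult_le_pos; nra.
by have := sqrt_sqrt _ hs; rewrite /=; lra.
Qed.

Lemma pass_val_sqr e he (a z : Disc) :
  Cmod (mval (pass_mult e he a) z) ^ 2 =
  blend e a * Cmod (1 - Cconj a * z)%C ^ 2 /
  Cmod (1 - RtoC (blend e a) * Cconj a * z)%C ^ 2.
Proof.
have [[h1 h2] _] := blend_bounds e a he.
rewrite /mval Cmod_div2; last exact: (disc_neq0 (shrink e he a) z).
rewrite shrink_D; congr Rdiv; rewrite /=.
have -> : (sqrt (blend e a) + - (sqrt (blend e a) * Cconj a) * z)%C =
          (RtoC (sqrt (blend e a)) * (1 - Cconj a * z))%C by ring.
rewrite Cmod_mult Cmod_R Rabs_pos_eq; last exact: sqrt_pos.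
have := sqrt_sqrt (blend e a) (Rlt_le _ _ h1).
set b := sqrt _ => <-; ring.
Qed.

Lemma shrink_D_ge (a z : Disc) (t : R) : 0 < t < 1 ->
  Cmod (1 - Cconj a * z)%C <= 2 * Cmod (1 - RtoC t * Cconj a * z)%C /\
  1 - t * Cmod a <= Cmod (1 - RtoC t * Cconj a * z)%C.
Proof.
move=> ht.
have ha := disc_lt a; have ha0 := Cmod_ge_0 a.
have hz := disc_lt z; have hz0 := Cmod_ge_0 z.
have h1 := Cmod_triangle (1 - RtoC t * Cconj a * z)%C (RtoC t * Cconj a * z)%C.
have e1 : (1 - RtoC t * Cconj a * z + RtoC t * Cconj a * z)%C = 1%C by ring.
rewrite e1 Cmod_1 !Cmod_mult Cmod_conj Cmod_R Rabs_pos_eq in h1; last by lra.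
have h2 := Cmod_triangle (1 - RtoC t * Cconj a * z)%C (- (RtoC (1 - t) * (Cconj a * z)))%C.
have e2 : (1 - RtoC t * Cconj a * z + - (RtoC (1 - t) * (Cconj a * z)))%C = (1 - Cconj a * z)%C.
  by rewrite RtoC_minus; ring.
rewrite e2 Cmod_opp !Cmod_mult Cmod_conj Cmod_R Rabs_pos_eq in h2; last by lra.
have haz : Cmod a * Cmod z <= Cmod a by nra.
split; last by nra.
have : (1 - t) * (Cmod a * Cmod z) <= 1 - t * (Cmod a * Cmod z) by nra.
nra.
Qed.

Lemma claim_self e he (a : Disc) : Cmod (mval (claim_mult e he a) a) ^ 2 = 1 - e.
Proof.
have [[h1 h2] [_ h3]] := blend_bounds e a he.
have ha := disc_lt a; have ha0 := Cmod_ge_0 a.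
rewrite claim_val_sqr Cmod_sqr_D.
have -> : Re (Cconj a * a)%C = Cmod a ^ 2.
  by rewrite Cmult_comm -Cmod2_conj.
rewrite h3; set p := Cmod a ^ 2.
have hp : blend e a * p < 1 by rewrite /p; nra.
have -> : 1 - 2 * blend e a * p + blend e a ^ 2 * (p * p) = (1 - blend e a * p) ^ 2 by ring.
by field; lra.
Qed.

(** The two squared moduli add up to one on the circle; inside, the deficit is
    proportional to [1 - |z|^2]. *)
Lemma claim_pass_defect e he (a z : Disc) :
  0 <= 1 - Cmod (mval (pass_mult e he a) z) ^ 2 - Cmod (mval (claim_mult e he a) z) ^ 2
  <= 4 * gram_sq a z / e.
Proof.
have [[h1 h2] [h3 _]] := blend_bounds e a he.
have ha := disc_lt a; have ha0 := Cmod_ge_0 a.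
have hz := disc_lt z; have hz0 := Cmod_ge_0 z.
have [hE _] := shrink_D_ge a z (blend e a) (conj h1 h2).
have hD := D_gt0 a z; have hcz := csq_gt0 z; have hca := csq_gt0 a.
rewrite claim_val_sqr pass_val_sqr.
have eE := Cmod_sqr_D a z (blend e a).
have eD := Cmod_sqr_D1 a z.
set E := Cmod (1 - RtoC (blend e a) * Cconj a * z)%C in hE eE *.
set D := Cmod (1 - Cconj a * z)%C in hE hD eD *.
have hE0 : 0 < E by lra.
have key : 1 - blend e a * D ^ 2 / E ^ 2
   - (1 - blend e a) * (1 - blend e a * Cmod a ^ 2) / E ^ 2
   = (1 - blend e a) * (blend e a * Cmod a ^ 2) * csq z / E ^ 2.
  apply: (Rmult_eq_reg_r (E ^ 2)); last by have : 0 < E ^ 2 by [apply: pow_lt]; lra.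
  have -> : (1 - blend e a * D ^ 2 / E ^ 2 -
   (1 - blend e a) * (1 - blend e a * Cmod a ^ 2) / E ^ 2) * E ^ 2 =
   E ^ 2 - blend e a * D ^ 2 - (1 - blend e a) * (1 - blend e a * Cmod a ^ 2)
   by field; lra.
  have -> : (1 - blend e a) * (blend e a * Cmod a ^ 2) * csq z / E ^ 2 * E ^ 2 =
    (1 - blend e a) * (blend e a * Cmod a ^ 2) * csq z by field; lra.
  by rewrite eE eD /csq; ring.
rewrite key; set t := blend e a in h1 h2 h3 key *.
have hp : 0 <= t * Cmod a ^ 2 <= 1.
  have : 0 <= Cmod a ^ 2 <= 1 by nra.
  nra.
split.
- apply: Rdiv_le_0_compat; last exact: pow_lt.
  apply: Rmult_le_pos; last by lra.
  by apply: Rmult_le_pos; lra.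
- have h5 : (1 - t) * (t * Cmod a ^ 2) * csq z <= csq a / e * csq z.
    apply: Rmult_le_compat_r; first by lra.
    have : 0 <= csq a / e by apply: Rdiv_le_0_compat; lra.
    nra.
  apply/Rle_div_l; first exact: pow_lt.
  apply: (Rle_trans _ _ _ h5).
  have -> : 4 * gram_sq a z / e * E ^ 2 = csq a / e * csq z * (4 * E ^ 2 / D ^ 2).
    by rewrite /gram_sq -/D; field; lra.
  have : 1 <= 4 * E ^ 2 / D ^ 2.
    by apply/Rle_div_r; [exact: pow_lt | nra].
  have : 0 <= csq a / e * csq z.
    apply: Rmult_le_pos; last by lra.
    by apply: Rdiv_le_0_compat; lra.
  nra.
Qed.

Lemma claim_val_le e he (a z : Disc) :
  Cmod (mval (claim_mult e he a) z) ^ 2 <= 4 * csq a / (e * Cmod (1 - Cconj a * z)%C).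
Proof.
have [[h1 h2] [h3 _]] := blend_bounds e a he.
have ha := disc_lt a; have ha0 := Cmod_ge_0 a.
have [hE hE2] := shrink_D_ge a z (blend e a) (conj h1 h2).
have hD := D_gt0 a z; have hca := csq_gt0 a.
rewrite claim_val_sqr.
set E := Cmod (1 - RtoC (blend e a) * Cconj a * z)%C in hE hE2 *.
set D := Cmod (1 - Cconj a * z)%C in hE hD *.
set t := blend e a in h1 h2 h3 hE2 *.
have hE0 : 0 < E by lra.
have h4 : 1 - t * Cmod a ^ 2 <= 2 * E.
  have : 0 <= (1 - t * Cmod a) ^ 2 by exact: pow2_ge_0.
  have : t ^ 2 * Cmod a ^ 2 <= t * Cmod a ^ 2 by have := pow2_ge_0 (Cmod a); nra.
  nra.
have h5 : (1 - t) * (1 - t * Cmod a ^ 2) <= csq a / e * (2 * E).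
  apply: Rmult_le_compat => //; first by lra.
  have : Cmod a ^ 2 < 1 by nra.
  nra.
apply/Rle_div_l; first exact: pow_lt.
apply: (Rle_trans _ _ _ h5).
have -> : 4 * csq a / (e * D) * E ^ 2 = csq a / e * (2 * E) * (2 * E / D).
  by field; lra.
have : 1 <= 2 * E / D by apply/Rle_div_r; lra.
have : 0 <= csq a / e * (2 * E).
  by apply: Rmult_le_pos; [apply: Rdiv_le_0_compat; lra | lra].
nra.
Qed.

(** ** The duel between two points *)

Definition duel_m (a z : C) : R := 1 + (Cmod a ^ 2 + Cmod z ^ 2) / 2.
(** The larger root [w] of [w^2 - 2 m w + |a + z|^2 = 0].  With [g = (a + z) / w] it
    gives the factorization [|1 - conj(a) x|^2 + |1 - conj(z) x|^2 = w |1 - conj(g) x|^2]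
    on the circle. *)
Definition duel_w (a z : C) : R :=
  duel_m a z + sqrt (Cmod (1 - Cconj a * z)%C ^ 2 + (Cmod a ^ 2 - Cmod z ^ 2) ^ 2 / 4).

Lemma duel_w_sym a z : duel_w a z = duel_w z a.
Proof.
rewrite /duel_w /duel_m Cmod_D_sym; congr Rplus; first by field.
by congr sqrt; field.
Qed.

Lemma duel_w_bounds (a z : Disc) :
  2 <= duel_w a z <= 2 + 2 * Cmod (1 - Cconj a * z)%C /\
  duel_w a z ^ 2 + Cmod (a + z)%C ^ 2 = 2 * duel_m a z * duel_w a z.
Proof.
have hD := D_gt0 a z.
have h1 := csq_lt_2D a z.
have h2 : csq a <= 2 * Cmod (1 - Cconj a * z)%C.
  by rewrite Cmod_D_sym; exact: csq_lt_2D.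
have hca := csq_gt0 a; have hcz := csq_gt0 z.
have eD := Cmod_sqr_D1 a z.
have es : Cmod (a + z)%C ^ 2 = Cmod a ^ 2 + Cmod z ^ 2 + 2 * Re (Cconj a * z)%C.
  by rewrite !Cmod2_alt; case: (disc_val a) => a1 a2; case: (disc_val z) => z1 z2; rewrite /Re /Im /=; ring.
have em : (csq a + csq z) / 2 <= Cmod (1 - Cconj a * z)%C.
  have h := Cmod_triangle (1 - Cconj a * z)%C (Cconj a * z)%C.
  have e : (1 - Cconj a * z + Cconj a * z)%C = 1%C by ring.
  rewrite e Cmod_1 Cmod_mult Cmod_conj in h.
  rewrite /csq; have := pow2_ge_0 (Cmod a - Cmod z); nra.
move: h1 h2 hca hcz eD em; rewrite /duel_w /duel_m /csq.
set D := Cmod (1 - Cconj a * z)%C in hD *.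
set p := Cmod a ^ 2 in es *; set q := Cmod z ^ 2 in es *.
move=> h1 h2 hca hcz eD em.
have hs0 : 0 <= D ^ 2 + (p - q) ^ 2 / 4.
  have := pow2_ge_0 D; have := pow2_ge_0 (p - q); lra.
have hs := sqrt_sqrt _ hs0; have hsp := sqrt_pos (D ^ 2 + (p - q) ^ 2 / 4).
set s := sqrt _ in hs hsp *.
have hp : 0 <= p by exact: pow2_ge_0.
have hq : 0 <= q by exact: pow2_ge_0.
have hsD : D <= s by apply: Rsqr_incr_0_var => //; rewrite /Rsqr; have := pow2_ge_0 (p - q); nra.
have hsD2 : s <= 2 * D.
  apply: Rsqr_incr_0_var; last by lra.
  rewrite /Rsqr; have : (p - q) ^ 2 <= (2 * D) ^ 2.
    by apply: pow_maj_Rabs; apply: Rabs_le; lra.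
  nra.
split; first by lra.
rewrite es.
have -> : 2 * Re (Cconj a * z)%C = 1 + p * q - D ^ 2 by rewrite eD; ring.
nra.
Qed.

Lemma duel_disc (a z : Disc) : Cmod ((a + z) / RtoC (duel_w a z))%C < 1.
Proof.
have [[h1 h2] _] := duel_w_bounds a z.
have hw : RtoC (duel_w a z) <> 0%C by move/RtoC_inj; lra.
rewrite Cmod_div // Cmod_R Rabs_pos_eq; last by lra.
apply/Rlt_div_l; first by lra.
have := Cmod_triangle a z; have := disc_lt a; have := disc_lt z; lra.
Qed.

Definition duel_pole (a z : Disc) : Disc := exist _ _ (duel_disc a z).

(** The amplitude for [a] to beat [z]: on the circle its squared modulus is
    [|1 - conj(z) x|^2 / (|1 - conj(a) x|^2 + |1 - conj(z) x|^2)], so the nearer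
    point tends to win. *)
Definition duel (a z : Disc) : mult :=
  Mult (RtoC (/ sqrt (duel_w a z))) (- (RtoC (/ sqrt (duel_w a z)) * Cconj z))%C
       (duel_pole a z).

Lemma duel_pole_sym a z : duel_pole a z = duel_pole z a.
Proof.
rewrite /duel_pole; apply: eq_sig_hprop => [x p q|/=]; first exact: proof_irrelevance.
by rewrite duel_w_sym Cplus_comm.
Qed.

Lemma duel_pair (a z : Disc) : circle_pair (duel a z) (duel z a).
Proof.
have [[h1 h2] h3] := duel_w_bounds a z.
have hw : RtoC (duel_w a z) <> 0%C by move/RtoC_inj; lra.
split; first exact: duel_pole_sym.
rewrite /= -(duel_w_sym a z).
set w := duel_w a z in h1 h2 h3 hw *.
have hs := sqrt_sqrt w ltac:(lra); have hs0 : 0 < sqrt w by apply: sqrt_lt_R0; lra.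
have er : / sqrt w * / sqrt w = / w by rewrite -Rinv_mult hs.
split.
- rewrite !Copp_conj !Cmult_conj !Cconj_conj.
  rewrite Cconj_RtoC.
  have -> : (RtoC (/ sqrt w) * - (RtoC (/ sqrt w) * z) + RtoC (/ sqrt w) * - (RtoC (/ sqrt w) * a))%C =
    (- (RtoC (/ sqrt w) * RtoC (/ sqrt w)) * (a + z))%C by ring.
  rewrite -RtoC_mult er RtoC_inv; last by lra.
  by field.
- rewrite !Cmod_opp !Cmod_mult !Cmod_conj !Cmod_R.
  rewrite (Rabs_pos_eq (/ sqrt w)); last by apply: Rlt_le; exact: Rinv_0_lt_compat.
  rewrite Rmult_1_r.
  rewrite Cmod_inv // Cmod_R Rabs_pos_eq; last by lra.
  have e2 : (Cmod (a + z)%C * / w) * (Cmod (a + z)%C * / w * 1) =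
     (Cmod (a + z)%C ^ 2) * (/ w * / w) by ring.
  rewrite e2.
  have -> : Cmod (a + z)%C ^ 2 = 2 * duel_m a z * w - w ^ 2 by lra.
  have -> : (2 * duel_m a z * w - w ^ 2) * (/ w * / w) = 2 * duel_m a z / w - 1.
    by field; lra.
  apply: Req_le.
  transitivity ((/ sqrt w * / sqrt w) * (2 + Cmod a ^ 2 + Cmod z ^ 2)); first by ring.
  by rewrite er /duel_m; field; lra.
Qed.

Lemma duel_val_sqr (a z x : Disc) :
  Cmod (mval (duel a z) x) ^ 2 =
  Cmod (1 - Cconj z * x)%C ^ 2 /
  (duel_w a z * Cmod (1 - Cconj (duel_pole a z) * x)%C ^ 2).
Proof.
have [[h1 h2] h3] := duel_w_bounds a z.
rewrite /mval Cmod_div2; last exact: (disc_neq0 (duel_pole a z) x).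
have hp := D_gt0 (duel_pole a z) x.
have -> : (num0 (duel a z) + num1 (duel a z) * x)%C =
          (RtoC (/ sqrt (duel_w a z)) * (1 - Cconj z * x))%C by rewrite /=; ring.
have hs := sqrt_sqrt (duel_w a z) ltac:(lra).
have hs0 : 0 < sqrt (duel_w a z) by apply: sqrt_lt_R0; lra.
rewrite Cmod_mult Cmod_R Rabs_pos_eq; last by apply: Rlt_le; exact: Rinv_0_lt_compat.
rewrite -{2}hs; change (pole (duel a z)) with (duel_pole a z).
by field; lra.
Qed.

(** Inside the disc the factorization behind [duel_w] acquires an error
    proportional to [1 - |a|^2], and [duel_w] itself exceeds 2 by at most
    [2 |1 - conj(z) a|]. *)
Lemma duel_self (a z : Disc) :
  0 <= 1 - Cmod (mval (duel a z) a) ^ 2 <= 4 * csq a / Cmod (1 - Cconj z * a)%C.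
Proof.
have [[h1 h2] h3] := duel_w_bounds a z.
have hw : RtoC (duel_w a z) <> 0%C by move/RtoC_inj; lra.
rewrite duel_val_sqr.
have hD := D_gt0 z a; have hc := csq_gt0 a.
have h4 := csq_lt_2D z a.
have eD := Cmod_sqr_D1 z a.
rewrite (Cmod_D_sym a z) in h2.
have eE : duel_w a z * Cmod (1 - Cconj (duel_pole a z) * a)%C ^ 2 =
  Cmod (1 - Cconj z * a)%C ^ 2 + csq a * (duel_w a z - 1 - Cmod a ^ 2).
  change (disc_val (duel_pole a z)) with ((a + z) / duel_w a z)%C.
  have -> : (1 - Cconj ((a + z) / duel_w a z) * a)%C =
            (1 - RtoC (/ duel_w a z) * Cconj (a + z) * a)%C.
    rewrite Cdiv_conj // RtoC_inv; last by lra.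
    rewrite Cconj_RtoC.
    by rewrite /Cdiv; ring.
  rewrite (Cmod_sqr_D (a + z)%C a (/ duel_w a z)).
  have -> : Re (Cconj (a + z) * a)%C = Re (Cconj z * a)%C + Cmod a ^ 2.
    by rewrite Cmod2_alt; case: (disc_val a) => a1 a2; case: (disc_val z) => z1 z2; rewrite /Re /Im /=; ring.
  move: eD h3; rewrite /csq /duel_m => eD h3.
  set w := duel_w a z in h1 h2 h3 hw *.
  have e5 : Cmod (a + z)%C ^ 2 = (2 + Cmod a ^ 2 + Cmod z ^ 2) * w - w ^ 2 by lra.
  rewrite e5 eD.
  have -> : w * (1 - 2 * / w * (Re (Cconj z * a)%C + Cmod a ^ 2) +
    (/ w) ^ 2 * (((2 + Cmod a ^ 2 + Cmod z ^ 2) * w - w ^ 2) * Cmod a ^ 2))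
   = w - 2 * (Re (Cconj z * a)%C + Cmod a ^ 2) +
     (2 + Cmod a ^ 2 + Cmod z ^ 2 - w) * Cmod a ^ 2 by field; lra.
  ring.
rewrite eE.
set D := Cmod (1 - Cconj z * a)%C in hD h4 h2 *.
have ea : Cmod a ^ 2 = 1 - csq a by rewrite /csq; ring.
rewrite ea.
set c := csq a in hc h4 *; set w := duel_w a z in h1 h2 *.
have hd : 0 <= c * (w - 1 - (1 - c)) by apply: Rmult_le_pos; lra.
have hd2 : c * (w - 1 - (1 - c)) <= c * (4 * D) by apply: Rmult_le_compat_l; lra.
have hD2 : 0 < D ^ 2 by apply: pow_lt.
set d := c * _ in hd hd2 *.
have -> : 1 - D ^ 2 / (D ^ 2 + d) = d / (D ^ 2 + d) by field; lra.
split; first by apply: Rdiv_le_0_compat; lra.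
apply/Rle_div_l; first by lra.
have -> : 4 * c / D * (D ^ 2 + d) = c * (4 * D) + 4 * c * d / D by field; lra.
have : 0 <= 4 * c * d / D.
  by apply: Rdiv_le_0_compat => //; apply: Rmult_le_pos; lra.
lra.
Qed.

(** * Finite Gram matrices of well separated points *)

Definition offdiag (a : nat -> Disc) (j i : nat) : R :=
  if Nat.eq_dec i j then 0 else gram_sq (a i) (a j).

Lemma offdiag_ge0 a j i : 0 <= offdiag a j i.
Proof. rewrite /offdiag; case: Nat.eq_dec => _; [lra | apply: Rlt_le; exact: gram_sq_gt0]. Qed.

Definition separated (a : nat -> Disc) (e : R) (L : list nat) : Prop :=
  NoDup L /\ forall j, In j L -> sumR L (offdiag a j) <= e ^ 2.

Definition nkern (a : Disc) : H := (RtoC (sqrt (csq a)) *: kern a)%H.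


(** The price that [z] pays for the competitor [a].  The claim of [a] at [z] and the
    chance that [z] loses a duel at [z] each contribute one power of
    [1 / |1 - conj(a) z|], which together give a Gram entry squared. *)
Lemma claim_factor e he (a z : Disc) :
  let f := Cmod (mval (pass_mult e he a) z) ^ 2 +
    Cmod (mval (claim_mult e he a) z) ^ 2 * Cmod (mval (duel z a) z) ^ 2 in
  1 - 20 / e * gram_sq a z <= f <= 1.
Proof.
have he' : 0 < e < 1 by exact: he.
rewrite /=.
have [h1 h2] := claim_pass_defect e he a z.
have h3 := claim_val_le e he a z.
have [h4 h5] := duel_self z a.
have hD := D_gt0 a z; have hca := csq_gt0 a; have hcz := csq_gt0 z.
move: h1 h2 h3 h4 h5.
set r := Cmod (mval (pass_mult e he a) z) ^ 2.
have hs : 0 <= Cmod (mval (claim_mult e he a) z) ^ 2 by exact: pow2_ge_0.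
move: hs; set s := Cmod (mval (claim_mult e he a) z) ^ 2.
have hw : 0 <= Cmod (mval (duel z a) z) ^ 2 by exact: pow2_ge_0.
move: hw; set w := Cmod (mval (duel z a) z) ^ 2.
change (Cmod (mval (pass_mult e he a) z) * (Cmod (mval (pass_mult e he a) z) * 1)) with r.
change (Cmod (mval (claim_mult e he a) z) * (Cmod (mval (claim_mult e he a) z) * 1)) with s.
change (Cmod (mval (duel z a) z) * (Cmod (mval (duel z a) z) * 1)) with w.
move=> hw hs h1 h2 h3 h4 h5; split; last by nra.
have h6 : s * (1 - w) <= 4 * csq a / (e * Cmod (1 - Cconj a * z)%C) *
    (4 * csq z / Cmod (1 - Cconj a * z)%C).
  by apply: Rmult_le_compat.
have e6 : 4 * csq a / (e * Cmod (1 - Cconj a * z)%C) *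
    (4 * csq z / Cmod (1 - Cconj a * z)%C) = 16 / e * gram_sq a z.
  by rewrite /gram_sq; field; lra.
rewrite e6 in h6.
have e7 : 20 / e * gram_sq a z = 4 * gram_sq a z / e + 16 / e * gram_sq a z by field; lra.
lra.
Qed.

Lemma claim_val_ge e he (a : nat -> Disc) j (A : list nat) : NoDup A ->
  let s := fun i => claim_mult e he (a i) in
  let r := fun i => pass_mult e he (a i) in
  let w := fun i k => duel (a i) (a k) in
  1 - e - 20 / e * sumR A (offdiag a j) <= claim_val s r w (a j) j A <= 1 /\
  (~ In j A -> 1 - 20 / e * sumR A (offdiag a j) <= claim_val s r w (a j) j A).
Proof.
move=> hA s r w.
have h20 : 0 < 20 / e by apply: Rdiv_lt_0_compat; lra.
elim: A hA => [_|i A IH hA]; first by split; [|move=> _]; rewrite /=; lra.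
have [hi hA'] : ~ In i A /\ NoDup A by inversion hA.
have [[h1 h2] h3] := IH hA'.
rewrite [claim_val _ _ _ _ _ _]/= [sumR _ _]/=.
set c := claim_val s r w (a j) j A in h1 h2 h3 *.
set t := sumR A (offdiag a j) in h1 h3 *.
case: Nat.eq_dec => [eij|nij].
- subst i; have h4 := h3 hi.
  have -> : offdiag a j j = 0 by rewrite /offdiag; case: Nat.eq_dec.
  have -> : Cmod (mval (s j) (a j)) * (Cmod (mval (s j) (a j)) * 1) = 1 - e.
    by have := claim_self e he (a j); rewrite /s /=.
  split; last by move=> h; case: h; left.
  have ht : 0 <= t by apply: sumR_ge0 => k _; exact: offdiag_ge0.
  rewrite Rplus_0_l.
  have : 0 <= 20 / e * t by apply: Rmult_le_pos; lra.
  move: h4; set y := 20 / e * t => h4 hy.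
  have hc0 : (1 - e) * (1 - y) <= (1 - e) * c by apply: Rmult_le_compat_l; lra.
  have hey : 0 <= e * y by apply: Rmult_le_pos; lra.
  have : (1 - e) * c <= (1 - e) * 1 by apply: Rmult_le_compat_l; lra.
  by split; lra.
- have [h4 h5] := claim_factor e he (a i) (a j).
  have -> : offdiag a j i = gram_sq (a i) (a j) by rewrite /offdiag; case: Nat.eq_dec.
  change (Cmod (mval (r i) (a j)) * (Cmod (mval (r i) (a j)) * 1) +
    Cmod (mval (s i) (a j)) * (Cmod (mval (s i) (a j)) * 1) *
    (Cmod (mval (w j i) (a j)) * (Cmod (mval (w j i) (a j)) * 1)))
    with (Cmod (mval (pass_mult e he (a i)) (a j)) ^ 2 +
     Cmod (mval (claim_mult e he (a i)) (a j)) ^ 2 *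
     Cmod (mval (duel (a j) (a i)) (a j)) ^ 2).
  set f := _ + _ * _ in h4 h5 *.
  have hf0 : 0 <= f.
    rewrite /f; have := pow2_ge_0 (Cmod (mval (pass_mult e he (a i)) (a j))).
    have := pow2_ge_0 (Cmod (mval (claim_mult e he (a i)) (a j))).
    have := pow2_ge_0 (Cmod (mval (duel (a j) (a i)) (a j))); nra.
  have hc0 : 0 <= c.
    rewrite /c; elim: (A) => [|k A' IHA] /=; first by lra.
    apply: Rmult_le_pos => //.
    case: Nat.eq_dec => _; first exact: (pow2_ge_0 (Cmod (mval (s k) (a j)))).
    have := pow2_ge_0 (Cmod (mval (r k) (a j))).
    have := pow2_ge_0 (Cmod (mval (s k) (a j))).
    have := pow2_ge_0 (Cmod (mval (w j k) (a j))); rewrite /=; nra.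
  have hfc : f + c - 1 <= f * c by nra.
  split; first by split; nra.
  move=> hn; have := h3 (fun h => hn (or_intror h)); nra.
Qed.

(** A Carleson embedding with constant close to one. *)
Lemma bessel_kernels (a : nat -> Disc) e L x : 0 < e <= / 42 -> separated a e L ->
  (1 - 21 * e) * sumR L (fun j => csq (a j) * Cmod (ev (a j) x) ^ 2) <= nrm2 x.
Proof.
move=> he [hL hs].
have he1 : 0 < e < 1 by lra.
set s := fun i => claim_mult e he1 (a i).
set r := fun i => pass_mult e he1 (a i).
set w := fun i k => duel (a i) (a k).
have hw : fair w by move=> i j _; exact: duel_pair.
have hsr i : circle_pair (s i) (r i) by exact: claim_pass.
apply: Rle_trans (weighted_bessel s r w a L x hw hsr hL).
rewrite -sumR_scal; apply: sumR_le => j hj.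
have [[h1 _] _] := claim_val_ge e he1 a j L hL.
have h2 := hs j hj.
have h3 : 20 / e * sumR L (offdiag a j) <= 20 * e.
  have : 0 < 20 / e by apply: Rdiv_lt_0_compat; lra.
  move=> h0; have -> : 20 * e = 20 / e * e ^ 2 by field; lra.
  by apply: Rmult_le_compat_l; lra.
rewrite Rmult_comm; apply: Rmult_le_compat_l; last by move: h1; rewrite -/s -/r -/w; lra.
apply: Rmult_le_pos; [have := csq_gt0 (a j); lra | exact: pow2_ge_0].
Qed.

Lemma inner_nkern (a : Disc) x : inner x (nkern a) = (RtoC (sqrt (csq a)) * ev a x)%C.
Proof.
rewrite /nkern inner_scal_r; congr Cmult; apply: C_eq => /=; ring.
Qed.

Lemma sqrt_csq_sqr (a : Disc) : Cmod (RtoC (sqrt (csq a))) ^ 2 = csq a.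
Proof.
rewrite Cmod_R -Rsqr_pow2 -Rsqr_abs Rsqr_pow2 pow2_sqrt //; have := csq_gt0 a; lra.
Qed.

Definition synth (a : nat -> Disc) (L : list nat) (c : nat -> C) : H :=
  sumH L (fun j => c j *: nkern (a j))%H.

(** Dual to [bessel_kernels]: an operator and its adjoint have the same norm. *)
Lemma synth_upper a e L c : 0 < e <= / 42 -> separated a e L ->
  (1 - 21 * e) * nrm2 (synth a L c) <= sumR L (fun j => Cmod (c j) ^ 2).
Proof.
move=> he hs.
set f := synth a L c; set N := sumR L _.
have hN : 0 <= N by apply: sumR_ge0 => j _; exact: pow2_ge_0.
have hb := bessel_kernels a e L f he hs.
set B := sumR L _ in hb.
have hB : 0 <= B.
  apply: sumR_ge0 => j _; apply: Rmult_le_pos; [have := csq_gt0 (a j); lra | exact: pow2_ge_0].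
have hf := nrm2_ge0 f.
have h1 : nrm2 f <= sumR L (fun j => Cmod (c j) * (sqrt (csq (a j)) * Cmod (ev (a j) f))).
  rewrite -Re_inner_self {2}/f /synth inner_sumH_r.
  apply: (Rle_trans _ (Cmod (sumC L (fun j => inner f (c j *: nkern (a j))%H)))).
    exact: Re_le_Cmod.
  elim: (L) => [|j l IH] /=; first by rewrite Cmod_0; lra.
  apply: Rle_trans (Cmod_triangle _ _) _; apply: Rplus_le_compat => //.
  rewrite inner_scal_r inner_nkern !Cmod_mult Cmod_conj Cmod_R Rabs_pos_eq; last exact: sqrt_pos.
  lra.
have h2 := sumR_cauchy_schwarz L (fun j => Cmod (c j)) (fun j => sqrt (csq (a j)) * Cmod (ev (a j) f)).
have eB : sumR L (fun i => (sqrt (csq (a i)) * Cmod (ev (a i) f)) ^ 2) = B.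
  apply: sumR_ext => j _; rewrite Rpow_mult_distr pow2_sqrt //; have := csq_gt0 (a j); lra.
rewrite eB in h2.
set q := sumR L (fun j => Cmod (c j) * _) in h1 h2.
have h3 : nrm2 f ^ 2 <= N * B.
  apply: Rle_trans h2; apply: pow_incr; lra.
case: (Req_dec (nrm2 f) 0) => [->|hf0]; first by lra.
have : (1 - 21 * e) * nrm2 f * nrm2 f <= N * nrm2 f.
  have : (1 - 21 * e) * (N * B) <= N * nrm2 f.
    have -> : (1 - 21 * e) * (N * B) = N * ((1 - 21 * e) * B) by ring.
    exact: Rmult_le_compat_l.
  nra.
move=> h4; apply: (Rmult_le_reg_r (nrm2 f)); lra.
Qed.

(** ** The dual system *)

Definition blaschke_mult (a : Disc) : mult := Mult (- a)%C 1%C a.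

Lemma inner_blaschke (a : Disc) x y :
  inner (act (blaschke_mult a) x) (act (blaschke_mult a) y) = inner x y.
Proof.
rewrite -{2}(lin_divide a x) -{2}(lin_divide a y) /act /=.
rewrite !inner_lin_l !inner_lin_r !inner_shift.
rewrite !Copp_conj !Cconj_conj Cconj_RtoC; ring.
Qed.

Fixpoint bprod (a : nat -> Disc) (l : list nat) (x : H) : H :=
  match l with nil => x | i :: l' => act (blaschke_mult (a i)) (bprod a l' x) end.

Lemma inner_bprod a l x y : inner (bprod a l x) (bprod a l y) = inner x y.
Proof. by elim: l => //= i l IH; rewrite inner_blaschke. Qed.

Lemma bprod_act a l m x : bprod a l (act m x) = act m (bprod a l x).
Proof. by elim: l => //= i l ->; rewrite act_comm. Qed.

Lemma bprod_remove a l k x : NoDup l -> In k l ->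
  bprod a l x = act (blaschke_mult (a k)) (bprod a (remove Nat.eq_dec k l) x).
Proof.
elim: l => //= i l IH hnd hin.
have [hi hl] : ~ In i l /\ NoDup l by inversion hnd.
case: Nat.eq_dec => [e|ne].
- by subst i; rewrite notin_remove.
- case: hin => [e|hin]; first by subst i.
  by rewrite (IH hl hin) /= act_comm.
Qed.

(** The normalized kernel times the Blaschke product of the other points: it
    vanishes at all of them. *)
Definition dual_vec (a : nat -> Disc) (L : list nat) (j : nat) : H :=
  (RtoC (sqrt (csq (a j))) *: bprod a (remove Nat.eq_dec j L) (kern (a j)))%H.

Lemma NoDup_remove_eq (l : list nat) k : NoDup l -> NoDup (remove Nat.eq_dec k l).
Proof.
elim: l => //= i l IH hnd.
have [hi hl] : ~ In i l /\ NoDup l by inversion hnd.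
case: Nat.eq_dec => _; first exact: IH.
constructor; last exact: IH.
by move=> /(in_remove _ _ _ _) [].
Qed.

(** With [u] the product of the two kernels, all four vectors are multiples of [u] by
    polynomials of degree one. *)
Lemma inner_blaschke_kern (a b : Disc) :
  inner (act (blaschke_mult b) (kern a)) (act (blaschke_mult a) (kern b)) =
  inner (kern b) (kern a).
Proof.
set u := divide b (kern a).
have eu : divide a (kern b) = u by rewrite /u /kern divide_comm.
rewrite -{2}(lin_divide b (kern a)) -{2}(lin_divide a (kern b)) /act /= eu -/u.
rewrite !inner_lin_l !inner_lin_r !inner_shift.
rewrite !Copp_conj !Cconj_conj Cconj_RtoC; ring.
Qed.

Lemma inner_dual_vec a L j l : NoDup L -> In j L -> In l L ->
  inner (dual_vec a L j) (dual_vec a L l) = inner (nkern (a l)) (nkern (a j)).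
Proof.
move=> hL hj hl.
rewrite /dual_vec /nkern !inner_scal_l !inner_scal_r.
rewrite !Cconj_RtoC.
suff -> : inner (bprod a (remove Nat.eq_dec j L) (kern (a j)))
   (bprod a (remove Nat.eq_dec l L) (kern (a l))) = inner (kern (a l)) (kern (a j)) by ring.
case: (Nat.eq_dec j l) => [e|ne].
- by subst l; rewrite inner_bprod.
- have h1 : In l (remove Nat.eq_dec j L) by apply: in_in_remove; auto.
  have h2 : In j (remove Nat.eq_dec l L) by apply: in_in_remove; auto.
  rewrite (bprod_remove a _ l _ (NoDup_remove_eq L j hL) h1).
  rewrite (bprod_remove a _ j _ (NoDup_remove_eq L l hL) h2).
  rewrite (remove_remove_comm Nat.eq_dec L l j) -!bprod_act inner_bprod.
  exact: inner_blaschke_kern.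
Qed.

Definition dual_synth (a : nat -> Disc) (L : list nat) (c : nat -> C) : H :=
  sumH L (fun j => Cconj (c j) *: dual_vec a L j)%H.

(** The dual system has the conjugate Gram matrix. *)
Lemma nrm2_dual_synth a L c : NoDup L -> nrm2 (dual_synth a L c) = nrm2 (synth a L c).
Proof.
move=> hL; apply: RtoC_inj; rewrite -!inner_self /dual_synth /synth.
rewrite !inner_sumH_l.
transitivity (sumC L (fun i => sumC L (fun j =>
   (Cconj (c i) * c j * inner (nkern (a j)) (nkern (a i)))%C))).
- apply: sumC_ext => i hi; rewrite inner_sumH_r; apply: sumC_ext => j hj.
  by rewrite inner_scal_l inner_scal_r inner_dual_vec // Cconj_conj; ring.
- rewrite sumC_swap; apply: sumC_ext => i hi; rewrite inner_sumH_r; apply: sumC_ext => j hj.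
  by rewrite inner_scal_l inner_scal_r; ring.
Qed.

Lemma blaschke_val (a z : Disc) : Cmod (mval (blaschke_mult a) z) ^ 2 = 1 - gram_sq a z.
Proof.
rewrite /mval Cmod_div2 /=; last exact: disc_neq0.
have hD := D_gt0 a z.
rewrite /gram_sq.
have eD := Cmod_sqr_D1 a z.
have -> : (- a + 1 * z)%C = (z - a)%C by ring.
have eN : Cmod (z - a)%C ^ 2 = Cmod z ^ 2 + Cmod a ^ 2 - 2 * Re (Cconj a * z)%C.
  by rewrite !Cmod2_alt; case: (disc_val a) => a1 a2; case: (disc_val z) => z1 z2; rewrite /Re /Im /=; ring.
move: eD eN hD; rewrite /csq.
set D := Cmod (1 - Cconj a * z)%C; set Nn := Cmod (z - a)%C => eD eN hD.
have -> : 1 - (1 - Cmod a ^ 2) * (1 - Cmod z ^ 2) / D ^ 2 =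
  (D ^ 2 - (1 - Cmod a ^ 2) * (1 - Cmod z ^ 2)) / D ^ 2 by field; lra.
by congr Rdiv; rewrite -[LHS]/(Nn ^ 2) eN eD; ring.
Qed.

Lemma ev_bprod_in a l k x : In k l -> ev (a k) (bprod a l x) = 0%C.
Proof.
elim: l => //= i l IH [e|h]; rewrite ev_act; last by rewrite IH // Cmult_0_r.
subst i; rewrite /mval /=.
have -> : (- a k + 1 * a k)%C = 0%C by ring.
by rewrite /Cdiv !Cmult_0_l.
Qed.

Lemma ev_bprod_ge (a : nat -> Disc) l (z : Disc) x :
  (1 - sumR l (fun i => gram_sq (a i) z)) * Cmod (ev z x) ^ 2 <= Cmod (ev z (bprod a l x)) ^ 2
  <= Cmod (ev z x) ^ 2.
Proof.
elim: l => [|i l [IH1 IH2]]; first by rewrite [sumR _ _]/= [bprod _ _ _]/=; lra.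
rewrite [sumR _ _]/= [bprod _ _ _]/= ev_act Cmod_mult Rpow_mult_distr blaschke_val.
have h0 := gram_sq_gt0 (a i) z.
have h1 : 0 <= 1 - gram_sq (a i) z by rewrite -blaschke_val; exact: pow2_ge_0.
have := pow2_ge_0 (Cmod (ev z (bprod a l x))).
move: IH1 IH2.
set y := Cmod (ev z x) ^ 2; set t := Cmod (ev z _) ^ 2; set g := gram_sq (a i) z in h0 h1 *.
set s := sumR l _ => IH1 IH2 ht; split; nra.
Qed.

Lemma sumR_remove (l : list nat) k f : NoDup l ->
  sumR (remove Nat.eq_dec k l) f = sumR l (fun i => if Nat.eq_dec i k then 0 else f i).
Proof.
elim: l => //= i l IH hnd.
have [hi hl] : ~ In i l /\ NoDup l by inversion hnd.
case: (Nat.eq_dec k i) => [e|ne] /=; rewrite IH //; case: (Nat.eq_dec i k) => [e'|ne'];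
  try ring; by [case: ne' | case: ne].
Qed.

Lemma ev_dual_synth a L c j : NoDup L -> In j L ->
  ev (a j) (dual_synth a L c) = (Cconj (c j) * ev (a j) (dual_vec a L j))%C.
Proof.
move=> hL hj; rewrite /dual_synth /ev inner_sumH_l.
have : forall l, NoDup l -> incl l L ->
   sumC l (fun i => inner (Cconj (c i) *: dual_vec a L i)%H (kern (a j))) =
   if in_dec Nat.eq_dec j l then (Cconj (c j) * inner (dual_vec a L j) (kern (a j)))%C else 0%C.
  elim=> //= i l IH hnd hinc.
  have [hi hl] : ~ In i l /\ NoDup l by inversion hnd.
  have hinc' : incl l L by move=> k hk; apply: hinc; right.
  rewrite IH // inner_scal_l.
  case: Nat.eq_dec => [e|ne].
  - subst i; case: in_dec => // _; ring.
  - have -> : inner (dual_vec a L i) (kern (a j)) = 0%C.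
      rewrite /dual_vec inner_scal_l.
      have -> : inner (bprod a (remove Nat.eq_dec i L) (kern (a i))) (kern (a j)) = 0%C.
        by apply: (ev_bprod_in a _ j); apply: in_in_remove; auto.
      ring.
    case: in_dec => _; ring.
move=> h; rewrite (h L hL (fun k hk => hk)).
by case: in_dec.
Qed.

(** Apply [bessel_kernels] to the dual combination: it has the same norm, and its
    normalized value at [a j], the one that [bessel_kernels] sums, is [conj (c j)]
    times a Blaschke product of modulus close to one. *)
Lemma synth_lower a e L c : 0 < e <= / 42 -> separated a e L ->
  (1 - 21 * e) * (1 - e ^ 2) * sumR L (fun j => Cmod (c j) ^ 2) <= nrm2 (synth a L c).
Proof.
move=> he hs; have [hL hsep] := hs.
rewrite -nrm2_dual_synth //.
apply: Rle_trans (bessel_kernels a e L _ he hs).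
rewrite Rmult_assoc; apply: Rmult_le_compat_l; first by lra.
rewrite -sumR_scal; apply: sumR_le => j hj.
rewrite ev_dual_synth // Cmod_mult Cmod_conj Rpow_mult_distr.
have hc := csq_gt0 (a j).
have h1 : csq (a j) * Cmod (ev (a j) (dual_vec a L j)) ^ 2 >= 1 - e ^ 2.
  have -> : ev (a j) (dual_vec a L j) =
     (RtoC (sqrt (csq (a j))) * ev (a j) (bprod a (remove Nat.eq_dec j L) (kern (a j))))%C.
    by rewrite /dual_vec /ev inner_scal_l.
  rewrite Cmod_mult Rpow_mult_distr sqrt_csq_sqr.
  have [h2 _] := ev_bprod_ge a (remove Nat.eq_dec j L) (a j) (kern (a j)).
  rewrite sumR_remove // in h2.
  have h3 := hsep j hj.
  have h4 : Cmod (ev (a j) (kern (a j))) ^ 2 = / csq (a j) ^ 2.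
    rewrite /ev inner_self nrm2_kern Cmod_R Rabs_pos_eq; first by rewrite pow_inv.
    by apply: Rlt_le; exact: Rinv_0_lt_compat.
  rewrite h4 in h2.
  have h5 : (1 - e ^ 2) * / csq (a j) ^ 2 <=
            Cmod (ev (a j) (bprod a (remove Nat.eq_dec j L) (kern (a j)))) ^ 2.
    apply: Rle_trans h2; apply: Rmult_le_compat_r.
      by apply: Rlt_le; apply: Rinv_0_lt_compat; exact: pow_lt.
    by move: h3; rewrite /offdiag; lra.
  have : csq (a j) * csq (a j) * ((1 - e ^ 2) * / csq (a j) ^ 2) <=
     csq (a j) * (csq (a j) *
     Cmod (ev (a j) (bprod a (remove Nat.eq_dec j L) (kern (a j)))) ^ 2).
    rewrite (Rmult_assoc (csq (a j)) (csq (a j))).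
    by do 2 (apply: Rmult_le_compat_l; first by lra).
  have -> : csq (a j) * csq (a j) * ((1 - e ^ 2) * / csq (a j) ^ 2) = 1 - e ^ 2.
    by field; lra.
  lra.
have := pow2_ge_0 (Cmod (c j)); nra.
Qed.

Lemma synth_bound a e L c : 0 < e <= / 42 -> separated a e L ->
  Rabs (nrm2 (synth a L c) - sumR L (fun j => Cmod (c j) ^ 2)) <=
  42 * e * sumR L (fun j => Cmod (c j) ^ 2).
Proof.
move=> he hs.
have h1 := synth_upper a e L c he hs; have h2 := synth_lower a e L c he hs.
have hN : 0 <= sumR L (fun j => Cmod (c j) ^ 2) by apply: sumR_ge0 => j _; exact: pow2_ge_0.
move: h1 h2 hN; set N := sumR L _; set F := nrm2 _ => h1 h2 hN.
apply: Rabs_le; split.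
- have : (1 - 42 * e) * N <= (1 - 21 * e) * (1 - e ^ 2) * N.
    by apply: Rmult_le_compat_r => //; nra.
  lra.
- have : (1 - 21 * e) * F <= (1 - 21 * e) * ((1 + 42 * e) * N).
    apply: (Rle_trans _ _ _ h1).
    have : 1 <= (1 - 21 * e) * (1 + 42 * e) by nra.
    nra.
  move=> h; have : F <= (1 + 42 * e) * N by apply: (Rmult_le_reg_l (1 - 21 * e)); lra.
  lra.
Qed.

(** * From quadratic to bilinear estimates *)

Definition form_on (L : list nat) (M : nat -> nat -> C) (x y : nat -> C) : C :=
  sumC L (fun i => sumC L (fun j => (M i j * x j * Cconj (y i))%C)).

Definition sqsum (L : list nat) (x : nat -> C) : R := sumR L (fun j => Cmod (x j) ^ 2).

Lemma sqsum_ge0 L x : 0 <= sqsum L x.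
Proof. apply: sumR_ge0 => j _; exact: pow2_ge_0. Qed.

Lemma sqsum_scal L c x : sqsum L (fun j => (c * x j)%C) = Cmod c ^ 2 * sqsum L x.
Proof. rewrite /sqsum -sumR_scal; apply: sumR_ext => j _; by rewrite Cmod_mult Rpow_mult_distr. Qed.

Lemma form_on_scal L M c d x y :
  form_on L M (fun j => (c * x j)%C) (fun j => (d * y j)%C) = (c * Cconj d * form_on L M x y)%C.
Proof.
rewrite /form_on -sumC_scal; apply: sumC_ext => i _; rewrite -sumC_scal; apply: sumC_ext => j _.
rewrite Cmult_conj; ring.
Qed.

Lemma sqsum_eq0 L x : sqsum L x <= 0 -> forall j, In j L -> x j = 0%C.
Proof.
elim: L => [_ j []|i L IH] /= h j.
have h1 := pow2_ge_0 (Cmod (x i)); have h2 := sqsum_ge0 L x.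
rewrite /sqsum /= -/(sqsum L x) in h.
case=> [<-|hj].
- apply: Cmod_eq_0; have := Cmod_ge_0 (x i); nra.
- by apply: IH => //; rewrite /= in h1; lra.
Qed.

Lemma parallelogram (a b : C) :
  Cmod (a + b)%C ^ 2 + Cmod (a - b)%C ^ 2 = 2 * Cmod a ^ 2 + 2 * Cmod b ^ 2.
Proof. rewrite !Cmod2_alt /Re /Im; case: a => a1 a2; case: b => b1 b2 /=; ring. Qed.

(** Polarization bounds the real part by the mean of the two squared norms; scaling
    both arguments to length one and rotating one of them gives the modulus. *)
Lemma hermitian_form_bound L M K :
  (forall i j, M j i = Cconj (M i j)) -> 0 <= K ->
  (forall x, Rabs (Re (form_on L M x x)) <= K * sqsum L x) ->
  forall x y, Cmod (form_on L M x y) <= K * (sqrt (sqsum L x) * sqrt (sqsum L y)).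
Proof.
move=> hM hK hq.
have hherm x y : form_on L M y x = Cconj (form_on L M x y).
  rewrite /form_on sumC_conj sumC_swap; apply: sumC_ext => i _.
  rewrite sumC_conj; apply: sumC_ext => j _; rewrite !Cmult_conj Cconj_conj hM; ring.
have hpol x y : 4 * Re (form_on L M x y) =
   Re (form_on L M (fun j => (x j + y j)%C) (fun j => (x j + y j)%C)) -
   Re (form_on L M (fun j => (x j - y j)%C) (fun j => (x j - y j)%C)).
  have hadd s : form_on L M (fun j => (x j + RtoC s * y j)%C) (fun j => (x j + RtoC s * y j)%C) =
     (form_on L M x x + RtoC s * form_on L M x y + RtoC s * form_on L M y x +
      RtoC s * RtoC s * form_on L M y y)%C.
    rewrite /form_on -!sumC_scal -!sumC_plus; apply: sumC_ext => i _.
    rewrite -!sumC_scal -!sumC_plus; apply: sumC_ext => j _.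
    rewrite Cplus_conj Cmult_conj.
    rewrite Cconj_RtoC.
    ring.
  have h1 := hadd 1; have h2 := hadd (-1).
  have -> : (fun j => (x j + y j)%C) = (fun j => (x j + RtoC 1 * y j)%C).
    by apply: functional_extensionality => j; ring.
  have -> : (fun j => (x j - y j)%C) = (fun j => (x j + RtoC (-1) * y j)%C).
    by apply: functional_extensionality => j; apply: C_eq; rewrite /Re /Im /=; ring.
  rewrite h1 h2 (hherm x y).
  move: (form_on L M x x) (form_on L M x y) (form_on L M y y) => [u1 u2] [v1 v2] [w1 w2].
  rewrite /Re /=; ring.
have hre x y : Re (form_on L M x y) <= K * (sqsum L x + sqsum L y) / 2.
  have h1 := hq (fun j => (x j + y j)%C); have h2 := hq (fun j => (x j - y j)%C).
  have h3 := hpol x y.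
  have e : sqsum L (fun j => (x j + y j)%C) + sqsum L (fun j => (x j - y j)%C) =
     2 * sqsum L x + 2 * sqsum L y.
    rewrite /sqsum -!sumR_scal -!sumR_plus; apply: sumR_ext => j _; exact: parallelogram.
  have h4 := Rle_abs (Re (form_on L M (fun j => (x j + y j)%C) (fun j => (x j + y j)%C))).
  have := Rle_abs (- Re (form_on L M (fun j => (x j - y j)%C) (fun j => (x j - y j)%C))).
  rewrite Rabs_Ropp; nra.
have hre2 x y : Re (form_on L M x y) <= K * (sqrt (sqsum L x) * sqrt (sqsum L y)).
  have hx := sqsum_ge0 L x; have hy := sqsum_ge0 L y.
  have z0 : (forall j, In j L -> x j = 0%C) \/ (forall j, In j L -> y j = 0%C) ->
     Re (form_on L M x y) = 0.
    move=> h; have -> : form_on L M x y = 0%C; last by [].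
    rewrite /form_on (sumC_ext _ _ (fun _ => (0 * 0)%C)); first by rewrite sumC_scal; ring.
    move=> i hi; rewrite (sumC_ext _ _ (fun _ => (0 * 0)%C)); first by rewrite sumC_scal; ring.
    move=> j hj; case: h => h; first by rewrite (h j hj); ring.
    rewrite (h i hi); rewrite Cconj_RtoC.
    ring.
  have hs := Rmult_le_pos _ _ (sqrt_pos (sqsum L x)) (sqrt_pos (sqsum L y)).
  case: (Rle_lt_dec (sqsum L x) 0) => hx0.
    by rewrite z0; [nra | left; exact: sqsum_eq0].
  case: (Rle_lt_dec (sqsum L y) 0) => hy0.
    by rewrite z0; [nra | right; exact: sqsum_eq0].
  have hsx := sqrt_lt_R0 _ hx0; have hsy := sqrt_lt_R0 _ hy0.
  have ex := sqrt_sqrt _ hx; have ey := sqrt_sqrt _ hy.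
  have := hre (fun j => (RtoC (/ sqrt (sqsum L x)) * x j)%C)
              (fun j => (RtoC (/ sqrt (sqsum L y)) * y j)%C).
  rewrite !sqsum_scal form_on_scal !Cmod_R.
  rewrite (Rabs_pos_eq (/ sqrt (sqsum L x))); last by apply: Rlt_le; exact: Rinv_0_lt_compat.
  rewrite (Rabs_pos_eq (/ sqrt (sqsum L y))); last by apply: Rlt_le; exact: Rinv_0_lt_compat.
  rewrite Cconj_RtoC -RtoC_mult re_scal_l.
  move: ex ey hsx hsy; set u := sqrt (sqsum L x); set v := sqrt (sqsum L y) => ex ey hu hv.
  have -> : (/ u) ^ 2 * sqsum L x = 1 by rewrite -ex; field; lra.
  have -> : (/ v) ^ 2 * sqsum L y = 1 by rewrite -ey; field; lra.
  move=> h; have : (u * v) * (/ u * / v * Re (form_on L M x y)) <= (u * v) * (K * (1 + 1) / 2).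
    by apply: Rmult_le_compat_l => //; apply: Rmult_le_pos; lra.
  have -> : (u * v) * (/ u * / v * Re (form_on L M x y)) = Re (form_on L M x y) by field; lra.
  lra.
move=> x y.
have [c [hc hz]] := Cphase (form_on L M x y).
have := hre2 (fun j => (c * x j)%C) (fun j => (RtoC 1 * y j)%C).
rewrite form_on_scal !sqsum_scal hc Cmod_1.
rewrite Cconj_RtoC.
have -> : (c * 1 * form_on L M x y)%C = RtoC (Cmod (form_on L M x y)) by rewrite -hz; ring.
by rewrite re_RtoC; have -> : 1 ^ 2 = 1 by [ring]; rewrite !Rmult_1_l.
Qed.

(** * Truncation *)

Definition trunc (n : nat) (x : H) : H := sumH (seq 0 n) (fun k => x k *: basis k)%H.

Lemma sumC_seq_pick (f : nat -> C) k n :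
  sumC (seq 0 n) (fun i => (f i * std_basis i k)%C) = if lt_dec k n then f k else 0%C.
Proof.
elim: n => [|n IH]; first by case: lt_dec => //; lia.
rewrite seq_S [(0 + n)%nat]/=.
have -> : forall l, sumC (l ++ n :: nil)%list (fun i => (f i * std_basis i k)%C) =
   (sumC l (fun i => (f i * std_basis i k)%C) + f n * std_basis n k)%C.
  by elim=> [|i l IHl] /=; [ring | rewrite IHl; ring].
rewrite IH /std_basis; case: (Nat.eq_dec k n) => [e|ne].
- subst k; case: lt_dec => h1; case: lt_dec => h2; try lia; ring.
- case: lt_dec => h1; case: lt_dec => h2; try lia; ring.
Qed.

Lemma trunc_coord n x k : (trunc n x) k = if lt_dec k n then x k else 0%C.
Proof. rewrite /trunc sumH_coord /=; exact: (sumC_seq_pick x). Qed.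

Lemma inner_trunc n x y : inner (trunc n x) y = sumC (seq 0 n) (fun k => (x k * Cconj (y k))%C).
Proof.
rewrite /trunc inner_sumH_l; apply: sumC_ext => k _.
by rewrite inner_scal_l inner_conj inner_basis.
Qed.

Lemma nrm2_trunc n x : nrm2 (trunc n x) = sqsum (seq 0 n) x.
Proof.
apply: RtoC_inj; rewrite -inner_self inner_trunc /sqsum -sumC_RtoC.
apply: sumC_ext => k /in_seq hk; rewrite trunc_coord; case: lt_dec => h; last lia.
by rewrite -Cmod2_conj.
Qed.

Lemma inner_trunc_self n x : inner x (trunc n x) = RtoC (nrm2 (trunc n x)).
Proof.
rewrite nrm2_trunc inner_conj inner_trunc /sqsum -sumC_RtoC sumC_conj.
apply: sumC_ext => k _; rewrite -Cmod2_conj; apply: C_eq => /=; ring.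
Qed.

Lemma nrm2_sub_trunc n x : nrm2 (x - trunc n x)%H = nrm2 x - sqsum (seq 0 n) x.
Proof. by rewrite nrm2_sub inner_trunc_self re_RtoC -nrm2_trunc; ring. Qed.


Lemma sumC_app {A} (l m : list A) f : sumC (l ++ m)%list f = (sumC l f + sumC m f)%C.
Proof. by elim: l => [|i l IHl] /=; [ring | rewrite IHl; ring]. Qed.

Lemma sumR_app {A} (l m : list A) f : sumR (l ++ m)%list f = sumR l f + sumR m f.
Proof. by elim: l => [|i l IHl] /=; [ring | rewrite IHl; ring]. Qed.

Lemma sumR_seq_sum_f_R0 (f : nat -> R) n : sumR (seq 0 (S n)) f = sum_f_R0 f n.
Proof.
elim: n => [|n IH]; first by rewrite /=; ring.
rewrite seq_S sumR_app IH /=; ring.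
Qed.

Lemma sqsum_le_nrm2 n (x : H) : sqsum (seq 0 n) x <= nrm2 x.
Proof. have := nrm2_ge0 (x - trunc n x)%H; rewrite nrm2_sub_trunc; lra. Qed.

Lemma trunc_lim (x : H) : is_lim_seq (fun n => nrm (x - trunc n x)%H) 0.
Proof.
have h1 : is_lim_seq (fun n => sqsum (seq 0 n) x) (nrm2 x).
  apply/is_lim_seq_incr_1.
  have := Series_correct _ (hv_l2 x); rewrite -/(nrm2 x) /is_series => h.
  apply: (is_lim_seq_ext (sum_n (fun n => Cmod (x n) ^ 2))); last exact: h.
  by move=> n; rewrite sum_n_Reals /sqsum sumR_seq_sum_f_R0.
have h2 : is_lim_seq (fun n => nrm2 (x - trunc n x)%H) (nrm2 x - nrm2 x).
  apply: (is_lim_seq_ext (fun n => nrm2 x - sqsum (seq 0 n) x)).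
    by move=> n; rewrite nrm2_sub_trunc.
  apply: is_lim_seq_minus' => //; exact: is_lim_seq_const.
rewrite Rminus_diag_eq // in h2.
rewrite -sqrt_0.
exact: (is_lim_seq_continuous sqrt _ 0 (continuity_pt_sqrt 0 (Rle_refl 0)) h2).
Qed.

Lemma le_limit_0 (u : nat -> R) (K A : R) :
  (forall n, A <= K + u n) -> is_lim_seq u 0 -> A <= K.
Proof.
move=> h hu.
have h1 : is_lim_seq (fun n => K + u n) (K + 0).
  by apply: is_lim_seq_plus' => //; exact: is_lim_seq_const.
have := is_lim_seq_le _ _ _ _ h (is_lim_seq_const A) h1.
by rewrite /= Rplus_0_r.
Qed.

Lemma inner_le_of_trunc (x z : H) (K : R) (m : nat) :
  (forall n, (m <= n)%nat -> Cmod (inner (trunc n x) z) <= K) -> Cmod (inner x z) <= K.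
Proof.
move=> h; apply: (le_limit_0 (fun n => nrm (x - trunc (n + m) x)%H * nrm z)).
- move=> n.
  have e : inner x z = (inner (x - trunc (n + m) x)%H z + inner (trunc (n + m) x) z)%C.
    by rewrite inner_sub_l; ring.
  rewrite {1}e; apply: Rle_trans (Cmod_triangle _ _) _.
  have := Cauchy_Schwarz (x - trunc (n + m) x)%H z.
  have := h (n + m)%nat ltac:(lia); lra.
- rewrite -(Rmult_0_l (nrm z)); apply: is_lim_seq_mult'; last exact: is_lim_seq_const.
  apply/(is_lim_seq_incr_n (fun n => nrm (x - trunc n x)%H) m); exact: trunc_lim.
Qed.

(** * Bounded matrices *)

Record bounded_matrix := BoundedMatrix {
  bm :> nat -> nat -> C;
  bm_row : forall i, l2 (fun j => Cconj (bm i j));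
  bm_norm : R;
  bm_norm_ge0 : 0 <= bm_norm;
  bm_bound : forall n x y, Cmod (form_on (seq 0 n) bm x y) <=
    bm_norm * (sqrt (sqsum (seq 0 n) x) * sqrt (sqsum (seq 0 n) y)) }.

Definition row (M : bounded_matrix) (i : nat) : H := mkH _ (bm_row M i).

(** Test the form on [x] and on the first [m] coordinates [y] of the product:
    [|y|^2 = <M x, y> <= K |x| |y|]. *)
Lemma matrix_coords_bound (M : bounded_matrix) (x : H) (m : nat) :
  sqsum (seq 0 m) (fun i => inner x (row M i)) <= bm_norm M ^ 2 * nrm2 x.
Proof.
set t := fun i => inner x (row M i).
set z := sumH (seq 0 m) (fun i => t i *: row M i)%H.
have hK := bm_norm_ge0 M.
have hz : inner x z = RtoC (sqsum (seq 0 m) t).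
  rewrite /z inner_sumH_r /sqsum -sumC_RtoC; apply: sumC_ext => i _.
  by rewrite inner_scal_r -/(t i) Cmult_comm -Cmod2_conj.
have hA := sqsum_ge0 (seq 0 m) t.
have h1 : Cmod (inner x z) <= bm_norm M * (nrm x * sqrt (sqsum (seq 0 m) t)).
  apply: (inner_le_of_trunc _ _ _ m) => n hn.
  set y := fun i => if lt_dec i m then t i else 0%C.
  have e : inner (trunc n x) z = form_on (seq 0 n) M x y.
    have -> : n = (m + (n - m))%nat by lia.
    rewrite /z inner_sumH_r /form_on.
    set N := (m + (n - m))%nat.
    have eN : seq 0 N = (seq 0 m ++ seq (0 + m) (n - m))%list by rewrite -seq_app.
    rewrite {1}eN sumC_app.
    have -> : sumC (seq (0 + m) (n - m)) (fun i => sumC (seq 0 N)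
       (fun j => (M i j * x j * Cconj (y i))%C)) = 0%C.
      rewrite (sumC_ext _ _ (fun _ => (0 * 0)%C)); first by rewrite sumC_scal; ring.
      move=> i /in_seq hi; rewrite /y; case: lt_dec => h; first lia.
      rewrite Cconj_RtoC.
      rewrite (sumC_ext _ _ (fun _ => (0 * 0)%C)); first by rewrite sumC_scal; ring.
      move=> j _; ring.
    rewrite Cplus_0_r; apply: sumC_ext => i /in_seq hi.
    rewrite inner_scal_r inner_trunc -sumC_scal; apply: sumC_ext => j _.
    rewrite /y; case: lt_dec => h; last lia.
    by rewrite /= Cconj_conj; ring.
  rewrite e; apply: Rle_trans (bm_bound M n x y) _.
  apply: Rmult_le_compat_l => //.
  have -> : sqsum (seq 0 n) y = sqsum (seq 0 m) t.
    rewrite /sqsum; have -> : n = (m + (n - m))%nat by lia.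
    rewrite seq_app sumR_app.
    have -> : sumR (seq (0 + m) (n - m)) (fun j => Cmod (y j) ^ 2) = 0.
      rewrite (sumR_ext _ _ (fun _ => 0 * 0)); first by rewrite sumR_scal; ring.
      move=> i /in_seq hi; rewrite /y; case: lt_dec => h; first lia.
      by rewrite Cmod_0; ring.
    rewrite Rplus_0_r; apply: sumR_ext => i /in_seq hi; rewrite /y; case: lt_dec => h //; lia.
  apply: Rmult_le_compat_r; first exact: sqrt_pos.
  by apply: sqrt_le_1_alt; exact: sqsum_le_nrm2.
rewrite hz Cmod_R Rabs_pos_eq // in h1.
have hs := sqrt_sqrt _ hA; have hs0 := sqrt_pos (sqsum (seq 0 m) t).
rewrite -nrm_sqr; have hn := nrm_ge0 x.
move: h1 hs hs0; set A := sqsum _ _; set s := sqrt A => h1 hs hs0.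
have h2 : s <= bm_norm M * nrm x.
  case: (Req_dec s 0) => [->|h0]; first by apply: Rmult_le_pos.
  by apply: (Rmult_le_reg_r s); lra.
rewrite -hs -Rpow_mult_distr; have : s * s <= (bm_norm M * nrm x) * (bm_norm M * nrm x).
  by apply: Rmult_le_compat.
lra.
Qed.

Lemma l2_op (M : bounded_matrix) (x : H) : l2 (fun i => inner x (row M i)).
Proof.
apply: (sum_f_R0_pos_incr _ (fun n => pow2_ge_0 _) (bm_norm M ^ 2 * nrm2 x)) => n.
rewrite -sumR_seq_sum_f_R0; exact: (matrix_coords_bound M x (S n)).
Qed.

Definition op (M : bounded_matrix) (x : H) : H := mkH _ (l2_op M x).

Lemma nrm2_le_of_partial (x : H) (K : R) :
  (forall n, sqsum (seq 0 n) x <= K) -> nrm2 x <= K.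
Proof.
move=> h; apply: (le_limit_0 (fun n => nrm (x - trunc n x)%H ^ 2)).
- by move=> n; rewrite nrm_sqr nrm2_sub_trunc; have := h n; lra.
- have -> : 0 = 0 * (0 * 1) by ring.
  by apply: is_lim_seq_mult'; [|apply: is_lim_seq_mult'; [|exact: is_lim_seq_const]];
     exact: trunc_lim.
Qed.

Lemma op_bound (M : bounded_matrix) (x : H) : nrm (op M x) <= bm_norm M * nrm x.
Proof.
apply: nrm_le_of_nrm2; first by apply: Rmult_le_pos; [exact: bm_norm_ge0 | exact: nrm_ge0].
rewrite Rpow_mult_distr nrm_sqr; apply: nrm2_le_of_partial => n; exact: matrix_coords_bound.
Qed.

Lemma op_add M x y : op M (x + y)%H = (op M x + op M y)%H.
Proof. by apply: H_ext => n /=; rewrite inner_add_l. Qed.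

Lemma op_scal M c x : op M (c *: x)%H = (c *: op M x)%H.
Proof. by apply: H_ext => n /=; rewrite inner_scal_l. Qed.

Lemma op_basis (M : bounded_matrix) i j : (op M (basis j)) i = M i j.
Proof. by rewrite /= inner_conj inner_basis /= Cconj_conj. Qed.

(** The two sides agree on basis vectors, hence on truncations, hence everywhere by
    continuity. *)
Lemma op_selfadjoint (M : bounded_matrix) : (forall i j, M j i = Cconj (M i j)) ->
  forall x y, inner (op M x) y = inner x (op M y).
Proof.
move=> hM x y.
have hb k : inner (op M x) (basis k) = inner x (op M (basis k)).
  rewrite inner_basis /=; congr inner; apply: H_ext => i; rewrite op_basis /=.
  by rewrite (hM k i).
have hs : forall l f, op M (sumH l f) = sumH l (fun k : nat => op M (f k)).
  move=> l f; elim: l => /= [|i l IH]; last by rewrite op_add IH.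
  by apply: H_ext => n /=; rewrite inner_zero_l.
have ht n : inner (op M x) (trunc n y) = inner x (op M (trunc n y)).
  rewrite /trunc hs !inner_sumH_r; apply: sumC_ext => k _.
  by rewrite op_scal !inner_scal_r hb.
apply/Ceq_minus/Cmod_eq_0.
apply: Rle_antisym; last exact: Cmod_ge_0.
set K := bm_norm M.
apply: (le_limit_0 (fun n => 2 * K * nrm x * nrm (y - trunc n y)%H)).
- move=> n; rewrite Rplus_0_l.
  have -> : (inner (op M x) y - inner x (op M y))%C =
    (inner (op M x) (y - trunc n y)%H - inner x (op M (y - trunc n y)%H))%C.
    have -> : op M (y - trunc n y)%H = (op M y - op M (trunc n y))%H.
      by rewrite /hsub op_add op_scal.
    by rewrite !inner_sub_r ht; ring.
  apply: Rle_trans (Cmod_triangle _ _) _; rewrite Cmod_opp.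
  have h1 := Cauchy_Schwarz (op M x) (y - trunc n y)%H.
  have h2 := Cauchy_Schwarz x (op M (y - trunc n y)%H).
  have h3 := op_bound M x; have h4 := op_bound M (y - trunc n y)%H.
  have h5 := nrm_ge0 x; have h6 := nrm_ge0 (y - trunc n y)%H.
  rewrite -/K in h3 h4.
  have : nrm (op M x) * nrm (y - trunc n y)%H <= K * nrm x * nrm (y - trunc n y)%H.
    by apply: Rmult_le_compat_r.
  have : nrm x * nrm (op M (y - trunc n y)%H) <= nrm x * (K * nrm (y - trunc n y)%H).
    by apply: Rmult_le_compat_l.
  lra.
- rewrite -(Rmult_0_r (2 * K * nrm x)); apply: is_lim_seq_mult'; first exact: is_lim_seq_const.
  exact: trunc_lim.
Qed.

(** * Singular systems of compact operators *)

Record bounded_map := BoundedMap {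
  bf :> H -> H;
  bf_add : forall x y, bf (x + y)%H = (bf x + bf y)%H;
  bf_scal : forall c x, bf (c *: x)%H = (c *: bf x)%H;
  bf_norm : R;
  bf_norm_ge0 : 0 <= bf_norm;
  bf_bound : forall x, nrm (bf x) <= bf_norm * nrm x }.

Definition compact (T : H -> H) : Prop :=
  forall (x : nat -> H) (K : R), (forall n, nrm (x n) <= K) ->
  exists (phi : nat -> nat) (y : H), (forall n, (phi n < phi (S n))%nat) /\
    is_lim_seq (fun n => nrm (T (x (phi n)) - y)%H) 0.

Definition adjoint (T Ts : H -> H) : Prop := forall x y, inner (T x) y = inner x (Ts y).

Lemma bf_sub (T : bounded_map) x y : T (x - y)%H = (T x - T y)%H.
Proof. by rewrite /hsub bf_add bf_scal. Qed.

Lemma bf_sumH {A} (T : bounded_map) (l : list A) f : T (sumH l f) = sumH l (fun k => T (f k)).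
Proof.
elim: l => /= [|i l IH]; last by rewrite bf_add IH.
have -> : hzero = (0%C *: hzero)%H by hring.
by rewrite bf_scal; hring.
Qed.

Lemma bf_zero (T : bounded_map) : T hzero = hzero.
Proof. exact: (bf_sumH T (@nil nat) (fun _ => hzero)). Qed.

Lemma phi_ge (phi : nat -> nat) : (forall n, (phi n < phi (S n))%nat) -> forall n, (n <= phi n)%nat.
Proof. move=> h; elim=> [|n IH]; [lia | have := h n; lia]. Qed.

Lemma phi_mono (phi : nat -> nat) : (forall n, (phi n < phi (S n))%nat) ->
  forall n m, (n < m)%nat -> (phi n < phi m)%nat.
Proof.
move=> h n; elim=> [|m IH] hm; first lia.
case: (Nat.eq_dec n m) => [->|ne]; [exact: h | have := h m; have := IH ltac:(lia); lia].
Qed.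

Definition perp (l : list (R * H)) (x : H) : Prop := forall p, In p l -> inner x (snd p) = 0%C.

Definition is_eig (A : H -> H) (p : R * H) : Prop :=
  A (snd p) = (RtoC (fst p ^ 2) *: snd p)%H.

Lemma perp_zero l : perp l hzero.
Proof. move=> p _; exact: inner_zero_l. Qed.

Lemma perp_scal l c x : perp l x -> perp l (c *: x)%H.
Proof. by move=> h p hp; rewrite inner_scal_l h //; ring. Qed.

Lemma adjoint_sym (T Ts : H -> H) : adjoint T Ts -> adjoint Ts T.
Proof. by move=> h x y; rewrite inner_conj -h -inner_conj. Qed.

Lemma normal_self (T Ts : H -> H) : adjoint T Ts ->
  forall x y, inner (Ts (T x)) y = inner (T x) (T y).
Proof. by move=> h x y; rewrite (adjoint_sym _ _ h). Qed.

Lemma normal_sym (T Ts : H -> H) : adjoint T Ts ->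
  forall x y, inner (Ts (T x)) y = inner x (Ts (T y)).
Proof. by move=> h x y; rewrite (normal_self _ _ h) h. Qed.

Lemma perp_normal (T Ts : H -> H) l x : adjoint T Ts ->
  (forall p, In p l -> is_eig (fun x => Ts (T x)) p) ->
  perp l x -> perp l (Ts (T x)).
Proof.
move=> h hl hx p hp; rewrite (normal_sym _ _ h) (hl p hp) inner_scal_r (hx p hp); ring.
Qed.

Lemma inv_nat_lim : is_lim_seq (fun n => / (INR n + 1)) 0.
Proof.
have h : is_lim_seq (fun n => INR (S n)) p_infty by apply/(is_lim_seq_incr_1 INR); exact: is_lim_seq_INR.
apply: (is_lim_seq_ext (fun n => / INR (S n))); first by move=> n; rewrite S_INR.
by have := is_lim_seq_inv _ _ h; apply.
Qed.

Lemma lim_sqrt0 (u : nat -> R) : is_lim_seq u 0 -> is_lim_seq (fun n => sqrt (u n)) 0.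
Proof.
move=> h; rewrite -sqrt_0.
exact: (is_lim_seq_continuous sqrt _ 0 (continuity_pt_sqrt 0 (Rle_refl 0)) h).
Qed.

Lemma lim_scal0 (c : R) (u : nat -> R) : is_lim_seq u 0 -> is_lim_seq (fun n => c * u n) 0.
Proof.
move=> h; rewrite -(Rmult_0_r c); apply: is_lim_seq_mult' => //; exact: is_lim_seq_const.
Qed.

Lemma lim_plus0 (u v : nat -> R) : is_lim_seq u 0 -> is_lim_seq v 0 ->
  is_lim_seq (fun n => u n + v n) 0.
Proof. by move=> h1 h2; rewrite -(Rplus_0_r 0); exact: is_lim_seq_plus'. Qed.

Lemma lim_sub0 (u : nat -> R) (phi : nat -> nat) : (forall n, (phi n < phi (S n))%nat) ->
  is_lim_seq u 0 -> is_lim_seq (fun n => u (phi n)) 0.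
Proof.
move=> h hu; apply: (is_lim_seq_subseq u 0 phi) => //.
by apply: eventually_subseq.
Qed.

(** A positive supremum of [|Tx|^2] on a reducing subspace is attained at an
    eigenvector: along a maximizing sequence [A x - S x] tends to 0, and
    compactness gives a limit. *)
Lemma max_eigenvector (T Ts : bounded_map) (l : list (R * H)) (S : R) :
  adjoint T Ts -> compact T ->
  (forall p, In p l -> is_eig (fun x => Ts (T x)) p) ->
  0 < S -> (forall x, perp l x -> nrm2 (T x) <= S * nrm2 x) ->
  (forall n : nat, exists x, perp l x /\ nrm2 x <= 1 /\ S - / (INR n + 1) <= nrm2 (T x)) ->
  exists v, perp l v /\ nrm2 v = 1 /\ Ts (T v) = (RtoC S *: v)%H.
Proof.
move=> hadj hcpt hl hS hle hsup.
set A := fun x => Ts (T x).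
set x := fun n => epsilon (inhabits hzero)
  (fun x => perp l x /\ nrm2 x <= 1 /\ S - / (INR n + 1) <= nrm2 (T x)).
have hx n : perp l (x n) /\ nrm2 (x n) <= 1 /\ S - / (INR n + 1) <= nrm2 (T (x n)).
  exact: epsilon_spec (hsup n).
have hx1 n : nrm (x n) <= 1.
  by apply: nrm_le_of_nrm2; [lra | have [_ [h _]] := hx n; lra].
have [phi [y [hphi hy]]] := hcpt x 1 hx1.
have hAx z : perp l z -> nrm2 (A z) <= S * nrm2 (T z).
  move=> hz.
  have e : nrm2 (A z) = Re (inner (T z) (T (A z))).
    by rewrite -Re_inner_self {1}/A (normal_self _ _ hadj).
  have h1 := Re_inner_le (T z) (T (A z)).
  have h2 := hle _ (perp_normal T Ts l z hadj hl hz).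
  rewrite -/(A z) in h2.
  have h3 := nrm2_ge0 (A z).
  rewrite -e in h1; rewrite -!nrm_sqr in h1 h2 h3 *.
  have hT := nrm_ge0 (T z); have hTA := nrm_ge0 (T (A z)).
  have h4 : (nrm (A z) ^ 2) ^ 2 <= (nrm (T z) * nrm (T (A z))) ^ 2 by apply: pow_incr.
  rewrite Rpow_mult_distr in h4.
  have h5 : (nrm (A z) ^ 2) ^ 2 <= nrm (T z) ^ 2 * (S * nrm (A z) ^ 2).
    by apply: (Rle_trans _ _ _ h4); apply: Rmult_le_compat_l => //; exact: pow2_ge_0.
  case: (Req_dec (nrm (A z) ^ 2) 0) => [->|hne].
    by apply: Rmult_le_pos; [lra | exact: pow2_ge_0].
  apply: (Rmult_le_reg_r (nrm (A z) ^ 2)); lra.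
have hdef n : nrm (A (x n) - (RtoC S *: x n))%H <= sqrt (S * / (INR n + 1)).
  have [hp [h1 h2]] := hx n.
  apply: Rsqr_incr_0_var; last exact: sqrt_pos.
  have hi : 0 < / (INR n + 1) by apply: Rinv_0_lt_compat; have := pos_INR n; lra.
  rewrite Rsqr_sqrt; last by apply: Rmult_le_pos; lra.
  rewrite Rsqr_pow2 nrm_sqr nrm2_sub nrm2_scal inner_scal_r.
  have -> : Re (Cconj (RtoC S) * inner (A (x n)) (x n))%C = S * nrm2 (T (x n)).
    rewrite /A (normal_self _ _ hadj) inner_self /=; ring.
  rewrite Cmod_R Rabs_pos_eq; last by lra.
  have := hAx _ hp; have := nrm2_ge0 (x n).
  have : S ^ 2 * nrm2 (x n) <= S ^ 2 * 1 by apply: Rmult_le_compat_l => //; exact: pow2_ge_0.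
  have : S * (S - / (INR n + 1)) <= S * nrm2 (T (x n)) by apply: Rmult_le_compat_l; lra.
  lra.
set v := (RtoC (/ S) *: Ts y)%H.
set d := fun n => nrm (x (phi n) - v)%H.
have hd : is_lim_seq d 0.
  apply: (is_lim_seq_le_le (fun _ => 0) _ (fun n => / S * (sqrt (S * / (INR (phi n) + 1)) +
      bf_norm Ts * nrm (T (x (phi n)) - y)%H))).
  - move=> n; split; first exact: nrm_ge0.
    have -> : d n = nrm (RtoC (/ S) *: ((-(1))%C *: (A (x (phi n)) - (RtoC S *: x (phi n))) +
         (Ts (T (x (phi n)) - y))))%H.
      rewrite /d; congr nrm; apply: H_ext => k.
      rewrite bf_sub /v /A /hsub /= RtoC_inv; last by lra.
      have hS0 : RtoC S <> 0%C by move/RtoC_inj; lra.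
      by field.
    rewrite nrm_scal Cmod_R Rabs_pos_eq; last by apply: Rlt_le; exact: Rinv_0_lt_compat.
    apply: Rmult_le_compat_l; first by apply: Rlt_le; exact: Rinv_0_lt_compat.
    apply: Rle_trans (nrm_add_le _ _) _.
    rewrite nrm_scal Cmod_m1 Rmult_1_l; apply: Rplus_le_compat; [exact: hdef | exact: bf_bound].
  - exact: is_lim_seq_const.
  - apply: lim_scal0; apply: lim_plus0; last by apply: lim_scal0.
    apply: lim_sqrt0; apply: lim_scal0.
    exact: (lim_sub0 (fun n => / (INR n + 1)) phi hphi inv_nat_lim).
have hperp : perp l v.
  move=> p hp; apply: Cmod_eq_0; apply: Rle_antisym; last exact: Cmod_ge_0.
  apply: (le_limit_0 (fun n => nrm (snd p) * d n)); last exact: lim_scal0.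
  move=> n; rewrite Rplus_0_l.
  have [h _] := hx (phi n).
  have -> : inner v (snd p) = (- inner (x (phi n) - v)%H (snd p))%C.
    by rewrite inner_sub_l (h p hp); ring.
  rewrite Cmod_opp Rmult_comm; exact: Cauchy_Schwarz.
have hAv : A v = (RtoC S *: v)%H.
  have hz : nrm2 (A v - (RtoC S *: v))%H <= 0.
    rewrite -nrm_sqr.
    suff -> : nrm (A v - (RtoC S *: v))%H = 0 by lra.
    apply: Rle_antisym; last exact: nrm_ge0.
    apply: (le_limit_0 (fun n => (bf_norm Ts * bf_norm T + S) * d n + sqrt (S * / (INR (phi n) + 1)))).
    + move=> n; rewrite Rplus_0_l.
      have -> : (A v - (RtoC S *: v))%H = ((RtoC S *: (x (phi n) - v)) -
         A (x (phi n) - v) + (A (x (phi n)) - (RtoC S *: x (phi n))))%H.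
        by rewrite /A !bf_sub; hring.
      apply: Rle_trans (nrm_add_le _ _) _; apply: Rplus_le_compat; last exact: hdef.
      apply: Rle_trans (nrm_sub_le _ _) _; rewrite nrm_scal Cmod_R Rabs_pos_eq; last by lra.
      have h1 := bf_bound Ts (T (x (phi n) - v)%H).
      have h2 := bf_bound T (x (phi n) - v)%H.
      have : bf_norm Ts * nrm (T (x (phi n) - v)%H) <= bf_norm Ts * (bf_norm T * nrm (x (phi n) - v)%H).
        by apply: Rmult_le_compat_l => //; exact: bf_norm_ge0.
      rewrite /A /d; lra.
    + apply: lim_plus0; first exact: lim_scal0.
      apply: lim_sqrt0; apply: lim_scal0.
      exact: (lim_sub0 (fun n => / (INR n + 1)) phi hphi inv_nat_lim).
  move/nrm2_eq0: hz => hz.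
  have -> : A v = ((A v - (RtoC S *: v)) + (RtoC S *: v))%H by hring.
  by rewrite hz; hring.
have hTv : nrm2 (T v) = S * nrm2 v.
  rewrite -!Re_inner_self -(normal_self _ _ hadj) -/(A v) hAv inner_scal_l.
  by rewrite inner_self /=; ring.
have hv1 : nrm v <= 1.
  apply: (le_limit_0 d) => // n.
  have e : v = (x (phi n) - (x (phi n) - v))%H by hring.
  rewrite {1}e; have := nrm_sub_le (x (phi n)) (x (phi n) - v)%H; have := hx1 (phi n).
  rewrite -/(d n); lra.
have hlow : S <= nrm2 (T v).
  apply: (le_limit_0 (fun n => / (INR (phi n) + 1) +
     (2 * bf_norm T * bf_norm T * d n + bf_norm T * bf_norm T * (d n * d n)))).
  - move=> n; have [_ [_ h]] := hx (phi n).
    have h1 : nrm (T (x (phi n))) <= nrm (T v) + bf_norm T * d n.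
      have e : T (x (phi n)) = (T v + T (x (phi n) - v))%H.
        by rewrite bf_sub; hring.
      rewrite e; apply: Rle_trans (nrm_add_le _ _) _.
      have := bf_bound T (x (phi n) - v)%H; rewrite -/(d n); lra.
    have h2 : nrm2 (T (x (phi n))) <= (nrm (T v) + bf_norm T * d n) ^ 2.
      by rewrite -nrm_sqr; apply: pow_incr; split; [exact: nrm_ge0|].
    have h3 : nrm (T v) <= bf_norm T.
      apply: Rle_trans (bf_bound T v) _.
      rewrite -{2}(Rmult_1_r (bf_norm T)); apply: Rmult_le_compat_l => //; exact: bf_norm_ge0.
    rewrite -(nrm_sqr (T v)).
    have hd0 : 0 <= d n by exact: nrm_ge0.
    have hk := bf_norm_ge0 T.
    have : bf_norm T * d n * nrm (T v) <= bf_norm T * d n * bf_norm T.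
      by apply: Rmult_le_compat_l => //; apply: Rmult_le_pos.
    nra.
  - apply: lim_plus0; first exact: (lim_sub0 (fun n => / (INR n + 1)) phi hphi inv_nat_lim).
    apply: lim_plus0; first exact: lim_scal0.
    apply: lim_scal0; rewrite -(Rmult_0_r 0); exact: is_lim_seq_mult'.
exists v; split => //; split => //.
have : nrm2 v <= 1 by rewrite -nrm_sqr; have := nrm_ge0 v; nra.
rewrite hTv in hlow; nra.
Qed.

Lemma singular_step (T Ts : bounded_map) (l : list (R * H)) :
  adjoint T Ts -> compact T ->
  (forall p, In p l -> is_eig (fun x => Ts (T x)) p) ->
  exists p : R * H, 0 <= fst p /\ is_eig (fun x => Ts (T x)) p /\ perp l (snd p) /\
    (fst p = 0 -> snd p = hzero) /\ (0 < fst p -> nrm2 (snd p) = 1) /\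
    (forall x, perp l x -> nrm2 (T x) <= fst p ^ 2 * nrm2 x).
Proof.
move=> hadj hcpt hl.
set E := fun r => exists x, perp l x /\ nrm2 x <= 1 /\ r = nrm2 (T x).
have hbd : bound E.
  exists (bf_norm T ^ 2) => r [x [_ [h ->]]].
  rewrite -nrm_sqr; apply: pow_incr; split; first exact: nrm_ge0.
  apply: Rle_trans (bf_bound T x) _.
  rewrite -{2}(Rmult_1_r (bf_norm T)); apply: Rmult_le_compat_l; first exact: bf_norm_ge0.
  by apply: nrm_le_of_nrm2; lra.
have h0E : E 0.
  by exists hzero; rewrite bf_zero nrm2_zero; split; [exact: perp_zero | lra].
have [S [hub hlub]] := completeness E hbd (ex_intro _ 0 h0E).
have hS0 : 0 <= S by exact: hub.
have hle x : perp l x -> nrm2 (T x) <= S * nrm2 x.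
  move=> hx; case: (Rle_lt_dec (nrm2 x) 0) => h.
    by rewrite (nrm2_eq0 x h) bf_zero nrm2_zero; lra.
  have hs : nrm x <> 0 by move=> e; move: h; rewrite -nrm_sqr e; lra.
  have hp : 0 < nrm x by have := nrm_ge0 x; lra.
  have hi : 0 <= / nrm x by apply: Rlt_le; exact: Rinv_0_lt_compat.
  have := hub (nrm2 (T (RtoC (/ nrm x) *: x)%H)).
  rewrite bf_scal nrm2_scal Cmod_R Rabs_pos_eq // => h1.
  have h2 : (/ nrm x) ^ 2 * nrm2 (T x) <= S.
    apply: h1; exists (RtoC (/ nrm x) *: x)%H; split; first exact: perp_scal.
    rewrite bf_scal !nrm2_scal Cmod_R Rabs_pos_eq //; split => //.
    by rewrite -nrm_sqr; apply: Req_le; field.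
  have : nrm2 x * ((/ nrm x) ^ 2 * nrm2 (T x)) <= nrm2 x * S by apply: Rmult_le_compat_l; lra.
  have -> : nrm2 x * ((/ nrm x) ^ 2 * nrm2 (T x)) = nrm2 (T x) by rewrite -nrm_sqr; field.
  lra.
case: (Req_dec S 0) => [e|ne].
- exists (0, hzero); rewrite /is_eig /=; split; first lra.
  split; first by rewrite !bf_zero; hring.
  split; first exact: perp_zero.
  split => //; split; first lra.
  by move=> x hx; have := hle x hx; rewrite e; lra.
- have hS : 0 < S by lra.
  have [|v [h1 [h2 h3]]] := max_eigenvector T Ts l S hadj hcpt hl hS hle.
    move=> n.
    have hi : 0 < / (INR n + 1) by apply: Rinv_0_lt_compat; have := pos_INR n; lra.
    have [h|hn] := classic (exists x, perp l x /\ nrm2 x <= 1 /\ S - / (INR n + 1) <= nrm2 (T x)).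
      exact: h.
    have : S <= S - / (INR n + 1).
      apply: hlub => r [x [hx1 [hx2 ->]]].
      apply: Rnot_lt_le => hlt; apply: hn; exists x; split => //; split => //; lra.
    lra.
  have hsq : sqrt S ^ 2 = S by apply: pow2_sqrt; lra.
  exists (sqrt S, v); rewrite /is_eig [fst _]/= [snd _]/= hsq.
  split; first exact: sqrt_pos.
  do 2 (split; first by []).
  split; last by split.
  by move=> e; have := sqrt_lt_R0 S hS; lra.
Qed.

(** Once [T] vanishes on the remaining orthogonal complement, [sg] continues with
    zeros and [vv] with zero vectors, so that finite rank is not a separate case. *)
Record sing_sys (T A : H -> H) (sg : nat -> R) (vv : nat -> H) : Prop := SingSys {
  ss_ge0 : forall n, 0 <= sg n;
  ss_decr : forall n, sg (S n) <= sg n;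
  ss_eig : forall n, A (vv n) = (RtoC (sg n ^ 2) *: vv n)%H;
  ss_orth : forall i j, i <> j -> inner (vv i) (vv j) = 0%C;
  ss_zero : forall n, sg n = 0 -> vv n = hzero;
  ss_unit : forall n, 0 < sg n -> nrm2 (vv n) = 1;
  ss_max : forall n x, (forall k, (k < n)%nat -> inner x (vv k) = 0%C) ->
     nrm2 (T x) <= sg n ^ 2 * nrm2 x;
  ss_lim : is_lim_seq sg 0 }.

Lemma singular_system (T Ts : bounded_map) : adjoint T Ts -> compact T ->
  exists sg vv, sing_sys T (fun x => Ts (T x)) sg vv.
Proof.
move=> hadj hcpt.
set A := fun x => Ts (T x).
set P := fun (l : list (R * H)) (p : R * H) =>
   0 <= fst p /\ is_eig A p /\ perp l (snd p) /\
    (fst p = 0 -> snd p = hzero) /\ (0 < fst p -> nrm2 (snd p) = 1) /\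
    (forall x, perp l x -> nrm2 (T x) <= fst p ^ 2 * nrm2 x).
set next := fun l => epsilon (inhabits (0, hzero)) (P l).
set lst := fix lst n := match n with O => nil | S k => next (lst k) :: lst k end.
have hlst n : (forall p, In p (lst n) -> is_eig A p) /\ P (lst n) (next (lst n)).
  elim: n => [|n [IH1 IH2]].
    split => //; exact: epsilon_spec (singular_step T Ts nil hadj hcpt (fun _ h => False_ind _ h)).
  have h : forall p, In p (lst (S n)) -> is_eig A p.
    by move=> p /= [<-|hp]; [case: IH2 => _ [] | exact: IH1].
  by split => //; exact: epsilon_spec (singular_step T Ts _ hadj hcpt h).
have hin n k : (k < n)%nat -> In (next (lst k)) (lst n).
  elim: n => [|n IH] hk; first lia.
  case: (Nat.eq_dec k n) => [->|ne]; [by left | right; apply: IH; lia].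
have hin2 n p : In p (lst n) -> exists k, (k < n)%nat /\ p = next (lst k).
  elim: n => [|n IH] //= [<-|h]; first by exists n; split => //; lia.
  by have [k [h1 h2]] := IH h; exists k; split => //; lia.
set sg := fun n => fst (next (lst n)); set vv := fun n => snd (next (lst n)).
have horth i j : (i < j)%nat -> inner (vv j) (vv i) = 0%C.
  by move=> hij; have [_ [_ [_ [h _]]]] := hlst j; exact: h _ (hin _ _ hij).
have hunit n : 0 < sg n -> nrm2 (vv n) = 1 by have [_ [_ [_ [_ [_ [h _]]]]]] := hlst n.
have heig n : A (vv n) = (RtoC (sg n ^ 2) *: vv n)%H by have [_ [_ [h _]]] := hlst n.
have hge n : 0 <= sg n by have [_ [h _]] := hlst n.
have hmax n x : (forall k, (k < n)%nat -> inner x (vv k) = 0%C) ->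
     nrm2 (T x) <= sg n ^ 2 * nrm2 x.
  move=> hx; have [_ [_ [_ [_ [_ [_ h]]]]]] := hlst n; apply: h => p /hin2 [k [hk ->]].
  exact: hx.
have hTv n : nrm2 (T (vv n)) = sg n ^ 2 * nrm2 (vv n).
  rewrite -!Re_inner_self -(normal_self _ _ hadj) -/(A (vv n)) heig inner_scal_l inner_self /=.
  ring.
have hdecr n : sg (S n) <= sg n.
  case: (Req_dec (sg (S n)) 0) => [->|ne] //.
  have hp : 0 < sg (S n) by have := hge (S n); lra.
  have h1 := hmax n (vv (S n)) (fun k hk => horth k (S n) ltac:(lia)).
  rewrite hTv hunit // in h1; have := hge n; nra.
have horth2 i j : i <> j -> inner (vv i) (vv j) = 0%C.
  move=> ne; case: (lt_dec i j) => h; last by apply: horth; lia.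
  by rewrite inner_conj horth //; apply: C_eq => /=; ring.
have hmono n m : (n <= m)%nat -> sg m <= sg n.
  elim: m => [|m IH] h; first by have -> : n = 0%nat by [lia]; lra.
  case: (Nat.eq_dec n (S m)) => [->|ne]; first lra.
  by have := IH ltac:(lia); have := hdecr m; lra.
exists sg, vv; split => //.
- by move=> n; have [_ [_ [_ [_ [h _]]]]] := hlst n.
- apply/is_lim_seq_spec => eps /=.
  have [[N hN]|hn] := classic (exists N, sg N < eps).
    exists N => n hn; rewrite Rminus_0_r Rabs_pos_eq //.
    by have := hmono N n hn; lra.
  (* the images of the unit vectors [vv n] would stay a fixed distance apart *)
  have hbig n : eps <= sg n by apply: Rnot_lt_le => h; apply: hn; exists n.
  have heps := cond_pos eps.
  have hb n : nrm (vv n) <= 1.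
    by apply: nrm_le_of_nrm2; [lra | rewrite hunit; [lra | have := hbig n; lra]].
  have [phi [y [hphi hy]]] := hcpt vv 1 hb.
  move/is_lim_seq_spec: hy => hy.
  have [N hN] := hy (mkposreal _ (is_pos_div_2 eps)).
  have h1 := hN N (le_n _); have h2 := hN (S N) ltac:(lia).
  rewrite /= !Rminus_0_r !Rabs_pos_eq in h1 h2; try exact: nrm_ge0.
  set a := vv (phi N) in h1; set b := vv (phi (S N)) in h2.
  have h3 : nrm (T a - T b)%H < eps.
    have -> : (T a - T b)%H = ((T a - y) - (T b - y))%H by hring.
    apply: Rle_lt_trans (nrm_sub_le _ _) _; lra.
  have h4 : nrm2 (T a - T b)%H = sg (phi N) ^ 2 + sg (phi (S N)) ^ 2.
    rewrite nrm2_sub -(normal_self _ _ hadj) -/(A a) /a heig inner_scal_l horth2;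
      last by have := hphi N; lia.
    rewrite /b !hTv !hunit; try (by have := hbig (phi N); have := hbig (phi (S N)); lra).
    by rewrite Cmult_0_r /=; ring.
  have h5 := nrm_ge0 (T a - T b)%H.
  have h6 := nrm_sqr (T a - T b)%H; rewrite h4 in h6.
  have := hbig (phi N); have := hbig (phi (S N)); nra.
Qed.

(** * Linear algebra *)

Lemma sumC_perm {A} (l l' : list A) f : Permutation l l' -> sumC l f = sumC l' f.
Proof.
elim=> //= [x m m' _ ->|x y m|m m' m'' _ -> _ ->] //; ring.
Qed.

Lemma remove_perm (l : list nat) k : NoDup l -> In k l ->
  Permutation l (k :: remove Nat.eq_dec k l).
Proof.
move=> hl hk; apply: NoDup_Permutation => //.
- constructor; [exact: remove_In | exact: NoDup_remove_eq].
- move=> x; split.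
  + move=> hx; case: (Nat.eq_dec x k) => [->|ne]; [by left | right; exact: in_in_remove].
  + by move=> [<-|/(in_remove _ _ _ _) []].
Qed.

Lemma sumC_zero {A} (l : list A) (f : A -> C) : (forall i, In i l -> f i = 0%C) -> sumC l f = 0%C.
Proof.
move=> h; rewrite (sumC_ext _ _ (fun _ => (0 * 0)%C)); first by rewrite sumC_scal; ring.
by move=> i hi; rewrite h //; ring.
Qed.

(** Gaussian elimination, one equation at a time. *)
Lemma hom_system (m : nat) : forall (E : list (nat -> C)) (J : list nat), length E = m ->
  NoDup J -> (length E < length J)%nat ->
  exists c : nat -> C, (exists j, In j J /\ c j <> 0%C) /\
    forall a, In a E -> sumC J (fun j => (a j * c j)%C) = 0%C.
Proof.
elim: m => [|m IH] [|a E] J // hm hJ hlen.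
  case: J hJ hlen => [|j J] _ /= hlen; first lia.
  exists (fun _ => 1%C); split; last by [].
  by exists j; split; [left | exact: C1_nz].
have hmE : length E = m by move: hm => /= [].
have [[k [hk ha]]|hno] := classic (exists k, In k J /\ a k <> 0%C); last first.
  have [|c [h1 h2]] := IH E J hmE hJ; first by move: hlen => /=; lia.
  exists c; split => // b [<-|hb]; last exact: h2.
  apply: sumC_zero => j hj.
  have -> : a j = 0%C by apply: NNPP => h; apply: hno; exists j.
  ring.
set J' := remove Nat.eq_dec k J.
have hp := remove_perm J k hJ hk.
have hJ' : NoDup J' by exact: NoDup_remove_eq.
have hlen' : length J = S (length J') by rewrite (Permutation_length hp).
set E' := List.map (fun b j => (b j - b k * a j / a k)%C) E.
have hE' : length E' = m by rewrite length_map.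
have [|c [[j0 [hj0 hc]] h2]] := IH E' J' hE' hJ'.
  by move: hlen; rewrite hE' hlen' /= hmE; lia.
(* eliminate the unknown [k] with the pivot [a k] *)
set d := (- sumC J' (fun j => a j * c j) / a k)%C.
exists (fun j => if Nat.eq_dec j k then d else c j); split.
- exists j0; have [hj hne] := in_remove Nat.eq_dec _ _ _ hj0; split => //.
  by case: Nat.eq_dec.
- have hs b : sumC J (fun j => (b j * (if Nat.eq_dec j k then d else c j))%C) =
     (b k * d + sumC J' (fun j => b j * c j))%C.
    rewrite (sumC_perm _ _ _ hp) [sumC _ _]/=; case: Nat.eq_dec => [_|//].
    congr Cplus; apply: sumC_ext => j hj; case: Nat.eq_dec => // e.
    by have [_ h] := in_remove Nat.eq_dec _ _ _ hj; case: h.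
  move=> b hb; rewrite hs.
  case: hb => [<-|hb]; first by rewrite /d; field.
  have := h2 _ (in_map _ _ _ hb).
  have -> : sumC J' (fun j => ((b j - b k * a j / a k) * c j)%C) =
     (sumC J' (fun j => b j * c j) + (- (b k / a k)) * sumC J' (fun j => a j * c j))%C.
    rewrite -sumC_scal -sumC_plus; apply: sumC_ext => j _; by field.
  move=> <-; rewrite /d; by field.
Qed.

Lemma lin_comb_sumC d c v n : lin_comb d c v n = sumC (seq 1 d) (fun i => (c i * v i n)%C).
Proof.
rewrite /lin_comb; elim: d => [|d IH]; first by rewrite sum_n_m_zero //; lia.
rewrite sum_n_Sm; last lia.
by rewrite seq_S sumC_app /= Cplus_0_r IH.
Qed.

Lemma sumC_map {A B} (m : list A) (g : A -> B) f :
  sumC (List.map g m) f = sumC m (fun i => f (g i)).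
Proof. by elim: m => //= i m ->. Qed.

Lemma sumC_nth (l : list nat) (f : nat -> C) :
  sumC l f = sumC (seq 1 (length l)) (fun i => f (nth (i - 1) l 0%nat)).
Proof.
rewrite -seq_shift sumC_map.
transitivity (sumC (seq 0 (length l)) (fun i => f (nth i l 0%nat))).
- elim: l => //= i l ->; congr Cplus.
  by rewrite -seq_shift sumC_map.
- by apply: sumC_ext => i _; rewrite /= Nat.sub_0_r.
Qed.

(** * Comparison of two lists of singular values *)

Definition multiplicities (A : (nat -> C) -> nat -> C) (s : nat -> R) : Prop :=
  forall mu, 0 < mu -> exists l : list nat, NoDup l /\ (forall n, In n l <-> s n = mu) /\
    has_dim (eigenspace A (mu ^ 2)) (length l).

(** Reindexing a basis of the eigenspace by the positions of [mu] in [s] lets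
    one sequence of vectors serve all eigenvalues at once. *)
Lemma eigenspace_frame A s : multiplicities A s -> forall mu, 0 < mu ->
  exists B : nat -> nat -> C, exists l, NoDup l /\ (forall n, In n l <-> s n = mu) /\
    forall x, eigenspace A (mu ^ 2) x -> exists c, forall n,
      x n = sumC l (fun k => (c k * B k n)%C).
Proof.
move=> hm mu hmu; have [l [hl [hin [v [_ [_ hspan]]]]]] := hm mu hmu.
set idx := fun k => epsilon (inhabits 0%nat) (fun i => (i < length l)%nat /\ nth i l 0%nat = k).
have hidx i : (i < length l)%nat -> idx (nth i l 0%nat) = i.
  move=> hi.
  have [h1 h2] : (idx (nth i l 0) < length l)%nat /\ nth (idx (nth i l 0%nat)) l 0%nat = nth i l 0%nat.
    by apply: (epsilon_spec (inhabits 0%nat)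
      (fun j => (j < length l)%nat /\ nth j l 0%nat = nth i l 0%nat)); exists i.
  by apply: (proj1 (NoDup_nth l 0%nat) hl).
exists (fun k => v (S (idx k))), l; split => //; split => // x hx.
have [c hc] := hspan x hx.
exists (fun k => c (S (idx k))) => n.
rewrite hc lin_comb_sumC [in RHS]sumC_nth; apply: sumC_ext => i /in_seq hi.
rewrite hidx; last lia.
by have -> : S (i - 1) = i by lia.
Qed.

Lemma decr_le (s : nat -> R) : (forall n, s (S n) <= s n) ->
  forall n m, (n <= m)%nat -> s m <= s n.
Proof.
move=> h n; elim=> [|m IH] hm; first by have -> : n = 0%nat by [lia]; lra.
case: (Nat.eq_dec n (S m)) => [->|ne]; first lra.
by have := IH ltac:(lia); have := h m; lra.
Qed.


(** If [s n < sg n], the [n + 1] orthonormal eigenvectors with values at least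
    [sg n] lie in the span of the basis vectors attached to [s 0], ..., [s (n - 1)]. *)
Lemma sing_le (T A : H -> H) sg vv (A' : (nat -> C) -> nat -> C) (s : nat -> R) :
  sing_sys T A sg vv -> (forall x : H, A' x = A x) ->
  multiplicities A' s -> (forall n, 0 <= s (S n) <= s n) ->
  forall n, sg n <= s n.
Proof.
move=> hs hA hm hdec n; apply: Rnot_lt_le => hlt.
have hmono := decr_le s (fun k => proj2 (hdec k)).
have hmono' := decr_le sg (ss_decr _ _ _ _ hs).
have hs0 k : 0 <= s k by have [h1 h2] := hdec k; lra.
have [B hB] : exists B : R -> nat -> nat -> C, forall mu, 0 < mu ->
  exists l, NoDup l /\ (forall n, In n l <-> s n = mu) /\
    forall x, eigenspace A' (mu ^ 2) x -> exists c, forall n,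
      x n = sumC l (fun k => (c k * B mu k n)%C).
  exists (fun mu => epsilon (inhabits (fun (_ _ : nat) => RtoC 0)) (fun B : nat -> nat -> C =>
    exists l, NoDup l /\ (forall n, In n l <-> s n = mu) /\
    forall x, eigenspace A' (mu ^ 2) x -> exists c, forall n,
      x n = sumC l (fun k => (c k * B k n)%C))).
  move=> mu hmu.
  exact: (epsilon_spec (inhabits (fun (_ _ : nat) => RtoC 0)) (fun B : nat -> nat -> C =>
    exists l, NoDup l /\ (forall n, In n l <-> s n = mu) /\
    forall x, eigenspace A' (mu ^ 2) x -> exists c, forall n,
      x n = sumC l (fun k => (c k * B k n)%C)) (eigenspace_frame A' s hm mu hmu)).
set b := fun k => B (s k) k.
have hcoef j : (j <= n)%nat -> exists c : nat -> C, forall i,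
   vv j i = sumC (seq 0 n) (fun k => (c k * b k i)%C).
  move=> hj; have hsj := hmono' j n hj.
  have hmu : 0 < sg j by have := hs0 n; lra.
  have [l [hl [hin hspan]]] := hB (sg j) hmu.
  have [|c hc] := hspan (vv j).
    split; first exact: hv_l2.
    by move=> i; rewrite hA (ss_eig _ _ _ _ hs).
  exists (fun k => if in_dec Nat.eq_dec k l then c k else 0%C) => i.
  have hincl k : In k l -> (k < n)%nat.
    move/hin => e; apply/Nat.nle_gt => h; have := hmono n k h; lra.
  have hp : Permutation (seq 0 n) (l ++ List.filter (fun k => if in_dec Nat.eq_dec k l then false else true) (seq 0 n)).
    apply: NoDup_Permutation; first exact: seq_NoDup.
    - apply: NoDup_app => //; first by apply: NoDup_filter; exact: seq_NoDup.
      by move=> k hk /filter_In [_]; case: in_dec.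
    - move=> k; split.
      + move=> hk; apply/in_app_iff; case: (in_dec Nat.eq_dec k l) => h; [by left|right].
        by apply/filter_In; split => //; case: in_dec.
      + by move/in_app_iff => [/hincl h|/filter_In [] //]; apply/in_seq; lia.
  rewrite (sumC_perm _ _ _ hp) sumC_app.
  rewrite (sumC_zero (List.filter _ _)); last first.
    by move=> k /filter_In [_]; case: in_dec => // _ _; ring.
  rewrite Cplus_0_r hc; apply: sumC_ext => k hk.
  case: in_dec => // _; rewrite /b; by have -> : s k = sg j by apply/hin.
set cf := fun j => epsilon (inhabits (fun _ => RtoC 0))
  (fun c : nat -> C => forall i, vv j i = sumC (seq 0 n) (fun k => (c k * b k i)%C)).
have hcf j : (j <= n)%nat -> forall i, vv j i = sumC (seq 0 n) (fun k => (cf j k * b k i)%C).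
  move=> hj; exact: (epsilon_spec (inhabits (fun _ => RtoC 0))
    (fun c : nat -> C => forall i, vv j i = sumC (seq 0 n) (fun k => (c k * b k i)%C)) (hcoef j hj)).
have [|||d [[j [hj hd]] hsys]] := hom_system n
  (List.map (fun k j => cf j k) (seq 0 n)) (seq 0 (S n)).
- by rewrite length_map length_seq.
- exact: seq_NoDup.
- by rewrite length_map !length_seq; lia.
have hcomb0 : sumH (seq 0 (S n)) (fun j => d j *: vv j)%H = hzero.
  apply: H_ext => i; rewrite sumH_coord.
  rewrite (sumC_ext _ _ (fun j => sumC (seq 0 n) (fun k => (cf j k * d j * b k i)%C))).
    rewrite sumC_swap; apply: sumC_zero => k hk.
    rewrite (sumC_ext _ _ (fun j => (b k i * (cf j k * d j))%C)); last by move=> *; ring.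
    rewrite sumC_scal.
    have -> := hsys (fun j => cf j k) (in_map (fun k j => cf j k) _ _ hk).
    ring.
  move=> q /in_seq hq; rewrite /= (hcf q); last lia.
  by rewrite -sumC_scal; apply: sumC_ext => k _; ring.
have : inner (sumH (seq 0 (S n)) (fun j => d j *: vv j)%H) (vv j) = d j.
  rewrite inner_sumH_l (sumC_perm _ _ _ (remove_perm _ j (seq_NoDup _ _) hj)) [sumC _ _]/=.
  rewrite sumC_zero.
    move/in_seq: hj => hj; have hsj := hmono' j n ltac:(lia).
    rewrite inner_scal_l inner_self (ss_unit _ _ _ _ hs); last by have := hs0 n; lra.
    ring.
  move=> k hk; have [_ hne] := in_remove Nat.eq_dec (seq 0 (S n)) k j hk.
  by rewrite inner_scal_l (ss_orth _ _ _ _ hs) //; ring.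
by rewrite hcomb0 inner_zero_l => e; apply: hd.
Qed.

(** An eigenvector orthogonal to the singular vectors of its own eigenvalue is
    orthogonal to all of them, and then [ss_max] makes it vanish. *)
Lemma sing_multiplicities (T Ts : H -> H) sg vv (A' : (nat -> C) -> nat -> C) :
  adjoint T Ts -> sing_sys T (fun x => Ts (T x)) sg vv ->
  (forall x y, Ts (T (x - y)%H) = (Ts (T x) - Ts (T y))%H) ->
  (forall x : H, A' x = Ts (T x)) ->
  multiplicities A' sg.
Proof.
move=> hadj hs hsub hA mu hmu.
set A := fun x => Ts (T x).
have hge := ss_ge0 _ _ _ _ hs.
have [N hN] : exists N, forall n, (N <= n)%nat -> sg n < mu.
  have /is_lim_seq_spec h := ss_lim _ _ _ _ hs.
  have [N hN] := h (mkposreal mu hmu); exists N => n hn.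
  by have := hN n hn; rewrite /= Rminus_0_r Rabs_pos_eq.
set l := List.filter (fun k => if Req_dec_T (sg k) mu then true else false) (seq 0 N).
have hin k : In k l <-> sg k = mu.
  rewrite /l filter_In in_seq; split.
  - by case=> _; case: Req_dec_T.
  - move=> e; split; last by case: Req_dec_T.
    split; first lia.
    by apply/Nat.nle_gt => h; have := hN k h; lra.
have hl : NoDup l by apply: NoDup_filter; exact: seq_NoDup.
exists l; split => //; split => //.
exists (fun i => vv (nth (i - 1) l 0%nat)).
have hnth i : (1 <= i <= length l)%nat -> sg (nth (i - 1) l 0%nat) = mu.
  by move=> hi; apply/hin; apply: nth_In; lia.
have hunit k : sg k = mu -> inner (vv k) (vv k) = 1%C.
  by move=> e; rewrite inner_self (ss_unit _ _ _ _ hs) //; lra.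
split; [|split].
- move=> i hi; split; first exact: hv_l2.
  by move=> n; rewrite hA (ss_eig _ _ _ _ hs) (hnth i hi).
- move=> c hc i hi.
  have hz : sumH (seq 1 (length l)) (fun i => c i *: vv (nth (i - 1) l 0%nat))%H = hzero.
    by apply: H_ext => n; rewrite sumH_coord /= -(hc n) lin_comb_sumC.
  have hi' : In i (seq 1 (length l)) by apply/in_seq; lia.
  have : inner (sumH (seq 1 (length l)) (fun i => c i *: vv (nth (i - 1) l 0%nat))%H)
               (vv (nth (i - 1) l 0%nat)) = c i.
    rewrite inner_sumH_l (sumC_perm _ _ _ (remove_perm _ i (seq_NoDup _ _) hi')) [sumC _ _]/=.
    rewrite sumC_zero.
      by rewrite inner_scal_l hunit; [ring | exact: hnth].
    move=> k hk; have [/in_seq hk1 hne] := in_remove Nat.eq_dec _ _ _ hk.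
    rewrite inner_scal_l (ss_orth _ _ _ _ hs); first ring.
    move=> e; apply: hne.
    have := proj1 (NoDup_nth l 0%nat) hl (k - 1)%nat (i - 1)%nat ltac:(lia) ltac:(lia) e.
    lia.
  by rewrite hz inner_zero_l => <-.
- move=> x [hx hAx].
  set X := mkH x hx.
  have hAX : A X = (RtoC (mu ^ 2) *: X)%H.
    by apply: H_ext => n; rewrite /A -hA /= hAx.
  set z := sumH l (fun k => inner X (vv k) *: vv k)%H.
  set y := (X - z)%H.
  have hdiff k : sg k <> mu -> inner X (vv k) = 0%C.
    move=> ne.
    have e : (RtoC (mu ^ 2) * inner X (vv k))%C = (RtoC (sg k ^ 2) * inner X (vv k))%C.
      rewrite -inner_scal_l -hAX /A (normal_sym _ _ hadj) (ss_eig _ _ _ _ hs) inner_scal_r.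
      by congr Cmult; apply: C_eq => /=; ring.
    have hne : RtoC (mu ^ 2 - sg k ^ 2) <> 0%C.
      move/RtoC_inj => h; apply: ne; have := hge k; nra.
    have h0 : (RtoC (mu ^ 2 - sg k ^ 2) * inner X (vv k))%C = 0%C.
      rewrite RtoC_minus.
      have -> : ((RtoC (mu ^ 2) - RtoC (sg k ^ 2)) * inner X (vv k))%C =
        (RtoC (mu ^ 2) * inner X (vv k) - RtoC (sg k ^ 2) * inner X (vv k))%C by ring.
      by rewrite e; ring.
    have -> : inner X (vv k) = (/ RtoC (mu ^ 2 - sg k ^ 2) *
       (RtoC (mu ^ 2 - sg k ^ 2) * inner X (vv k)))%C by field.
    by rewrite h0; ring.
  have hyp k : inner y (vv k) = 0%C.
    rewrite /y inner_sub_l /z inner_sumH_l.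
    case: (Req_dec (sg k) mu) => e.
    + have hk : In k l by apply/hin.
      rewrite (sumC_perm _ _ _ (remove_perm _ k hl hk)) [sumC _ _]/= sumC_zero.
        by rewrite inner_scal_l hunit //; ring.
      move=> i hi; have [_ hne] := in_remove Nat.eq_dec _ _ _ hi.
      by rewrite inner_scal_l (ss_orth _ _ _ _ hs) //; ring.
    + rewrite hdiff // sumC_zero; first ring.
      move=> i hi; rewrite inner_scal_l (ss_orth _ _ _ _ hs); first ring.
      by move=> ei; apply: e; rewrite -ei; apply/hin.
  have hAz : A z = (RtoC (mu ^ 2) *: z)%H.
    have hw w : inner (A z) w = inner (RtoC (mu ^ 2) *: z)%H w.
      rewrite /A (normal_sym _ _ hadj) /z inner_sumH_l inner_scal_l inner_sumH_l -sumC_scal.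
      apply: sumC_ext => k /hin hk.
      rewrite inner_scal_l -(normal_sym _ _ hadj) (ss_eig _ _ _ _ hs) hk !inner_scal_l; ring.
    apply: H_ext => n; by rewrite -!inner_basis hw.
  have hAy : A y = (RtoC (mu ^ 2) *: y)%H.
    by rewrite /A /y hsub -/(A X) -/(A z) hAX hAz; hring.
  have hTy : nrm2 (T y) = mu ^ 2 * nrm2 y.
    rewrite -!Re_inner_self -(normal_self _ _ hadj) -/(A y) hAy inner_scal_l inner_self /=; ring.
  have hy0 : y = hzero.
    apply: nrm2_eq0; apply: Rnot_lt_le => hy.
    have := ss_max _ _ _ _ hs N y (fun k _ => hyp k); rewrite hTy.
    have : sg N ^ 2 < mu ^ 2 by have := hN N (le_n _); have := hge N; nra.
    nra.
  have eX : X = z.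
    have -> : X = (y + z)%H by rewrite /y; hring.
    by rewrite hy0; hring.
  exists (fun i => inner X (vv (nth (i - 1) l 0%nat))) => n.
  rewrite lin_comb_sumC.
  have -> : x n = X n by [].
  rewrite {1}eX /z sumH_coord sumC_nth; apply: sumC_ext => i _ //.
Qed.

(** * Powers *)

Lemma rpow_ge0 x p : 0 <= rpow x p.
Proof. rewrite /rpow; case: Rlt_dec => _; [apply: Rlt_le; exact: exp_pos | lra]. Qed.

Lemma rpow_pos x p : 0 < x -> rpow x p = Rpower x p.
Proof. by move=> h; rewrite /rpow; case: Rlt_dec. Qed.

Lemma rpow_le x y p : 0 <= p -> x <= y -> rpow x p <= rpow y p.
Proof.
move=> hp hxy; rewrite {1}/rpow; case: Rlt_dec => h; last exact: rpow_ge0.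
rewrite rpow_pos; last lra.
apply: Rle_Rpower_l => //; lra.
Qed.

Lemma rpow_sqr x p : 0 <= x -> rpow (x ^ 2) (p / 2) = rpow x p.
Proof.
move=> hx; case: (Req_dec x 0) => [->|ne].
  by rewrite /rpow; case: Rlt_dec => h1; case: Rlt_dec => h2; lra.
have hx0 : 0 < x by lra.
rewrite !rpow_pos //; last exact: pow_lt.
have -> : x ^ 2 = Rpower x 2 by rewrite -(Rpower_pow 2) //; congr Rpower; rewrite /=; lra.
rewrite Rpower_mult; congr Rpower; field.
Qed.

Lemma rpow_scal c x p : 0 < c -> rpow (c * x) p = Rpower c p * rpow x p.
Proof.
move=> hc; rewrite /rpow; case: Rlt_dec => h1; case: Rlt_dec => h2.
- by rewrite Rpower_mult_distr.
- by exfalso; apply: h2; apply: (Rmult_lt_reg_l c) => //; lra.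
- by exfalso; apply: h1; apply: Rmult_lt_0_compat.
- ring.
Qed.

Lemma ln_le_sub1 y : 0 < y -> ln y <= y - 1.
Proof. move=> h; have := exp_ineq1_le (ln y); rewrite exp_ln //; lra. Qed.

(** Concavity of the logarithm at the points [x] and [1]. *)
Lemma Rpower_le_affine x a : 0 < x -> 0 < a <= 1 -> Rpower x a <= 1 + a * (x - 1).
Proof.
move=> hx ha; set m := 1 + a * (x - 1).
have hm : 0 < m by rewrite /m; nra.
have h1 := ln_le_sub1 (x / m) (Rdiv_lt_0_compat _ _ hx hm).
have h2 := ln_le_sub1 (/ m) (Rinv_0_lt_compat _ hm).
rewrite ln_div // in h1; rewrite ln_Rinv // in h2.
have e : a * (x / m - 1) + (1 - a) * (/ m - 1) = 0 by rewrite /m; field; rewrite -/m; lra.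
have h3 : a * ln x <= ln m.
  have : a * (ln x - ln m) <= a * (x / m - 1) by apply: Rmult_le_compat_l; lra.
  have : (1 - a) * (- ln m) <= (1 - a) * (/ m - 1) by apply: Rmult_le_compat_l; lra.
  lra.
rewrite /Rpower -(exp_ln m) //.
by case: h3 => [h|->]; [apply: Rlt_le; exact: exp_increasing | lra].
Qed.

Lemma bernoulli_real x q : 0 < x -> 1 <= q -> 1 + q * (x - 1) <= Rpower x q.
Proof.
move=> hx hq.
have hp : 0 < Rpower x q by exact: exp_pos.
have hi : 0 < / q by apply: Rinv_0_lt_compat; lra.
have hi1 : / q <= 1 by rewrite -Rinv_1; apply: Rinv_le_contravar; lra.
have := Rpower_le_affine (Rpower x q) (/ q) hp (conj hi hi1).
rewrite Rpower_mult Rinv_r; last lra.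
rewrite Rpower_1 // => h.
have : q * x <= q * (1 + / q * (Rpower x q - 1)) by apply: Rmult_le_compat_l; lra.
have -> : q * (1 + / q * (Rpower x q - 1)) = q + (Rpower x q - 1) by field; lra.
lra.
Qed.

Lemma rpow_tangent s t q : 0 <= s -> 0 < t -> 1 <= q ->
  rpow t q * (1 + q * (s / t - 1)) <= rpow s q.
Proof.
move=> hs ht hq; have h0 := rpow_ge0 t q.
case: (Req_dec s 0) => [->|ne].
- have := rpow_ge0 0 q; have -> : 0 / t = 0 by field; lra.
  nra.
- have hs0 : 0 < s by lra.
  have -> : rpow s q = rpow t q * Rpower (s / t) q.
    rewrite !rpow_pos // Rpower_mult_distr //; last exact: Rdiv_lt_0_compat.
    by congr Rpower; field; lra.
  apply: Rmult_le_compat_l => //.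
  by apply: bernoulli_real => //; exact: Rdiv_lt_0_compat.
Qed.

(** Compare [rpow] with its tangent at the mean [t]; the value of the tangent at 0
    is nonpositive, so missing mass only helps. *)
Lemma rpow_jensen {A} (l : list A) (w a : A -> R) q : 1 <= q ->
  (forall i, In i l -> 0 <= w i) -> (forall i, In i l -> 0 <= a i) -> sumR l w <= 1 ->
  rpow (sumR l (fun i => w i * a i)) q <= sumR l (fun i => w i * rpow (a i) q).
Proof.
move=> hq hw ha hs; set t := sumR l _.
have hr : 0 <= sumR l (fun i => w i * rpow (a i) q).
  by apply: sumR_ge0 => i hi; apply: Rmult_le_pos; [exact: hw | exact: rpow_ge0].
case: (Rlt_dec 0 t) => ht; last by rewrite {1}/rpow; case: Rlt_dec.
apply: (Rle_trans _ (sumR l (fun i => w i * (rpow t q * (1 + q * (a i / t - 1)))))); last first.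
  apply: sumR_le => i hi; apply: Rmult_le_compat_l; first exact: hw.
  by apply: rpow_tangent => //; exact: ha.
have -> : sumR l (fun i => w i * (rpow t q * (1 + q * (a i / t - 1)))) =
  rpow t q * ((1 - q) * sumR l w + q / t * t).
  change (q / t * t) with (q / t * sumR l (fun i => w i * a i)).
  rewrite -!sumR_scal -sumR_plus -sumR_scal; apply: sumR_ext => i _; field; lra.
have -> : q / t * t = q by field; lra.
have := rpow_ge0 t q.
have : (1 - q) * 1 <= (1 - q) * sumR l w by nra.
nra.
Qed.

(** * Columns of a compact operator *)

Lemma nrm2_sumH_orth (l : list nat) (f : nat -> H) : NoDup l ->
  (forall i j, i <> j -> inner (f i) (f j) = 0%C) ->
  nrm2 (sumH l f) = sumR l (fun i => nrm2 (f i)).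
Proof.
move=> hl ho; elim: l hl => [|i l IH] hl /=; first exact: nrm2_zero.
have [hi hl'] : ~ In i l /\ NoDup l by inversion hl.
rewrite nrm2_add IH // inner_sumH_r sumC_zero /=; first ring.
by move=> j hj; apply: ho => e; subst j.
Qed.

(** Bessel's inequality and the splitting of [x] along the first [K] singular vectors. *)
Lemma singular_expansion (T Ts : bounded_map) sg vv (K : nat) (x : H) :
  adjoint T Ts -> sing_sys T (fun x => Ts (T x)) sg vv ->
  sumR (seq 0 K) (fun k => Cmod (inner x (vv k)) ^ 2) <= nrm2 x /\
  nrm2 (T x) <= sg K ^ 2 * nrm2 x +
    sumR (seq 0 K) (fun k => Cmod (inner x (vv k)) ^ 2 * sg k ^ 2).
Proof.
move=> hadj hs.
set A := fun x => Ts (T x).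
set z := sumH (seq 0 K) (fun k => inner x (vv k) *: vv k)%H.
set y := (x - z)%H.
have hself k : (inner x (vv k) * inner (vv k) (vv k))%C = inner x (vv k).
  case: (Req_dec (sg k) 0) => e.
  - rewrite (ss_zero _ _ _ _ hs k e) inner_zero_r; ring.
  - rewrite inner_self (ss_unit _ _ _ _ hs); first ring.
    by have := ss_ge0 _ _ _ _ hs k; lra.
have hzk k : (k < K)%nat -> inner z (vv k) = inner x (vv k).
  move=> hk; have hk' : In k (seq 0 K) by apply/in_seq; lia.
  rewrite /z inner_sumH_l (sumC_perm _ _ _ (remove_perm _ k (seq_NoDup _ _) hk')) [sumC _ _]/=.
  rewrite inner_scal_l hself sumC_zero; first ring.
  move=> i hi; have [_ hne] := in_remove Nat.eq_dec (seq 0 K) i k hi.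
  by rewrite inner_scal_l (ss_orth _ _ _ _ hs) //; ring.
have hyk k : (k < K)%nat -> inner y (vv k) = 0%C.
  by move=> hk; rewrite /y inner_sub_l hzk //; ring.
have hyz : inner y z = 0%C.
  rewrite /z inner_sumH_r; apply: sumC_zero => k /in_seq hk.
  by rewrite inner_scal_r hyk; [ring | lia].
have hAz : A z = sumH (seq 0 K) (fun k => (inner x (vv k) * RtoC (sg k ^ 2))%C *: vv k)%H.
  rewrite /A /z !bf_sumH; apply: sumH_ext => k _.
  by rewrite !bf_scal (ss_eig _ _ _ _ hs); hring.
have hyAz : inner y (A z) = 0%C.
  rewrite hAz inner_sumH_r; apply: sumC_zero => k /in_seq hk.
  by rewrite inner_scal_r hyk; [ring | lia].
have hz2 : nrm2 z = sumR (seq 0 K) (fun k => Cmod (inner x (vv k)) ^ 2).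
  apply: RtoC_inj; rewrite -inner_self {1}/z inner_sumH_l -sumC_RtoC.
  apply: sumC_ext => k /in_seq hk.
  rewrite inner_scal_l (inner_conj z) hzk; last lia.
  by rewrite -Cmod2_conj.
have hTz : nrm2 (T z) = sumR (seq 0 K) (fun k => Cmod (inner x (vv k)) ^ 2 * sg k ^ 2).
  apply: RtoC_inj; rewrite -inner_self -(normal_self _ _ hadj) -/(A z) hAz inner_sumH_l -sumC_RtoC.
  apply: sumC_ext => k /in_seq hk.
  rewrite inner_scal_l (inner_conj z) hzk; last lia.
  rewrite RtoC_mult Cmod2_conj; ring.
have ex : x = (y + z)%H by rewrite /y; hring.
have hx2 : nrm2 x = nrm2 y + nrm2 z.
  by rewrite {1}ex nrm2_add hyz /=; ring.
have hTx : nrm2 (T x) = nrm2 (T y) + nrm2 (T z).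
  rewrite {1}ex bf_add nrm2_add hadj -/(A z) hyAz /=; ring.
have hy0 := nrm2_ge0 y; have hz0 := nrm2_ge0 z.
split; first by rewrite -hz2; lra.
rewrite hTx -hTz; apply: Rplus_le_compat_r.
apply: Rle_trans (ss_max _ _ _ _ hs K y hyk) _.
apply: Rmult_le_compat_l; [exact: pow2_ge_0 | lra].
Qed.

Lemma small_common (N : nat) (u : nat -> R) : exists d, 0 < d /\
  forall n, (n < N)%nat -> 0 < u n -> d <= u n.
Proof.
elim: N => [|N [d [hd h]]]; first by exists 1; split; [lra | move=> n; lia].
case: (Rlt_dec 0 (u N)) => hu.
- exists (Rmin d (u N)); split; first by apply: Rmin_glb_lt.
  move=> n hn hun; case: (Nat.eq_dec n N) => [->|ne]; first exact: Rmin_r.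
  by apply: Rle_trans (Rmin_l _ _) (h n _ hun); lia.
- exists d; split => // n hn hun; case: (Nat.eq_dec n N) => [e|ne]; last by apply: h => //; lia.
  by exfalso; apply: hu; rewrite -e.
Qed.

(** By convexity of [t^(p/2)], which needs [p >= 2], [|T e_n|^p] is at most the
    [|<e_n, v_k>|^2]-weighted sum of the [s_k^p].  The expansion in the [v_k] is cut
    at an index beyond which it contributes at most half of [|T e_n|^2], for all
    nonzero ones among the first [N] columns; this costs the factor [2^(p/2)]. *)
Lemma column_powers (T Ts : bounded_map) sg vv (p S : R) :
  adjoint T Ts -> sing_sys T (fun x => Ts (T x)) sg vv -> 2 <= p ->
  (forall K, sumR (seq 0 K) (fun k => rpow (sg k) p) <= S) ->
  forall N, sumR (seq 0 N) (fun n => rpow (nrm2 (T (basis n))) (p / 2)) <= Rpower 2 (p / 2) * S.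
Proof.
move=> hadj hs hp hS N.
have [d [hd hdn]] := small_common N (fun n => nrm2 (T (basis n))).
have [K hK] : exists K, sg K ^ 2 <= d / 2.
  have /is_lim_seq_spec hl := ss_lim _ _ _ _ hs.
  have hmin : 0 < Rmin 1 (d / 2) by apply: Rmin_glb_lt; lra.
  have [K hK] := hl (mkposreal _ hmin).
  exists K; have := hK K (le_n _); rewrite /= Rminus_0_r.
  have h0 := ss_ge0 _ _ _ _ hs K.
  rewrite Rabs_pos_eq //; have := Rmin_l 1 (d / 2); have := Rmin_r 1 (d / 2); nra.
have hb n : nrm2 (basis n) = 1.
  by apply: RtoC_inj; rewrite -inner_self inner_basis /= /std_basis; case: Nat.eq_dec.
set w := fun n k => Cmod (inner (basis n) (vv k)) ^ 2.
have hw n k : w n k = Cmod (vv k n) ^ 2.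
  by rewrite /w inner_conj inner_basis Cmod_conj.
have hcol n : (n < N)%nat -> rpow (nrm2 (T (basis n))) (p / 2) <=
   Rpower 2 (p / 2) * sumR (seq 0 K) (fun k => w n k * rpow (sg k) p).
  move=> hn.
  have [h1 h2] := singular_expansion T Ts sg vv K (basis n) hadj hs.
  rewrite hb Rmult_1_r in h2; rewrite hb in h1.
  set t := sumR _ _ in h2.
  have ht : nrm2 (T (basis n)) <= 2 * t.
    have ht0 : 0 <= t.
      by apply: sumR_ge0 => k _; apply: Rmult_le_pos; exact: pow2_ge_0.
    case: (Rlt_dec 0 (nrm2 (T (basis n)))) => hu; last lra.
    have := hdn n hn hu; lra.
  apply: (Rle_trans _ (rpow (2 * t) (p / 2))); first by apply: rpow_le => //; lra.
  rewrite rpow_scal; last lra.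
  apply: Rmult_le_compat_l; first by apply: Rlt_le; exact: exp_pos.
  have -> : sumR (seq 0 K) (fun k => w n k * rpow (sg k) p) =
            sumR (seq 0 K) (fun k => w n k * rpow (sg k ^ 2) (p / 2)).
    by apply: sumR_ext => k _; rewrite rpow_sqr //; exact: (ss_ge0 _ _ _ _ hs).
  apply: rpow_jensen => //; first lra.
  - by move=> k _; exact: pow2_ge_0.
  - by move=> k _; exact: pow2_ge_0.
apply: (Rle_trans _ (sumR (seq 0 N) (fun n => Rpower 2 (p / 2) *
    sumR (seq 0 K) (fun k => w n k * rpow (sg k) p)))).
  by apply: sumR_le => n /in_seq hn; apply: hcol; lia.
rewrite sumR_scal; apply: Rmult_le_compat_l; first by apply: Rlt_le; exact: exp_pos.
rewrite sumR_swap; apply: Rle_trans (hS K); apply: sumR_le => k _.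
rewrite (sumR_ext _ _ (fun n => rpow (sg k) p * Cmod (vv k n) ^ 2)); last first.
  by move=> n _; rewrite hw; ring.
rewrite sumR_scal -{2}(Rmult_1_r (rpow (sg k) p)).
apply: Rmult_le_compat_l; first exact: rpow_ge0.
apply: Rle_trans (sqsum_le_nrm2 N (vv k)) _.
case: (Req_dec (sg k) 0) => e; first by rewrite (ss_zero _ _ _ _ hs k e) nrm2_zero; lra.
rewrite (ss_unit _ _ _ _ hs); first lra.
by have := ss_ge0 _ _ _ _ hs k; lra.
Qed.

(** A vector in the span of the first [m + 1] singular vectors can be made to
    vanish, together with its image, on any [m / 2] coordinates. *)
Lemma sing_rank_bound (T Ts : bounded_map) sg vv (F : list nat) (eta : R) (m : nat) :
  adjoint T Ts -> sing_sys T (fun x => Ts (T x)) sg vv ->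
  (forall v : H, (forall i, In i F -> v i = 0%C) -> (forall i, In i F -> (T v) i = 0%C) ->
     nrm (T v) <= eta * nrm v) ->
  0 <= eta -> (2 * length F <= m)%nat -> sg m <= eta.
Proof.
move=> hadj hs htail heta hm.
case: (Rlt_dec 0 (sg m)) => hsm; last by lra.
have hmono := decr_le sg (ss_decr _ _ _ _ hs).
have [|||c [[j0 [hj0 hc]] hsys]] := hom_system (2 * length F)
  (List.map (fun i j => vv j i) F ++ List.map (fun i j => (T (vv j)) i) F) (seq 0 (S m)).
- by rewrite length_app !length_map; lia.
- exact: seq_NoDup.
- by rewrite length_app !length_map length_seq; lia.
set v := sumH (seq 0 (S m)) (fun j => c j *: vv j)%H.
have hv0 i : In i F -> v i = 0%C.
  move=> hi; rewrite /v sumH_coord.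
  have <- := hsys (fun j => vv j i) (in_or_app _ _ _ (or_introl (in_map (fun i j => vv j i) _ _ hi))).
  by apply: sumC_ext => j _ /=; ring.
have hTv0 i : In i F -> (T v) i = 0%C.
  move=> hi; rewrite /v bf_sumH sumH_coord.
  have <- := hsys (fun j => (T (vv j)) i)
    (in_or_app _ _ _ (or_intror (in_map (fun i j => (T (vv j)) i) _ _ hi))).
  by apply: sumC_ext => j _; rewrite bf_scal /=; ring.
have h := htail v hv0 hTv0.
have hpos j : In j (seq 0 (S m)) -> sg m <= sg j /\ nrm2 (vv j) = 1.
  move/in_seq => hj; have hj' := hmono j m ltac:(lia); split => //.
  by apply: (ss_unit _ _ _ _ hs); lra.
have hnv : nrm2 v = sumR (seq 0 (S m)) (fun j => Cmod (c j) ^ 2).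
  rewrite /v nrm2_sumH_orth; first 1 last.
  - exact: seq_NoDup.
  - by move=> i j ne; rewrite inner_scal_l inner_scal_r (ss_orth _ _ _ _ hs) //; ring.
  - by apply: sumR_ext => j hj; rewrite nrm2_scal (proj2 (hpos j hj)); ring.
have hnT : sg m ^ 2 * nrm2 v <= nrm2 (T v).
  rewrite hnv /v bf_sumH nrm2_sumH_orth; first 1 last.
  - exact: seq_NoDup.
  - move=> i j ne; rewrite !bf_scal inner_scal_l inner_scal_r -(normal_self _ _ hadj).
    by rewrite (ss_eig _ _ _ _ hs) inner_scal_l (ss_orth _ _ _ _ hs) //; ring.
  - rewrite -sumR_scal; apply: sumR_le => j hj; have [h1 h2] := hpos j hj.
    rewrite bf_scal nrm2_scal.
    have -> : nrm2 (T (vv j)) = sg j ^ 2.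
      rewrite -Re_inner_self -(normal_self _ _ hadj) (ss_eig _ _ _ _ hs) inner_scal_l inner_self h2.
      by rewrite /=; ring.
    rewrite Rmult_comm; apply: Rmult_le_compat_l; first exact: pow2_ge_0.
    by apply: pow_incr; lra.
have hvpos : 0 < nrm2 v.
  apply: Rnot_le_lt => hle; apply: hc.
  have h0 := sqsum_eq0 (seq 0 (S m)) c; rewrite /sqsum -hnv in h0.
  exact: h0.
rewrite -!nrm_sqr in hnT hvpos.
have hn0 := nrm_ge0 v; have hT0 := nrm_ge0 (T v).
have hn1 : 0 < nrm v by have : nrm v <> 0 by [move=> e; rewrite e in hvpos; lra]; lra.
have h3 : sg m * nrm v <= nrm (T v).
  apply: Rsqr_incr_0_var => //; rewrite /Rsqr; lra.
by apply: (Rmult_le_reg_r (nrm v)); lra.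
Qed.

(** * A compactness criterion *)

(** A subsequence converging to the upper limit. *)
Lemma bounded_subseq (u : nat -> R) (B : R) : (forall n, Rabs (u n) <= B) ->
  exists phi : nat -> nat, (forall n, (phi n < phi (S n))%nat) /\
    ex_finite_lim_seq (fun n => u (phi n)).
Proof.
move=> hB.
have [L hL] : exists L : R, is_LimSup_seq u L.
  have [[l| |] h] := ex_LimSup_seq u; first by exists l.
  - have [n [_ hn]] := h B 0%nat; have := hB n; have := Rle_abs (u n); lra.
  - have [N hN] := h (- B); have := hN N (le_n _); have := hB N.
    have := Rle_abs (- u N); rewrite Rabs_Ropp; lra.
have hnext (N : nat) (e : posreal) : exists n, (N <= n)%nat /\ Rabs (u n - L) < e.
  have [h1 [M hM]] := hL e.
  have [n [hn hlt]] := h1 (Nat.max N M).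
  exists n; split; first lia.
  have := hM n ltac:(lia) => hlt2.
  by apply: Rabs_def1; lra.
have hpos n : 0 < / (INR n + 1) by apply: Rinv_0_lt_compat; have := pos_INR n; lra.
set pick := fun (N n : nat) => epsilon (inhabits 0%nat)
   (fun k => (N <= k)%nat /\ Rabs (u k - L) < / (INR n + 1)).
have hpick N n : (N <= pick N n)%nat /\ Rabs (u (pick N n) - L) < / (INR n + 1).
  exact: (epsilon_spec (inhabits 0%nat) (fun k => (N <= k)%nat /\ Rabs (u k - L) < / (INR n + 1))
     (hnext N (mkposreal _ (hpos n)))).
set phi := fix phi n := match n with O => pick 0%nat 0%nat | S k => pick (S (phi k)) (S k) end.
exists phi; split; first by move=> n; have [h _] := hpick (S (phi n)) (S n); rewrite /=; lia.
exists L; apply/is_lim_seq_spec => e.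
have /is_lim_seq_spec hi := inv_nat_lim.
have [N hN] := hi e; exists N => n hn.
have h1 := hN n hn; rewrite Rminus_0_r Rabs_pos_eq in h1; last by apply: Rlt_le.
apply: Rlt_trans h1.
by case: n hn => [|n] hn; [case: (hpick 0%nat 0%nat) | case: (hpick (S (phi n)) (S n))].
Qed.

Lemma comp_lt (f g : nat -> nat) : (forall n, (f n < f (S n))%nat) ->
  (forall n, (g n < g (S n))%nat) -> forall n, (f (g n) < f (g (S n)))%nat.
Proof. move=> hf hg n; exact: (phi_mono f hf). Qed.

Lemma lim_along (u : nat -> R) (l : R) (chi : nat -> nat) (N : nat) :
  is_lim_seq u l -> (forall n, (N <= n)%nat -> (n <= chi n)%nat) ->
  is_lim_seq (fun n => u (chi n)) l.
Proof.
move=> /is_lim_seq_spec hu hchi; apply/is_lim_seq_spec => e.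
have [M hM] := hu e; exists (Nat.max N M) => n hn.
by apply: hM; have := hchi n ltac:(lia); lia.
Qed.

Lemma diagonal_subseq (c : nat -> nat -> R) : (forall k, exists B, forall n, Rabs (c k n) <= B) ->
  exists phi : nat -> nat, (forall n, (phi n < phi (S n))%nat) /\
    forall k, ex_finite_lim_seq (fun n => c k (phi n)).
Proof.
move=> hc.
set P := fun (k : nat) (f psi : nat -> nat) => (forall n, (psi n < psi (S n))%nat) /\
    ex_finite_lim_seq (fun n => c k (f (psi n))).
have hex k f : exists psi, P k f psi.
  have [B hB] := hc k; exact: (bounded_subseq (fun n => c k (f n)) B (fun n => hB (f n))).
set nxt := fun k f => epsilon (inhabits (fun n : nat => n)) (P k f).
have hnxt k f : P k f (nxt k f) by exact: (epsilon_spec _ (P k f) (hex k f)).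
set Phi := fix Phi k : nat -> nat := match k with
  | O => fun n => n | S j => fun n => Phi j (nxt j (Phi j) n) end.
have hinc k : forall n, (Phi k n < Phi k (S n))%nat.
  elim: k => [|k IH] n /=; first lia.
  exact: (comp_lt (Phi k) (nxt k (Phi k)) IH (proj1 (hnxt k (Phi k)))).
have hfac k m : (k <= m)%nat -> exists chi, (forall n, (chi n < chi (S n))%nat) /\
   forall n, Phi m n = Phi k (chi n).
  elim: m => [|m IH] hkm.
    have -> : k = 0%nat by lia.
    by exists (fun n => n); split => // n; lia.
  case: (Nat.eq_dec k (S m)) => [->|ne].
    by exists (fun n => n); split => // n; lia.
  have [chi [h1 h2]] := IH ltac:(lia).
  have hn := proj1 (hnxt m (Phi m)).
  exists (fun n => chi (nxt m (Phi m) n)); split; last by move=> n /=; rewrite h2.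
  exact: (comp_lt chi _ h1 hn).
exists (fun n => Phi n n); split.
- move=> n /=.
  have h1 := phi_ge _ (proj1 (hnxt n (Phi n))) (S n).
  exact: (phi_mono _ (hinc n) n (nxt n (Phi n) (S n)) ltac:(lia)).
- move=> k; have [_ [l hl]] := hnxt k (Phi k).
  exists l.
  set chi := fun n => epsilon (inhabits 0%nat)
     (fun m => (n <= m)%nat /\ Phi n n = Phi (S k) m).
  have hchi n : (S k <= n)%nat -> (n <= chi n)%nat /\ Phi n n = Phi (S k) (chi n).
    move=> hn; apply: (epsilon_spec (inhabits 0%nat)
      (fun m => (n <= m)%nat /\ Phi n n = Phi (S k) m)).
    have [ch [h1 h2]] := hfac (S k) n hn.
    by exists (ch n); split; [exact: phi_ge | exact: h2].
  apply: (is_lim_seq_ext_loc (fun n => c k (Phi (S k) (chi n)))).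
    by exists (S k) => n hn; rewrite (proj2 (hchi n hn)).
  apply: (lim_along (fun n => c k (Phi (S k) n)) l chi (S k)); first exact: hl.
  by move=> n hn; case: (hchi n hn).
Qed.

Definition coord_conv (x : nat -> H) : Prop := forall i,
  ex_finite_lim_seq (fun n => Re (x n i)) /\ ex_finite_lim_seq (fun n => Im (x n i)).

Lemma Im_le_Cmod (z : C) : Rabs (Im z) <= Cmod z.
Proof. by apply: Rle_trans (Rmax_Cmod z); exact: Rmax_r. Qed.

Lemma coord_extract (x : nat -> H) (K : R) : (forall n, nrm (x n) <= K) ->
  exists phi : nat -> nat, (forall n, (phi n < phi (S n))%nat) /\
    coord_conv (fun n => x (phi n)).
Proof.
move=> hK.
have hb n i : Cmod (x n i) <= K by apply: Rle_trans (coord_le_nrm _ _) (hK n).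
have [k|phi [h1 h2]] := diagonal_subseq
  (fun k n => if Nat.even k then Re (x n (Nat.div2 k)) else Im (x n (Nat.div2 k))).
  exists K => n; case: Nat.even.
  - exact: Rle_trans (re_le_Cmod _) (hb _ _).
  - exact: Rle_trans (Im_le_Cmod _) (hb _ _).
exists phi; split => // i; split.
- have := h2 (2 * i)%nat; rewrite Nat.even_mul Nat.div2_double //.
- have := h2 (S (2 * i)); rewrite Nat.even_succ Nat.odd_mul Nat.div2_succ_double //.
Qed.

Lemma sqsum_lim (l : list nat) (u : nat -> nat -> C) (t : nat -> C) :
  (forall i, is_lim_seq (fun n => Re (u n i)) (Re (t i)) /\
             is_lim_seq (fun n => Im (u n i)) (Im (t i))) ->
  is_lim_seq (fun n => sqsum l (u n)) (sqsum l t).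
Proof.
move=> h; rewrite /sqsum; elim: l => [|i l IH]; first exact: is_lim_seq_const.
rewrite [sumR (i :: l) _]/=; apply: is_lim_seq_plus' => //.
have [h1 h2] := h i.
change (Cmod (t i) * (Cmod (t i) * 1)) with (Cmod (t i) ^ 2).
rewrite Cmod2_alt.
apply: (is_lim_seq_ext (fun n => Re (u n i) * Re (u n i) + Im (u n i) * Im (u n i))).
  by move=> n; rewrite Cmod2_alt; ring.
have -> : Re (t i) ^ 2 + Im (t i) ^ 2 = Re (t i) * Re (t i) + Im (t i) * Im (t i) by ring.
by apply: is_lim_seq_plus'; apply: is_lim_seq_mult'.
Qed.

(** The limit is taken coordinatewise; bounds on partial sums pass to it. *)
Lemma H_complete (x : nat -> H) : coord_conv x ->
  (forall e, 0 < e -> exists N, forall n m, (N <= n)%nat -> (N <= m)%nat ->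
     nrm (x n - x m)%H <= e) ->
  exists y, is_lim_seq (fun n => nrm (x n - y)%H) 0.
Proof.
move=> hc hcau.
set t : nat -> C := fun i => (real (Lim_seq (fun n => Re (x n i))), real (Lim_seq (fun n => Im (x n i)))).
have ht i : is_lim_seq (fun n => Re (x n i)) (Re (t i)) /\
            is_lim_seq (fun n => Im (x n i)) (Im (t i)).
  by have [h1 h2] := hc i; split; exact: Lim_seq_correct'.
have hfat n e N : (forall m, (N <= m)%nat -> nrm (x n - x m)%H <= e) ->
   forall k, sqsum (seq 0 k) (fun i => (x n i - t i)%C) <= e ^ 2.
  move=> h k.
  have hl : is_lim_seq (fun m => sqsum (seq 0 k) (fun i => (x n i - x m i)%C))
     (sqsum (seq 0 k) (fun i => (x n i - t i)%C)).
    apply: (sqsum_lim _ (fun m i => (x n i - x m i)%C)) => i; have [h1 h2] := ht i.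
    split; [apply: (is_lim_seq_minus' (fun _ => Re (x n i)) _ (Re (x n i)) _ _ h1)
           |apply: (is_lim_seq_minus' (fun _ => Im (x n i)) _ (Im (x n i)) _ _ h2)];
      exact: is_lim_seq_const.
  apply: (is_lim_seq_le_loc _ (fun _ => e ^ 2) _ _ _ hl (is_lim_seq_const _)).
  exists N => m hm.
  apply: (Rle_trans _ (nrm2 (x n - x m)%H)).
    apply: Rle_trans (sqsum_le_nrm2 k _); apply: Req_le; apply: sumR_ext => i _.
    by congr (_ ^ 2); congr Cmod; rewrite /hsub /=; ring.
  rewrite -nrm_sqr; apply: pow_incr; split; [exact: nrm_ge0 | exact: h].
have hl2 n e N : (forall m, (N <= m)%nat -> nrm (x n - x m)%H <= e) ->
    l2 (fun i => (x n i - t i)%C).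
  move=> h; apply: (sum_f_R0_pos_incr _ (fun k => pow2_ge_0 _) (e ^ 2)) => k.
  rewrite -sumR_seq_sum_f_R0; exact: (hfat n e N h (S k)).
have [N0 hN0] := hcau 1 Rlt_0_1.
have hd := hl2 N0 1 N0 (fun m hm => hN0 N0 m (le_n _) hm).
have hy : l2 t.
  apply: (ex_series_ext _ _ _ (hv_l2 (x N0 - mkH _ hd)%H)) => i.
  by congr (_ ^ 2); congr Cmod; rewrite /hsub /=; ring.
exists (mkH t hy); apply/is_lim_seq_spec => e.
have he : 0 < e / 2 by have := cond_pos e; lra.
have [N hN] := hcau _ he; exists N => n hn.
rewrite Rminus_0_r Rabs_pos_eq; last exact: nrm_ge0.
apply: (Rle_lt_trans _ (e / 2)); last by have := cond_pos e; lra.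
apply: nrm_le_of_nrm2; first lra.
apply: nrm2_le_of_partial => k.
apply: Rle_trans (hfat n (e / 2) N (fun m hm => hN n m hn hm) k).
apply: Req_le; apply: sumR_ext => i _; congr (_ ^ 2); congr Cmod; rewrite /hsub /=; ring.
Qed.

Definition drop_seq (F : list nat) (x : nat -> C) (i : nat) : C :=
  if in_dec Nat.eq_dec i F then RtoC 0 else x i.

Lemma Cmod_drop_le F x i : Cmod (drop_seq F x i) ^ 2 <= Cmod (x i) ^ 2.
Proof.
rewrite /drop_seq; case: in_dec => _; last lra.
rewrite Cmod_0; have := pow2_ge_0 (Cmod (x i)); lra.
Qed.

Lemma l2_le (x y : nat -> C) : (forall i, Cmod (x i) ^ 2 <= Cmod (y i) ^ 2) -> l2 y -> l2 x.
Proof.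
move=> h hy; apply: (@ex_series_le R_AbsRing R_CompleteNormedModule _ _ _ hy) => n.
rewrite /norm /= /abs /= Rabs_pos_eq; [exact: h | exact: pow2_ge_0].
Qed.

Definition drop (F : list nat) (x : H) : H :=
  mkH _ (l2_le _ _ (Cmod_drop_le F x) (hv_l2 x)).

Lemma nrm_drop F x : nrm (drop F x) <= nrm x.
Proof.
apply: nrm_le_of_nrm2; first exact: nrm_ge0.
rewrite nrm_sqr /nrm2; apply: Series_le; last exact: hv_l2.
by move=> n; split; [exact: pow2_ge_0 | exact: Cmod_drop_le].
Qed.

Lemma drop_in F x i : In i F -> (drop F x) i = RtoC 0.
Proof. by move=> h; rewrite /= /drop_seq; case: in_dec. Qed.

Lemma drop_split F x : NoDup F -> x = (drop F x + sumH F (fun j => x j *: basis j))%H.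
Proof.
move=> hF; apply: H_ext => i; rewrite /= sumH_coord /= /drop_seq.
case: in_dec => h.
- rewrite (sumC_perm _ _ _ (remove_perm _ i hF h)) [sumC _ _]/= sumC_zero.
    by rewrite /std_basis; case: Nat.eq_dec => // _; ring.
  move=> j hj; have [_ hne] := in_remove Nat.eq_dec _ _ _ hj.
  by rewrite /std_basis; case: Nat.eq_dec => [e|_]; [case: hne | ring].
- rewrite sumC_zero; first ring.
  move=> j hj; rewrite /std_basis; case: Nat.eq_dec => [e|_]; last ring.
  by case: h; rewrite e.
Qed.

(** The compression of [T] to the coordinates outside [F] has norm at most [eta]. *)
Definition tail_bound (T : H -> H) (F : list nat) (eta : R) : Prop :=
  forall y w : H, (forall i, In i F -> y i = RtoC 0) -> (forall i, In i F -> w i = RtoC 0) ->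
    Cmod (inner (T y) w) <= eta * (nrm y * nrm w).

Lemma nrm_basis k : nrm (basis k) = 1.
Proof.
have h : nrm2 (basis k) = 1.
  by apply: RtoC_inj; rewrite -inner_self inner_basis /= /std_basis; case: Nat.eq_dec.
rewrite /nrm /l2_norm -/(nrm2 (basis k)) h; exact: sqrt_1.
Qed.

Lemma sumR_le_const {A} (l : list A) f d : (forall i, In i l -> f i <= d) ->
  sumR l f <= INR (length l) * d.
Proof. by move=> h; rewrite -sumR_const; exact: sumR_le. Qed.

(** Splitting off the coordinates in [F] of both [y] and its image leaves the
    compression; what is split off is controlled by finitely many coordinates. *)
Lemma tail_nrm (T : bounded_map) (F : list nat) eta (y : H) : NoDup F -> 0 <= eta -> tail_bound T F eta ->
  nrm (T y) <= eta * nrm y + sumR F (fun i => Cmod (T y i)) +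
     (INR (length F) + 1) * bf_norm T * sumR F (fun j => Cmod (y j)).
Proof.
move=> hF heta ht.
set y' := drop F y; set z := sumH F (fun j => y j *: basis j)%H.
have ey : y = (y' + z)%H by exact: drop_split.
set w := drop F (T y').
have ew : T y' = (w + sumH F (fun i => (T y') i *: basis i))%H by exact: drop_split.
have hw : nrm w <= eta * nrm y.
  have hww : inner (T y') w = RtoC (nrm2 w).
    rewrite {1}ew inner_add_l inner_self inner_sumH_l sumC_zero; first ring.
    move=> i hi; rewrite inner_scal_l inner_conj inner_basis drop_in //.
    by apply: C_eq => /=; ring.
  have := ht y' w (fun i hi => drop_in F y i hi) (fun i hi => drop_in F (T y') i hi).
  rewrite hww Cmod_R Rabs_pos_eq; last exact: nrm2_ge0.
  rewrite -nrm_sqr => h.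
  have h1 := nrm_drop F y; rewrite -/y' in h1.
  have hw0 := nrm_ge0 w; have hy0 := nrm_ge0 y'.
  case: (Req_dec (nrm w) 0) => [->|ne].
    by apply: Rmult_le_pos => //; exact: nrm_ge0.
  have : nrm w <= eta * nrm y' by apply: (Rmult_le_reg_r (nrm w)); lra.
  have : eta * nrm y' <= eta * nrm y by apply: Rmult_le_compat_l.
  lra.
have hTz : nrm (T z) <= bf_norm T * sumR F (fun j => Cmod (y j)).
  apply: Rle_trans (bf_bound T z) _; apply: Rmult_le_compat_l; first exact: bf_norm_ge0.
  apply: Rle_trans (nrm_sumH_le _ _) _; apply: sumR_le => j _.
  by rewrite nrm_scal nrm_basis; lra.
have hc i : Cmod (T y' i) <= Cmod (T y i) + bf_norm T * sumR F (fun j => Cmod (y j)).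
  have -> : T y' i = (T y i - T z i)%C.
    have -> : T y = (T y' + T z)%H by rewrite -bf_add -ey.
    by rewrite /=; ring.
  apply: Rle_trans (Cmod_triangle _ _) _; rewrite Cmod_opp.
  have := coord_le_nrm (T z) i; lra.
have hs : nrm (sumH F (fun i => (T y') i *: basis i))%H <=
   sumR F (fun i => Cmod (T y i)) + INR (length F) * (bf_norm T * sumR F (fun j => Cmod (y j))).
  rewrite -sumR_const -sumR_plus.
  apply: Rle_trans (nrm_sumH_le _ _) _; apply: sumR_le => i _.
  rewrite nrm_scal nrm_basis Rmult_1_r; exact: hc.
have e : T y = ((w + sumH F (fun i => (T y') i *: basis i)) + T z)%H.
  by rewrite -ew -bf_add -ey.
have h1 := nrm_add_le (w + sumH F (fun i => (T y') i *: basis i))%H (T z).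
have h2 := nrm_add_le w (sumH F (fun i => (T y') i *: basis i))%H.
rewrite -e in h1; lra.
Qed.

Lemma conv_cauchy (u : nat -> R) : ex_finite_lim_seq u -> forall d, 0 < d ->
  exists N, forall n m, (N <= n)%nat -> (N <= m)%nat -> Rabs (u n - u m) <= d.
Proof.
move=> /ex_lim_seq_cauchy_corr h d hd; have [N hN] := h (mkposreal d hd).
by exists N => n m hn hm; apply: Rlt_le; exact: hN.
Qed.

Lemma Cmod_le_ReIm (z : C) : Cmod z <= Rabs (Re z) + Rabs (Im z).
Proof.
apply: Rsqr_incr_0_var; last by have := Rabs_pos (Re z); have := Rabs_pos (Im z); lra.
rewrite !Rsqr_pow2 Cmod2_alt -(pow2_abs (Re z)) -(pow2_abs (Im z)).
have := Rabs_pos (Re z); have := Rabs_pos (Im z); nra.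
Qed.

Lemma coord_cauchy (x : nat -> H) (F : list nat) : coord_conv x -> forall d, 0 < d ->
  exists N, forall n m, (N <= n)%nat -> (N <= m)%nat ->
    forall i, In i F -> Cmod (x n i - x m i)%C <= d.
Proof.
move=> hx d hd; elim: F => [|i F [N hN]]; first by exists 0%nat.
have [h1 h2] := hx i.
have [N1 hN1] := conv_cauchy _ h1 (d / 2) ltac:(lra).
have [N2 hN2] := conv_cauchy _ h2 (d / 2) ltac:(lra).
exists (Nat.max N (Nat.max N1 N2)) => n m hn hm k [<-|hk].
- apply: Rle_trans (Cmod_le_ReIm _) _.
  have := hN1 n m ltac:(lia) ltac:(lia); have := hN2 n m ltac:(lia) ltac:(lia).
  rewrite /Re /Im /= /Rminus; lra.
- by apply: hN => //; lia.
Qed.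

(** On a subsequence along which all coordinates of [x n] and of [T (x n)] converge,
    [tail_nrm] makes the images Cauchy. *)
Lemma compact_of_tails (T : bounded_map) :
  (forall d, 0 < d -> exists F, NoDup F /\ tail_bound T F d) -> compact T.
Proof.
move=> htail x K hK.
have [phi1 [hphi1 hc1]] := coord_extract x K hK.
have hKT n : nrm (T (x (phi1 n))) <= bf_norm T * K.
  apply: Rle_trans (bf_bound _ _) _; apply: Rmult_le_compat_l => //; exact: bf_norm_ge0.
have [phi2 [hphi2 hc2]] := coord_extract (fun n => T (x (phi1 n))) _ hKT.
set phi := fun n => phi1 (phi2 n).
have hc3 : coord_conv (fun n => x (phi n)).
  move=> i; have [[a ha] [b hb]] := hc1 i; split; [exists a|exists b].
  - exact: (is_lim_seq_subseq _ _ phi2 (eventually_subseq _ hphi2) ha).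
  - exact: (is_lim_seq_subseq _ _ phi2 (eventually_subseq _ hphi2) hb).
have hK0 : 0 <= K by apply: Rle_trans (hK 0%nat); exact: nrm_ge0.
have [|y hy] := H_complete (fun n => T (x (phi n))) hc2.
  move=> e he.
  set d1 := e / (2 * (2 * K + 1)).
  have hd1 : 0 < d1 by apply: Rdiv_lt_0_compat; lra.
  have [F [hF ht]] := htail d1 hd1.
  set f := INR (length F); have hf : 0 <= f by exact: pos_INR.
  have hT0 := bf_norm_ge0 T.
  have hprod : 0 <= (f + 1) * bf_norm T by apply: Rmult_le_pos; lra.
  set D := 2 * (f + (f + 1) * bf_norm T * f + 1).
  have hff : 0 <= (f + 1) * bf_norm T * f by apply: Rmult_le_pos.
  have hD : 0 < D by rewrite /D; lra.
  have hd2 : 0 < e / D by apply: Rdiv_lt_0_compat.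
  have [N1 hN1] := coord_cauchy _ F hc3 _ hd2.
  have [N2 hN2] := coord_cauchy _ F hc2 _ hd2.
  exists (Nat.max N1 N2) => n m hn hm.
  rewrite -bf_sub.
  set yy := (x (phi n) - x (phi m))%H.
  have h1 := tail_nrm T F d1 yy hF (Rlt_le _ _ hd1) ht.
  have h2 : sumR F (fun j => Cmod (yy j)) <= f * (e / D).
    apply: sumR_le_const => j hj.
    have := hN1 n m ltac:(lia) ltac:(lia) j hj.
    by have -> : yy j = (x (phi n) j - x (phi m) j)%C by rewrite /yy /hsub /=; ring.
  have h3 : sumR F (fun j => Cmod (T yy j)) <= f * (e / D).
    apply: sumR_le_const => j hj.
    have := hN2 n m ltac:(lia) ltac:(lia) j hj.
    have -> : T yy j = (T (x (phi n)) j - T (x (phi m)) j)%C by rewrite /yy bf_sub /hsub /=; ring.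
    by [].
  have h4 : nrm yy <= 2 * K.
    by apply: Rle_trans (nrm_sub_le _ _) _; have := hK (phi n); have := hK (phi m); lra.
  have h5 : d1 * nrm yy <= e / 2.
    have : d1 * nrm yy <= d1 * (2 * K) by apply: Rmult_le_compat_l; lra.
    have : d1 * (2 * K) <= d1 * (2 * K + 1) by apply: Rmult_le_compat_l; lra.
    have -> : d1 * (2 * K + 1) = e / 2 by rewrite /d1; field; lra.
    lra.
  have h6 : (f + 1) * bf_norm T * sumR F (fun j => Cmod (yy j)) <= (f + 1) * bf_norm T * (f * (e / D)).
    exact: Rmult_le_compat_l.
  have h7 : f * (e / D) + (f + 1) * bf_norm T * (f * (e / D)) <= e / 2.
    have -> : f * (e / D) + (f + 1) * bf_norm T * (f * (e / D)) =
        (f + (f + 1) * bf_norm T * f) * (e / D) by ring.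
    have -> : e / 2 = (f + (f + 1) * bf_norm T * f + 1) * (e / D) by rewrite /D; field; lra.
    apply: Rmult_le_compat_r; lra.
  rewrite -/f in h1; lra.
exists phi, y; split; last exact: hy.
exact: (comp_lt phi1 phi2).
Qed.

(** * Identification of the Gram matrix *)

Lemma is_series_Re_Im (a : nat -> C) (l : C) :
  is_series (K := C_AbsRing) (V := C_NormedModule) a l ->
  is_series (fun n => Re (a n)) (Re l) /\ is_series (fun n => Im (a n)) (Im l).
Proof.
move=> h; split.
- have hs n : sum_n (fun k => Re (a k)) n = fst (sum_n a n).
    elim: n => [|n IH]; first by rewrite !sum_O.
    by rewrite !sum_Sn IH.
  apply: (filterlim_ext (fun n => fst (sum_n a n))); first by move=> n; rewrite hs.
  apply: (filterlim_comp _ _ _ _ _ _ _ _ h).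
  exact: (continuous_fst (U := R_UniformSpace) (V := R_UniformSpace)).
- have hs n : sum_n (fun k => Im (a k)) n = snd (sum_n a n).
    elim: n => [|n IH]; first by rewrite !sum_O.
    by rewrite !sum_Sn IH.
  apply: (filterlim_ext (fun n => snd (sum_n a n))); first by move=> n; rewrite hs.
  apply: (filterlim_comp _ _ _ _ _ _ _ _ h).
  exact: (continuous_snd (U := R_UniformSpace) (V := R_UniformSpace)).
Qed.

Lemma pow_n_C (z : C) n : pow_n (K := C_Ring) z n = (z ^ n)%C.
Proof. by elim: n => //= n ->. Qed.

Lemma Cpow_RtoC (x : R) n : (RtoC x ^ n)%C = RtoC (x ^ n).
Proof. by rewrite RtoC_pow. Qed.

Lemma pseries_real (a : nat -> C) (x : R) (l : C) :
  is_pseries (K := C_AbsRing) (V := C_NormedModule) a (RtoC x) l ->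
  is_pseries (fun n => Re (a n)) x (Re l) /\ is_pseries (fun n => Im (a n)) x (Im l).
Proof.
move=> /is_series_Re_Im [h1 h2]; split.
- apply: is_series_ext h1 => n.
  rewrite pow_n_C Cpow_RtoC pow_n_pow; exact: re_scal_l.
- apply: is_series_ext h2 => n.
  rewrite pow_n_C Cpow_RtoC pow_n_pow; exact: im_scal_l.
Qed.

Lemma radius_pos (a : nat -> R) (B : R) : (forall n, Rabs (a n) <= B) ->
  Rbar_lt 0 (CV_radius a).
Proof.
move=> h; have [hub _] := CV_radius_bounded a.
apply: (Rbar_lt_le_trans _ (Finite 1)); first by rewrite /=; lra.
by apply: hub; exists B => n; rewrite pow1 Rmult_1_r.
Qed.

Lemma pseries_unique (a b : nat -> R) (f : R -> R) (A B : R) :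
  (forall n, Rabs (a n) <= A) -> (forall n, Rabs (b n) <= B) ->
  (forall x, Rabs x < 1 -> is_pseries a x (f x)) ->
  (forall x, Rabs x < 1 -> is_pseries b x (f x)) -> forall n, a n = b n.
Proof.
move=> hA hB ha hb n.
apply: PSeries_ext_recip; [exact: radius_pos hA | exact: radius_pos hB |].
exists (mkposreal 1 Rlt_0_1) => x hx.
have hx1 : Rabs x < 1.
  by move: hx; rewrite /ball /= /AbsRing_ball /abs /minus /plus /opp /= Ropp_0 Rplus_0_r.
by rewrite (is_pseries_unique _ _ _ (ha x hx1)) (is_pseries_unique _ _ _ (hb x hx1)).
Qed.

(** On the real diameter the real and imaginary parts are real power series. *)
Lemma H2_coeffs_unique f a b : H2_coeffs f a -> H2_coeffs f b -> a = b.
Proof.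
move=> [la ha] [lb hb]; apply: functional_extensionality => n.
have hx x : Rabs x < 1 -> Cmod (RtoC x) < 1 by rewrite Cmod_R.
have hc c (lc : l2 c) k : Cmod (c k) <= nrm (mkH c lc) by exact: (coord_le_nrm (mkH c lc) k).
apply: C_eq.
- apply: (pseries_unique (fun n => Re (a n)) (fun n => Re (b n)) (fun x => Re (f (RtoC x)))
     (nrm (mkH a la)) (nrm (mkH b lb))) => [k|k|x h|x h].
  + exact: Rle_trans (re_le_Cmod _) (hc a la k).
  + exact: Rle_trans (re_le_Cmod _) (hc b lb k).
  + exact: (proj1 (pseries_real _ _ _ (ha _ (hx x h)))).
  + exact: (proj1 (pseries_real _ _ _ (hb _ (hx x h)))).
- apply: (pseries_unique (fun n => Im (a n)) (fun n => Im (b n)) (fun x => Im (f (RtoC x)))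
     (nrm (mkH a la)) (nrm (mkH b lb))) => [k|k|x h|x h].
  + exact: Rle_trans (Im_le_Cmod _) (hc a la k).
  + exact: Rle_trans (Im_le_Cmod _) (hc b lb k).
  + exact: (proj2 (pseries_real _ _ _ (ha _ (hx x h)))).
  + exact: (proj2 (pseries_real _ _ _ (hb _ (hx x h)))).
Qed.

Lemma taylor_eq f a : H2_coeffs f a -> taylor f = a.
Proof.
move=> h; apply: (H2_coeffs_unique f) => //.
exact: (epsilon_spec (inhabits (fun _ : nat => RtoC 0)) (H2_coeffs f) (ex_intro _ a h)).
Qed.

Lemma geom_C (q : C) : Cmod q < 1 ->
  is_series (K := C_AbsRing) (V := C_NormedModule) (fun n => (q ^ n)%C) (1 / (1 - q))%C.
Proof.
move=> hq.
have hne : (1 - q)%C <> 0%C.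
  move=> e; have : q = 1%C by have -> : q = (1 - (1 - q))%C by [ring]; rewrite e; ring.
  by move=> e1; rewrite e1 Cmod_1 in hq; lra.
have hD : 0 < Cmod (1 - q)%C by apply/Cmod_gt_0.
have hsum n : sum_n (fun k => (q ^ k)%C : C_NormedModule) n = ((1 - q ^ (S n)) / (1 - q))%C.
  elim: n => [|n IH]; first by rewrite sum_O /=; field.
  rewrite sum_Sn IH /plus /=; field; exact: hne.
apply/filterlim_locally_ball_norm => eps.
have hl : is_lim_seq (fun n => Cmod q ^ n) 0.
  by apply: is_lim_seq_geom; rewrite Rabs_pos_eq //; exact: Cmod_ge_0.
have hep : 0 < eps * Cmod (1 - q)%C by apply: Rmult_lt_0_compat => //; exact: cond_pos.
have /is_lim_seq_spec hl' := hl.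
have [N hN] := hl' (mkposreal _ hep).
exists N => n hn; rewrite /ball_norm hsum.
have -> : minus ((1 - q ^ S n) / (1 - q))%C (1 / (1 - q))%C = (- (q ^ S n / (1 - q)))%C.
  by rewrite /minus /plus /opp /=; field.
change (Cmod (- (q ^ S n / (1 - q)))%C < eps).
rewrite Cmod_opp Cmod_div // Cmod_pow.
apply/Rlt_div_l => //.
have := hN (S n) ltac:(lia); rewrite [pos _]/= Rminus_0_r Rabs_pos_eq //.
by apply: pow_le; exact: Cmod_ge_0.
Qed.

Lemma kern_coord (a : Disc) n : kern a n = (Cconj a ^ n)%C.
Proof.
elim: n => [|n IH]; first by rewrite /= /std_basis.
change (kern a (S n)) with (std_basis 0 (S n) + Cconj a * kern a n)%C.
by rewrite IH /std_basis /=; ring.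
Qed.

Lemma kern_coeffs (a : Disc) (c : C) :
  H2_coeffs (fun z => (c * (1 / (1 - Cconj a * z)))%C) (hscal c (kern a)).
Proof.
split; first exact: hv_l2.
move=> z hz.
have hq : Cmod (Cconj a * z)%C < 1.
  rewrite Cmod_mult Cmod_conj; have := disc_lt a; have := Cmod_ge_0 a; have := Cmod_ge_0 z; nra.
have := is_series_scal (K := C_AbsRing) (V := C_NormedModule) c _ _ (geom_C _ hq).
apply: is_series_ext => n.
rewrite pow_n_C.
change (c * (Cconj a * z) ^ n = z ^ n * (c * kern a n))%C; rewrite kern_coord.
have -> : ((Cconj a * z) ^ n)%C = (Cconj a ^ n * z ^ n)%C.
  elim: n => /= [|n ->]; ring.
ring.
Qed.

Lemma szego_norm (alpha : nat -> C) (a : nat -> Disc) j : (forall j, disc_val (a j) = alpha j) ->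
  H2_norm (szego alpha j) = / sqrt (csq (a j)).
Proof.
move=> ha.
have h : H2_coeffs (szego alpha j) (hscal 1 (kern (a j))).
  have -> : szego alpha j = (fun z => (1 * (1 / (1 - Cconj (a j) * z)))%C).
    by apply: functional_extensionality => z; rewrite ha /szego; ring.
  exact: kern_coeffs.
rewrite /H2_norm /H2_inner (taylor_eq _ _ h) -/(inner (hscal 1 (kern (a j))) (hscal 1 (kern (a j)))).
have -> : hscal 1 (kern (a j)) = kern (a j) by hring.
by rewrite inner_self nrm2_kern re_RtoC sqrt_inv.
Qed.

Lemma gram_eq (alpha : nat -> C) (a : nat -> Disc) i j : (forall j, disc_val (a j) = alpha j) ->
  gram alpha i j = inner (nkern (a j)) (nkern (a i)).
Proof.
move=> ha.
have ht k : taylor (normalized_szego alpha k) = nkern (a k).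
  have -> : normalized_szego alpha k =
     (fun z => (RtoC (sqrt (csq (a k))) * (1 / (1 - Cconj (a k) * z)))%C).
    apply: functional_extensionality => z.
    rewrite /normalized_szego (szego_norm alpha a k ha) /szego -ha.
    have hs : 0 < sqrt (csq (a k)) by apply: sqrt_lt_R0; exact: csq_gt0.
    rewrite RtoC_inv; last lra.
    have hne : RtoC (sqrt (csq (a k))) <> 0%C by move/RtoC_inj; lra.
    have hinv (u v : C) : v <> 0%C -> (u / / v)%C = (v * u)%C by move=> hv; field.
    exact: hinv.
  by rewrite (taylor_eq _ _ (kern_coeffs (a k) _)).
by rewrite /gram /H2_inner !ht.
Qed.

Lemma nkern_unit (a : Disc) : nrm2 (nkern a) = 1.
Proof.
rewrite /nkern nrm2_scal sqrt_csq_sqr nrm2_kern; have := csq_gt0 a => h; field; lra.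
Qed.

Lemma gram_offdiag (a z : Disc) : Cmod (inner (nkern a) (nkern z)) ^ 2 = gram_sq a z.
Proof.
rewrite inner_nkern /nkern /ev inner_scal_l -/(ev z (kern a)) ev_kern.
rewrite Cmod_mult (Cmod_mult (RtoC (sqrt (csq a)))) !Rpow_mult_distr !sqrt_csq_sqr.
rewrite Cmod_div2; last exact: disc_neq0.
rewrite Cmod_1 /gram_sq; have := D_gt0 a z => h; field; lra.
Qed.

(** * The numbers [delta] *)

Definition rho_factor (a : nat -> Disc) (j k : nat) : R :=
  if Nat.eq_dec k j then 1
  else Cmod ((a k - a j) / (1 - Cconj (a k) * a j))%C.

Lemma rho_sqr a j k : rho_factor a j k ^ 2 = 1 - offdiag a j k.
Proof.
rewrite /rho_factor /offdiag; case: Nat.eq_dec => _; first ring.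
rewrite -blaschke_val /mval !Cmod_div2; try exact: disc_neq0.
congr Rdiv; rewrite /= -(Cmod_opp (a k - a j)%C).
have -> : (- (a k - a j))%C = (- a k + 1 * a j)%C by ring.
by [].
Qed.

Lemma rho_ge0 a j k : 0 <= rho_factor a j k.
Proof. rewrite /rho_factor; case: Nat.eq_dec => _; [lra | exact: Cmod_ge_0]. Qed.

Lemma rho_le1 a j k : rho_factor a j k <= 1.
Proof.
have h := rho_sqr a j k; have h0 := rho_ge0 a j k; have := offdiag_ge0 a j k; nra.
Qed.

(** For numbers [t] in [0, 1] the product of the [1 - t] lies between [1 - sum t] and
    [1 / (1 + sum t)]. *)
Lemma prod_rho_bounds a j n :
  let P := prod_f_R0 (rho_factor a j) n in
  0 <= P <= 1 /\ 1 - sumR (seq 0 (S n)) (offdiag a j) <= P ^ 2 /\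
  P ^ 2 * (1 + sumR (seq 0 (S n)) (offdiag a j)) <= 1.
Proof.
rewrite /= -/(seq 0 (S n)) -[offdiag a j 0 + _]/(sumR (seq 0 (S n)) (offdiag a j)).
elim: n => [|n [[h1 h2] [h3 h4]]].
- rewrite /= !Rplus_0_r.
  have h := rho_sqr a j 0; have h0 := rho_ge0 a j 0; have h1 := rho_le1 a j 0.
  have h2 := offdiag_ge0 a j 0; rewrite /= in h; split; [lra|split]; first lra.
  rewrite h; nra.
- rewrite seq_S sumR_app [sumR (_ :: nil) _]/= Rplus_0_r [prod_f_R0 _ (S n)]/=.
  have h := rho_sqr a j (S n); have h0 := rho_ge0 a j (S n); have h5 := rho_le1 a j (S n).
  have h6 := offdiag_ge0 a j (S n).
  have h7 : 0 <= sumR (seq 0 (S n)) (offdiag a j) by apply: sumR_ge0 => k _; exact: offdiag_ge0.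
  move: h1 h2 h3 h4 h h0 h5 h6 h7.
  set P := prod_f_R0 _ n; set r := rho_factor a j (S n); set o := offdiag a j (S n).
  set s := sumR _ _ => h1 h2 h3 h4 h h0 h5 h6 h7.
  have hP2 : 0 <= P ^ 2 <= 1 by nra.
  have e : (P * r) * (P * r * 1) = P ^ 2 * (1 - o) by rewrite -h; ring.
  have ho1 : o <= 1 by have := pow2_ge_0 r; lra.
  have e4 : P * (P * 1) = P ^ 2 by [].
  rewrite e4 in h3 h4.
  rewrite e; split; first by split; nra.
  split; first by nra.
  have : P ^ 2 * ((1 - o) * (1 + (s + o))) <= P ^ 2 * (1 + s).
    by apply: Rmult_le_compat_l; [lra | nra].
  lra.
Qed.

Lemma delta_lim (alpha : nat -> C) (a : nat -> Disc) j : (forall j, disc_val (a j) = alpha j) ->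
  is_lim_seq (prod_f_R0 (rho_factor a j)) (delta alpha j) /\
  0 <= delta alpha j /\ (forall n, delta alpha j <= prod_f_R0 (rho_factor a j) n).
Proof.
move=> ha.
have -> : delta alpha j = real (Lim_seq (prod_f_R0 (rho_factor a j))).
  rewrite /delta; congr (real (Lim_seq (prod_f_R0 _))).
  by apply: functional_extensionality => k; rewrite /rho_factor !ha.
have hdec n : prod_f_R0 (rho_factor a j) (S n) <= prod_f_R0 (rho_factor a j) n.
  have [[h1 _] _] := prod_rho_bounds a j n.
  by rewrite /=; have := rho_le1 a j (S n); nra.
have hge n : 0 <= prod_f_R0 (rho_factor a j) n by have [[h1 _] _] := prod_rho_bounds a j n.
have hex : ex_finite_lim_seq (prod_f_R0 (rho_factor a j)) by exact: (ex_finite_lim_seq_decr _ 0).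
have hl := Lim_seq_correct' _ hex.
split => //; split.
- exact: (is_lim_seq_le _ _ (Finite 0) _ hge (is_lim_seq_const 0) hl).
- exact: (is_lim_seq_decr_compare _ _ hl hdec).
Qed.

Lemma sumR_incl_le (L L' : list nat) f : (forall i, 0 <= f i) -> NoDup L -> incl L L' ->
  sumR L f <= sumR L' f.
Proof.
move=> h0; elim: L L' => [|i L IH] L' hL hinc /=; first by apply: sumR_ge0.
have [hi hL'] : ~ In i L /\ NoDup L by inversion hL.
have hiL : In i L' by apply: hinc; left.
have [l1 [l2 e]] := in_split i L' hiL; subst L'.
rewrite sumR_app /=.
have := IH (l1 ++ l2)%list hL' _.
rewrite sumR_app => h; have := h _; suff hx : incl L (l1 ++ l2) by move=> /(_ hx); lra.
move=> k hk; have := hinc k (or_intror hk).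
rewrite !in_app_iff /=; case=> [h1|[h1|h1]]; [by left| |by right].
by case: hi; rewrite h1.
Qed.

Lemma delta_upper (alpha : nat -> C) (a : nat -> Disc) j u : (forall j, disc_val (a j) = alpha j) ->
  (forall n, sumR (seq 0 n) (offdiag a j) <= u) -> 1 - delta alpha j ^ 2 <= u.
Proof.
move=> ha hu; have [hl [h0 hle]] := delta_lim alpha a j ha.
case: (Rle_lt_dec 1 u) => h1; first by have := pow2_ge_0 (delta alpha j); lra.
have hu0 : 0 <= u by have := hu 0%nat; rewrite /=.
have hs n : sqrt (1 - u) <= prod_f_R0 (rho_factor a j) n.
  have [[h2 _] [h3 _]] := prod_rho_bounds a j n.
  apply: Rsqr_incr_0_var => //; rewrite Rsqr_sqrt; last lra.
  rewrite Rsqr_pow2; have := hu (S n); lra.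
have h2 : sqrt (1 - u) <= delta alpha j.
  exact: (is_lim_seq_le _ _ (Finite (sqrt (1 - u))) _ hs (is_lim_seq_const _) hl).
have h3 := sqrt_sqrt (1 - u) ltac:(lra); have h4 := sqrt_pos (1 - u).
nra.
Qed.

Lemma delta_lower (alpha : nat -> C) (a : nat -> Disc) j L : (forall j, disc_val (a j) = alpha j) ->
  NoDup L -> delta alpha j ^ 2 * (1 + sumR L (offdiag a j)) <= 1.
Proof.
move=> ha hL; have [hl [h0 hle]] := delta_lim alpha a j ha.
set n := list_max L.
have hinc : incl L (seq 0 (S n)).
  move=> k hk; apply/in_seq; have := proj1 (list_max_le L n) (le_n _).
  by move/Forall_forall => /(_ k hk); lia.
have h1 := sumR_incl_le L _ (offdiag a j) (offdiag_ge0 a j) hL hinc.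
have [[h2 h3] [_ h4]] := prod_rho_bounds a j n.
have h5 := hle n.
have h6 : 0 <= sumR L (offdiag a j) by apply: sumR_ge0 => k _; exact: offdiag_ge0.
apply: Rle_trans h4; apply: Rmult_le_compat; [exact: pow2_ge_0 | lra | | lra].
by apply: pow_incr.
Qed.

(** * The matrix [G - I] *)

Definition gram_off (a : nat -> Disc) (i j : nat) : C :=
  (inner (nkern (a j)) (nkern (a i)) - id_matrix i j)%C.

Lemma gram_off_herm a i j : gram_off a j i = Cconj (gram_off a i j).
Proof.
rewrite /gram_off Cminus_conj -inner_conj; congr Cminus; rewrite /id_matrix.
by case: Nat.eq_dec => h1; case: Nat.eq_dec => h2; try (by subst); apply: C_eq => /=; ring.
Qed.

Lemma gram_off_sqr a i j : Cmod (gram_off a i j) ^ 2 = offdiag a j i.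
Proof.
rewrite /gram_off /id_matrix /offdiag; case: Nat.eq_dec => e.
- subst i; rewrite inner_self nkern_unit.
  have -> : (RtoC 1 - RtoC 1)%C = RtoC 0 by ring.
  by rewrite Cmod_0; ring.
- have -> : (inner (nkern (a j)) (nkern (a i)) - RtoC 0)%C = inner (nkern (a j)) (nkern (a i)) by ring.
  by rewrite gram_offdiag gram_sq_sym.
Qed.

Lemma form_gram_off a L x y : NoDup L ->
  form_on L (gram_off a) x y = (inner (synth a L x) (synth a L y) - sumC L (fun i => x i * Cconj (y i)))%C.
Proof.
move=> hL; rewrite /form_on /synth inner_sumH_r.
have -> : forall u v : C, (u - v)%C = (u + (- (1)) * v)%C by move=> u v; ring.
rewrite -sumC_scal -sumC_plus; apply: sumC_ext => i hi.
rewrite inner_scal_r inner_sumH_l.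
have -> : (- (1) * (x i * Cconj (y i)))%C =
  sumC L (fun j => (- (1) * id_matrix i j * x j * Cconj (y i))%C).
  rewrite (sumC_perm _ _ _ (remove_perm _ i hL hi)) [sumC _ _]/= sumC_zero.
    by rewrite /id_matrix; case: Nat.eq_dec => // _; ring.
  move=> j hj; have [_ hne] := in_remove Nat.eq_dec _ _ _ hj.
  by rewrite /id_matrix; case: Nat.eq_dec => [e|_]; [case: hne | ring].
rewrite -sumC_scal -sumC_plus; apply: sumC_ext => j _.
by rewrite inner_scal_l /gram_off; ring.
Qed.

Lemma form_gram_off_diag a L x : NoDup L ->
  Re (form_on L (gram_off a) x x) = nrm2 (synth a L x) - sqsum L x.
Proof.
move=> hL; rewrite form_gram_off // inner_self.
have -> : sumC L (fun i => (x i * Cconj (x i))%C) = RtoC (sqsum L x).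
  by rewrite /sqsum -sumC_RtoC; apply: sumC_ext => i _; rewrite -Cmod2_conj.
by rewrite -RtoC_minus.
Qed.

Lemma separated_form_bound a e L : 0 < e <= / 42 -> separated a e L ->
  forall x y, Cmod (form_on L (gram_off a) x y) <= 42 * e * (sqrt (sqsum L x) * sqrt (sqsum L y)).
Proof.
move=> he hs; apply: hermitian_form_bound; [exact: gram_off_herm | lra |].
move=> x; rewrite form_gram_off_diag; last exact: (proj1 hs).
exact: synth_bound.
Qed.

Definition outside (F L : list nat) : list nat :=
  List.filter (fun i => if in_dec Nat.eq_dec i F then false else true) L.
Definition inside (F L : list nat) : list nat :=
  List.filter (fun i => if in_dec Nat.eq_dec i F then true else false) L.

Lemma in_outside F L i : In i (outside F L) -> In i L /\ ~ In i F.
Proof. by move=> /filter_In []; case: in_dec. Qed.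

Lemma in_inside F L i : In i (inside F L) -> In i L /\ In i F.
Proof. by move=> /filter_In []; case: in_dec. Qed.

Lemma NoDup_outside F L : NoDup L -> NoDup (outside F L).
Proof. exact: NoDup_filter. Qed.

Lemma sumH_split F L f : sumH L f = (sumH (inside F L) f + sumH (outside F L) f)%H.
Proof.
elim: L => /= [|i L IH]; first by hring.
by case: in_dec => _ /=; rewrite IH; hring.
Qed.

Lemma sqsum_filter_le p L x : sqsum (List.filter p L) x <= sqsum L x.
Proof.
rewrite /sqsum; elim: L => /= [|i L IH]; first lra.
have := pow2_ge_0 (Cmod (x i)); case: (p i) => /=; lra.
Qed.

Definition tail_separated (a : nat -> Disc) (F : list nat) (e : R) : Prop :=
  forall L, NoDup L -> (forall i, In i L -> ~ In i F) -> separated a e L.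

(** Finitely many badly separated points contribute at most their number. *)
Lemma synth_any a F e L c : 0 < e <= / 42 -> NoDup F -> tail_separated a F e -> NoDup L ->
  nrm (synth a L c) <= (INR (length F) + 2) * sqrt (sqsum L c).
Proof.
move=> he hF ht hL.
rewrite /synth (sumH_split F).
apply: Rle_trans (nrm_add_le _ _) _; rewrite Rmult_plus_distr_r; apply: Rplus_le_compat.
- apply: Rle_trans (nrm_sumH_le _ _) _.
  have hin : NoDup (inside F L) by exact: NoDup_filter.
  apply: (Rle_trans _ (INR (length (inside F L)) * sqrt (sqsum L c))).
    apply: sumR_le_const => i /in_inside [hi _].
    rewrite nrm_scal /nrm /l2_norm -/(nrm2 (nkern (a i))) nkern_unit sqrt_1 Rmult_1_r.
    apply: Rsqr_incr_0_var; last exact: sqrt_pos.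
    rewrite Rsqr_sqrt; last exact: sqsum_ge0.
    rewrite Rsqr_pow2 /sqsum.
    have hnd : NoDup (i :: nil) by constructor; [case | constructor].
    have hinc : incl (i :: nil) L by move=> j [<-|[]].
    have := sumR_incl_le (i :: nil) L (fun j => Cmod (c j) ^ 2) (fun j => pow2_ge_0 _) hnd hinc.
    by rewrite [sumR (i :: nil) _]/=; rewrite Rplus_0_r.
  apply: Rmult_le_compat_r; first exact: sqrt_pos.
  apply: le_INR; apply: NoDup_incl_length => // i /in_inside [].
  by [].
- have hs := ht (outside F L) (NoDup_outside F L hL) (fun i hi => proj2 (in_outside F L i hi)).
  have h1 := synth_bound a e (outside F L) c he hs.
  have h2 := sqsum_filter_le (fun i => if in_dec Nat.eq_dec i F then false else true) L c.
  rewrite -/(outside F L) in h2.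
  have h3 := sqsum_ge0 (outside F L) c.
  rewrite -/(synth a (outside F L) c) -/(sqsum (outside F L) c) in h1 *.
  have h4 := Rle_abs (nrm2 (synth a (outside F L) c) - sqsum (outside F L) c).
  apply: nrm_le_of_nrm2; first by have := sqrt_pos (sqsum L c); lra.
  rewrite Rpow_mult_distr pow2_sqrt; last exact: sqsum_ge0.
  have : 42 * e * sqsum (outside F L) c <= 1 * sqsum (outside F L) c.
    by apply: Rmult_le_compat_r; lra.
  rewrite -/(sqsum (outside F L) c) in h1 h4 *; nra.
Qed.

Lemma sumC_cauchy_schwarz (L : list nat) (x y : nat -> C) :
  Cmod (sumC L (fun i => (x i * Cconj (y i))%C)) <= sqrt (sqsum L x) * sqrt (sqsum L y).
Proof.
rewrite -sqrt_mult; try exact: sqsum_ge0.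
apply: Rsqr_incr_0_var; last exact: sqrt_pos.
rewrite Rsqr_sqrt; last by apply: Rmult_le_pos; exact: sqsum_ge0.
rewrite Rsqr_pow2.
apply: Rle_trans (sumR_cauchy_schwarz L (fun i => Cmod (x i)) (fun i => Cmod (y i))).
apply: pow_incr; split; first exact: Cmod_ge_0.
elim: L => /= [|i L IH]; first by rewrite Cmod_0; lra.
apply: Rle_trans (Cmod_triangle _ _) _; rewrite Cmod_mult Cmod_conj; lra.
Qed.

Lemma form_gram_off_bounded a F e : 0 < e <= / 42 -> NoDup F -> tail_separated a F e ->
  forall n x y, Cmod (form_on (seq 0 n) (gram_off a) x y) <=
    ((INR (length F) + 2) ^ 2 + 1) * (sqrt (sqsum (seq 0 n) x) * sqrt (sqsum (seq 0 n) y)).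
Proof.
move=> he hF ht n x y.
have hL := seq_NoDup n 0.
rewrite form_gram_off //.
apply: Rle_trans (Cmod_triangle _ _) _; rewrite Cmod_opp Rmult_plus_distr_r Rmult_1_l.
apply: Rplus_le_compat; last exact: sumC_cauchy_schwarz.
apply: Rle_trans (Cauchy_Schwarz _ _) _.
have h1 := synth_any a F e _ x he hF ht hL; have h2 := synth_any a F e _ y he hF ht hL.
have -> : forall k u v : R, k ^ 2 * (u * v) = (k * u) * (k * v) by move=> k u v; ring.
by apply: Rmult_le_compat => //; exact: nrm_ge0.
Qed.

(** Testing the form on a basis vector and on the truncated conjugate row bounds
    the row. *)
Lemma bounded_matrix_of_form (M : nat -> nat -> C) (K : R) : 0 <= K ->
  (forall n x y, Cmod (form_on (seq 0 n) M x y) <=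
     K * (sqrt (sqsum (seq 0 n) x) * sqrt (sqsum (seq 0 n) y))) ->
  exists B : bounded_matrix, bm B = M /\ bm_norm B = K.
Proof.
move=> hK h.
have hrow i : l2 (fun j => Cconj (M i j)).
  apply: (sum_f_R0_pos_incr _ (fun n => pow2_ge_0 _) (K ^ 2)) => m.
  rewrite -sumR_seq_sum_f_R0 -/(sqsum (seq 0 (S m)) (fun j => Cconj (M i j))).
  have [n [hn1 hn2]] : exists n, (S m <= n)%nat /\ (i < n)%nat by exists (S m + S i)%nat; lia.
  set x := fun j => Cconj (M i j).
  apply: (Rle_trans _ (sqsum (seq 0 n) x)).
    apply: sumR_incl_le => [j||j /in_seq hj]; [exact: pow2_ge_0 | exact: seq_NoDup |].
    by apply/in_seq; lia.
  have hi : In i (seq 0 n) by apply/in_seq; lia.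
  have hb := h n x (std_basis i).
  have hy : sqsum (seq 0 n) (std_basis i) = 1.
    apply: RtoC_inj; rewrite /sqsum -sumC_RtoC.
    rewrite (sumC_perm _ _ _ (remove_perm _ i (seq_NoDup _ _) hi)) [sumC _ _]/= sumC_zero.
      by rewrite /std_basis; case: Nat.eq_dec => // _; rewrite Cmod_1 -RtoC_plus; congr RtoC; ring.
    move=> j hj; have [_ hne] := in_remove Nat.eq_dec (seq 0 n) j i hj.
    by rewrite /std_basis; case: Nat.eq_dec => // _; rewrite Cmod_0; congr RtoC; ring.
  have hf : form_on (seq 0 n) M x (std_basis i) = RtoC (sqsum (seq 0 n) x).
    rewrite /form_on (sumC_perm _ _ _ (remove_perm _ i (seq_NoDup _ _) hi)) [sumC (_ :: _) _]/=.
    rewrite (sumC_zero (remove _ _ _)).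
      rewrite Cplus_0_r /sqsum -sumC_RtoC; apply: sumC_ext => j _.
      rewrite /std_basis; case: Nat.eq_dec => // _.
      rewrite Cconj_RtoC.
      by rewrite Cmod2_conj /x Cconj_conj; ring.
    move=> k hk; have [_ hne] := in_remove Nat.eq_dec (seq 0 n) k i hk.
    apply: sumC_zero => j _; rewrite /std_basis; case: Nat.eq_dec => // _.
    rewrite Cconj_RtoC.
    ring.
  have hS := sqsum_ge0 (seq 0 n) x.
  rewrite hf hy sqrt_1 Rmult_1_r Cmod_R Rabs_pos_eq // in hb.
  have hs := sqrt_sqrt _ hS; have hs0 := sqrt_pos (sqsum (seq 0 n) x).
  move: hb hs hs0; set A := sqsum (seq 0 n) x; set s := sqrt A => hb hs hs0.
  have : s <= K.
    case: (Req_dec s 0) => [->|ne] //; apply: (Rmult_le_reg_r s); lra.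
  nra.
by exists (BoundedMatrix M hrow K hK h).
Qed.

Definition mask (F : list nat) (M : nat -> nat -> C) (i j : nat) : C :=
  if in_dec Nat.eq_dec i F then RtoC 0 else if in_dec Nat.eq_dec j F then RtoC 0 else M i j.

Lemma sumC_outside F L (f : nat -> C) :
  sumC L (fun i => if in_dec Nat.eq_dec i F then RtoC 0 else f i) = sumC (outside F L) f.
Proof.
elim: L => //= i L IH; case: in_dec => h /=; rewrite IH; ring.
Qed.

Lemma form_mask F L M x y : form_on L (mask F M) x y = form_on (outside F L) M x y.
Proof.
rewrite /form_on -(sumC_outside F L); apply: sumC_ext => i _; rewrite /mask.
case: in_dec => h; first by apply: sumC_zero => j _; ring.
rewrite -(sumC_outside F L); apply: sumC_ext => j _; case: in_dec => _ //; ring.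
Qed.

Lemma inner_ext (x z x' z' : H) : (forall i, (x i * Cconj (z i))%C = (x' i * Cconj (z' i))%C) ->
  inner x z = inner x' z'.
Proof.
by move=> h; rewrite /inner /l2_inner /CSeries; congr pair; apply: Series_ext => n; rewrite h.
Qed.

(** Against vectors vanishing on [F] the matrix may be replaced by the one with the rows and
    columns in [F] set to zero. *)
Lemma tail_bound_of_separated a F e (M : bounded_matrix) : bm M = gram_off a ->
  0 < e <= / 42 -> tail_separated a F e -> tail_bound (op M) F (42 * e).
Proof.
move=> hM he ht y w hy hw.
have [||MF [hMF hK]] := bounded_matrix_of_form (mask F (gram_off a)) (42 * e); first lra.
  move=> n u v; rewrite form_mask.
  have hs := ht (outside F (seq 0 n)) (NoDup_outside F _ (seq_NoDup _ _))
     (fun i hi => proj2 (in_outside F _ i hi)).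
  apply: Rle_trans (separated_form_bound a e _ he hs u v) _.
  apply: Rmult_le_compat_l; first lra.
  apply: Rmult_le_compat; try exact: sqrt_pos;
    apply: sqrt_le_1_alt; exact: sqsum_filter_le.
have -> : inner (op M y) w = inner (op MF y) w.
  apply: inner_ext => i.
  case: (in_dec Nat.eq_dec i F) => hi; first by rewrite (hw i hi); apply: C_eq => /=; ring.
  congr Cmult; rewrite /=; apply: inner_ext => j /=.
  rewrite hM hMF !Cconj_conj /mask.
  case: (in_dec Nat.eq_dec i F) => // _; case: in_dec => hj //.
  by rewrite (hy j hj); ring.
apply: Rle_trans (Cauchy_Schwarz _ _) _.
rewrite -Rmult_assoc; apply: Rmult_le_compat_r; first exact: nrm_ge0.
by have := op_bound MF y; rewrite hK.
Qed.

(** * Operators on sequences and operators on [H] *)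

Lemma l2_norm_sub (x y : H) : l2_norm (fun m => (x m - y m)%C) = nrm (x - y)%H.
Proof.
rewrite /nrm; congr l2_norm; apply: functional_extensionality => m; rewrite /hsub /=; ring.
Qed.

Lemma bounded_map_of (T : (nat -> C) -> nat -> C) : bounded_operator T ->
  exists B : bounded_map, forall x : H, hv (B x) = T x.
Proof.
move=> [h1 [h2 [h3 [K hK]]]].
set B := fun x : H => mkH (T x) (h1 x (hv_l2 x)).
have hadd x y : B (x + y)%H = (B x + B y)%H.
  by apply: H_ext => n; exact: (h2 x y (hv_l2 x) (hv_l2 y) n).
have hsc c x : B (c *: x)%H = (c *: B x)%H.
  by apply: H_ext => n; exact: (h3 c x (hv_l2 x) n).
have hb x : nrm (B x) <= Rabs K * nrm x.
  apply: Rle_trans (hK x (hv_l2 x)) _.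
  by apply: Rmult_le_compat_r; [exact: nrm_ge0 | exact: Rle_abs].
by exists (BoundedMap B hadd hsc (Rabs K) (Rabs_pos K) hb).
Qed.

Definition seq_op (B : H -> H) (x : nat -> C) : nat -> C :=
  match excluded_middle_informative (l2 x) with
  | left h => B (mkH x h)
  | right _ => fun _ => RtoC 0
  end.

Lemma seq_op_eq (B : H -> H) (x : H) : seq_op B x = B x.
Proof.
rewrite /seq_op; case: excluded_middle_informative => h; last by case: h; exact: hv_l2.
by congr (hv (B _)); apply: H_ext.
Qed.

Lemma seq_op_mk (B : H -> H) (x : nat -> C) (h : l2 x) : seq_op B x = B (mkH x h).
Proof. exact: (seq_op_eq B (mkH x h)). Qed.

Lemma seq_op_bounded (B : bounded_map) : bounded_operator (seq_op B).
Proof.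
split; [|split; [|split]].
- by move=> x hx; rewrite (seq_op_mk B x hx); exact: hv_l2.
- move=> x y hx hy n.
  rewrite (seq_op_mk B x hx) (seq_op_mk B y hy).
  by rewrite (seq_op_eq B (mkH x hx + mkH y hy)%H) bf_add.
- move=> c x hx n; rewrite (seq_op_mk B x hx).
  by rewrite (seq_op_eq B (c *: mkH x hx)%H) bf_scal.
- exists (bf_norm B) => x hx; rewrite (seq_op_mk B x hx); exact: (bf_bound B (mkH x hx)).
Qed.

Lemma seq_op_compact (B : bounded_map) : compact B -> compact_operator (seq_op B).
Proof.
move=> hB; split; first exact: seq_op_bounded.
move=> x hx [K hK].
have [phi [y [h1 h2]]] := hB (fun n => mkH (x n) (hx n)) K hK.
exists phi, y; split => //; split; first exact: hv_l2.
apply: is_lim_seq_ext h2 => n.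
by rewrite (seq_op_mk B _ (hx (phi n))) l2_norm_sub.
Qed.

Lemma seq_op_schatten (B : bounded_map) (p : R) sg vv : compact B -> adjoint B B ->
  sing_sys B (fun x => B (B x)) sg vv -> ex_series (fun n => rpow (sg n) p) ->
  schatten_class p (seq_op B).
Proof.
move=> hc ha hs hp; split; first exact: seq_op_compact.
exists sg; split => //; split.
  by move=> n; split; [exact: (ss_ge0 _ _ _ _ hs) | exact: (ss_decr _ _ _ _ hs)].
exists (seq_op B); split.
- split; first exact: seq_op_bounded.
  move=> x y hx hy; rewrite (seq_op_mk B x hx) (seq_op_mk B y hy).
  exact: (ha (mkH x hx) (mkH y hy)).
- apply: (sing_multiplicities B B sg vv) => //.
  + by move=> x y; rewrite !bf_sub.
  + by move=> x; rewrite !seq_op_eq.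
Qed.

(** * Necessity *)

(** The norm of the [n]-th column dominates [sqrt (1 - delta_n^2)]. *)
Lemma schatten_implies_summable (alpha : nat -> C) (a : nat -> Disc) (p : R) :
  (forall j, disc_val (a j) = alpha j) -> 2 <= p ->
  matrix_in_schatten p (fun i j => (gram alpha i j - id_matrix i j)%C) ->
  ex_series (fun n => rpow (1 - delta alpha n ^ 2) (p / 2)).
Proof.
move=> ha hp [T [[hTb hTm] [[_ hTc] [s [[hsd [Ts [[hTsb hadj] hmult]]] hsum]]]]].
have [B hB] := bounded_map_of T hTb; have [Bs hBs] := bounded_map_of Ts hTsb.
have hadjB : adjoint B Bs.
  by move=> x y; have := hadj x y (hv_l2 x) (hv_l2 y); rewrite -hB -hBs.
have hcB : compact B.
  move=> x K hK.
  have [phi [y [h1 [hy h2]]]] := hTc (fun n => x n) (fun n => hv_l2 (x n)) (ex_intro _ K hK).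
  exists phi, (mkH y hy); split => //.
  by apply: is_lim_seq_ext h2 => n; rewrite -l2_norm_sub hB.
have [sg [vv hss]] := singular_system B Bs hadjB hcB.
have hle n : sg n <= s n.
  apply: (sing_le B _ sg vv (fun x => Ts (T x)) s hss) => //.
  by move=> x; rewrite hBs hB.
have hS K : sumR (seq 0 K) (fun k => rpow (sg k) p) <= Series (fun n => rpow (s n) p).
  case: K => [|K]; first by apply: Series_ge_0 => // n; exact: rpow_ge0.
  rewrite sumR_seq_sum_f_R0.
  apply: Rle_trans (sum_le_Series _ (fun n => rpow_ge0 (s n) p) hsum K).
  apply: sum_Rle => n _; apply: rpow_le => //; lra.
have hcol := column_powers B Bs sg vv p _ hadjB hss hp hS.
have hdel n : 1 - delta alpha n ^ 2 <= nrm2 (B (basis n)).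
  apply: (delta_upper alpha a) => // m.
  apply: Rle_trans (sqsum_le_nrm2 m (B (basis n))); apply: sumR_le => i _.
  rewrite hB hTm (gram_eq alpha a) // -/(gram_off a i n) gram_off_sqr; lra.
apply: (sum_f_R0_pos_incr _ (fun n => rpow_ge0 _ _)
   (Rpower 2 (p / 2) * Series (fun n => rpow (s n) p))) => N.
rewrite -sumR_seq_sum_f_R0; apply: Rle_trans (hcol (S N)); apply: sumR_le => n _.
apply: rpow_le => //; lra.
Qed.

(** * Sufficiency *)

Lemma rpow_small (u : nat -> R) q d : 0 <= q -> 0 < d ->
  ex_series (fun n => rpow (u n) q) -> exists N, forall n, (N <= n)%nat -> u n < d.
Proof.
move=> hq hd hs.
have /is_lim_seq_spec hl := ex_series_lim_0 _ hs.
have hp : 0 < rpow d q by rewrite rpow_pos //; exact: exp_pos.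
have [N hN] := hl (mkposreal _ hp).
exists N => n hn; apply: Rnot_le_lt => hle.
have := hN n hn; rewrite /= Rminus_0_r Rabs_pos_eq; last exact: rpow_ge0.
have := rpow_le d (u n) q hq hle; lra.
Qed.

Lemma list_argmax (f : nat -> R) (l : list nat) n0 :
  exists n, In n (n0 :: l) /\ forall m, In m (n0 :: l) -> f m <= f n.
Proof.
elim: l => [|i l [n [hn h]]].
  by exists n0; split; [left | move=> m [<-|[]]; lra].
case: (Rle_lt_dec (f i) (f n)) => hi.
- exists n; split; first by case: hn => [<-|hn]; [left | right; right].
  move=> m [<-|[<-|hm]] //; apply: h; [by left | by right].
- exists i; split; first by right; left.
  move=> m [<-|[<-|hm]]; [|lra|].
  + have := h n0 (or_introl eq_refl); lra.
  + have := h m (or_intror hm); lra.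
Qed.

(** Some value off [F] is positive, and only finitely many indices exceed it. *)
Lemma argmax_outside (eta : nat -> R) (F : list nat) : (forall n, 0 < eta n) ->
  (forall d, 0 < d -> exists N, forall n, (N <= n)%nat -> eta n < d) ->
  exists n, ~ In n F /\ forall m, ~ In m F -> eta m <= eta n.
Proof.
move=> hpos hlim.
set n0 := S (list_max F).
have hn0 : ~ In n0 F.
  move=> h; have := proj1 (list_max_le F (list_max F)) (le_n _).
  by move/Forall_forall => /(_ _ h); rewrite /n0; lia.
have [M hM] := hlim (eta n0) (hpos n0).
have [n [hn hmax]] := list_argmax eta (outside F (seq 0 M)) n0.
exists n; split.
  by case: hn => [<-|/in_outside []].
move=> m hm; case: (lt_dec m M) => hmM.
- apply: hmax; right; apply/filter_In; split; first by apply/in_seq; lia.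
  by case: in_dec.
- have h1 := hM m ltac:(lia); have h2 := hmax n0 (or_introl eq_refl); lra.
Qed.

(** Greedy choice of the largest remaining value; the chosen indices are distinct,
    so the chosen values are summable along with [eta]. *)
Lemma decreasing_order (eta : nat -> R) (q : R) : (forall n, 0 < eta n) -> 0 <= q ->
  ex_series (fun n => rpow (eta n) q) ->
  exists (Fs : nat -> list nat) (m : nat -> R),
    (forall N, NoDup (Fs N) /\ length (Fs N) = N) /\
    (forall N, 0 < m N) /\
    (forall N j, ~ In j (Fs N) -> eta j <= m N) /\
    ex_series (fun N => rpow (m N) q).
Proof.
move=> hpos hq hs.
have hlim d : 0 < d -> exists N, forall n, (N <= n)%nat -> eta n < d.
  by move=> hd; exact: (rpow_small eta q d hq hd hs).
set P := fun F n => ~ In n F /\ forall m, ~ In m F -> eta m <= eta n.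
set pick := fun F => epsilon (inhabits 0%nat) (P F).
have hpick F : P F (pick F) by exact: (epsilon_spec _ (P F) (argmax_outside eta F hpos hlim)).
set Fs := fix Fs N := match N with O => nil | S k => pick (Fs k) :: Fs k end.
have hFs N : NoDup (Fs N) /\ length (Fs N) = N.
  elim: N => [|N [h1 h2]] /=; first by split; [constructor|].
  by split; [constructor => //; exact: (proj1 (hpick (Fs N))) | rewrite h2].
exists Fs, (fun N => eta (pick (Fs N))); split => //; split => //; split.
  by move=> N j; exact: (proj2 (hpick (Fs N))).
apply: (sum_f_R0_pos_incr _ (fun n => rpow_ge0 _ _) (Series (fun n => rpow (eta n) q))) => N.
have -> : sum_f_R0 (fun N => rpow (eta (pick (Fs N))) q) N =
          sumR (Fs (S N)) (fun n => rpow (eta n) q).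
  elim: N => [|N IH]; first by rewrite /=; ring.
  by rewrite [sum_f_R0 _ _]/= IH Rplus_comm.
set L := Fs (S N).
apply: (Rle_trans _ (sumR (seq 0 (S (list_max L))) (fun n => rpow (eta n) q))).
  apply: sumR_incl_le => [i||i hi]; [exact: rpow_ge0 | exact: (proj1 (hFs (S N))) |].
  apply/in_seq; have := proj1 (list_max_le L (list_max L)) (le_n _).
  by move/Forall_forall => /(_ _ hi); lia.
rewrite sumR_seq_sum_f_R0; exact: (sum_le_Series _ (fun n => rpow_ge0 (eta n) q) hs).
Qed.

Lemma sumR_div2 (f : nat -> R) K :
  sumR (seq 0 (2 * K)) (fun k => f (Nat.div2 k)) = 2 * sumR (seq 0 K) f.
Proof.
elim: K => [|K IH]; first by rewrite /=; ring.
have -> : (2 * S K = S (S (2 * K)))%nat by lia.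
rewrite !seq_S !sumR_app IH [sumR (_ :: nil) _]/= [sumR (_ :: nil) (fun k => f (Nat.div2 k))]/=.
rewrite [sumR (_ :: nil) f]/=.
have e1 : Nat.div2 (2 * K) = K by rewrite Nat.div2_double.
have e2 : Nat.div2 (S (2 * K)) = K by rewrite Nat.div2_succ_double.
rewrite /= in e1 e2; rewrite ?e1 ?e2 /=; ring.
Qed.

Lemma ex_series_div2 (f : nat -> R) : (forall n, 0 <= f n) -> ex_series f ->
  ex_series (fun k => f (Nat.div2 k)).
Proof.
move=> h0 hf; apply: (sum_f_R0_pos_incr _ (fun n => h0 _) (2 * Series f)) => n.
rewrite -sumR_seq_sum_f_R0.
apply: (Rle_trans _ (sumR (seq 0 (2 * S n)) (fun k => f (Nat.div2 k)))).
  apply: sumR_incl_le => [i||i /in_seq hi]; [exact: h0 | exact: seq_NoDup |].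
  by apply/in_seq; lia.
rewrite sumR_div2; apply: Rmult_le_compat_l; first lra.
rewrite sumR_seq_sum_f_R0; exact: sum_le_Series.
Qed.

(** Off the first [N] indices in the order of decreasing [1 - delta^2], the points
    are separated with parameter [e = sqrt (2 m_N)], where [m_N] is the largest remaining
    value; so the singular value of index [2 N] is at most [42 e]. *)
Lemma summable_implies_schatten (alpha : nat -> C) (a : nat -> Disc) (p : R) :
  (forall j, disc_val (a j) = alpha j) -> 2 <= p ->
  ex_series (fun n => rpow (1 - delta alpha n ^ 2) (p / 2)) ->
  matrix_in_schatten p (fun i j => (gram alpha i j - id_matrix i j)%C).
Proof.
move=> ha hp hsum.
set eta := fun n => 1 - delta alpha n ^ 2.
have heta n : 0 < eta n.
  have hnd : NoDup (S n :: nil) by constructor; [case | constructor].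
  have := delta_lower alpha a n (S n :: nil) ha hnd.
  rewrite [sumR _ _]/= Rplus_0_r /offdiag; case: Nat.eq_dec => [e|_]; first lia.
  have h1 := gram_sq_gt0 (a (S n)) (a n).
  have h2 := pow2_ge_0 (delta alpha n).
  by rewrite /eta; nra.
have hq : 0 <= p / 2 by lra.
have [Fs [m [hFs [hm0 [hmax hms]]]]] := decreasing_order eta (p / 2) heta hq hsum.
(* [3528 = 2 * 42^2], so that [sqrt (2 m_N) <= 1 / 42] *)
have hsep N : m N <= / 3528 -> 0 < sqrt (2 * m N) <= / 42 /\ tail_separated a (Fs N) (sqrt (2 * m N)).
  move=> hN; have hmN := hm0 N; split.
    split; first by apply: sqrt_lt_R0; lra.
    rewrite -(sqrt_Rsqr (/ 42)); last lra.
    by apply: sqrt_le_1_alt; rewrite /Rsqr; lra.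
  move=> L hL hdis; split => // j hj.
  rewrite pow2_sqrt; last lra.
  have h1 := delta_lower alpha a j L ha hL.
  have h2 := hmax N j (hdis j hj).
  have h3 : 0 <= sumR L (offdiag a j) by apply: sumR_ge0 => k _; exact: offdiag_ge0.
  have h4 : delta alpha j ^ 2 = 1 - eta j by rewrite /eta; ring.
  rewrite h4 in h1; have h5 := heta j.
  have : (1 - m N) * (1 + sumR L (offdiag a j)) <= 1.
    by apply: Rle_trans h1; apply: Rmult_le_compat_r; lra.
  nra.
have hsmall d : 0 < d -> exists N0, forall N, (N0 <= N)%nat -> m N < d.
  by move=> hd; exact: (rpow_small m (p / 2) d hq hd hms).
have [N0 hN0] := hsmall (/ 3528) ltac:(lra).
have [hF1 hF2] := hFs N0.
have [he0 hts0] := hsep N0 (Rlt_le _ _ (hN0 N0 (le_n _))).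
have hK : 0 <= (INR (length (Fs N0)) + 2) ^ 2 + 1.
  by have := pow2_ge_0 (INR (length (Fs N0)) + 2); lra.
have [M [hM _]] := bounded_matrix_of_form (gram_off a) _ hK (form_gram_off_bounded a (Fs N0) _ he0 hF1 hts0).
set B := BoundedMap (op M) (op_add M) (op_scal M) (bm_norm M) (bm_norm_ge0 M) (op_bound M).
have hadj : adjoint B B by apply: op_selfadjoint => i j; rewrite hM gram_off_herm.
have htail N : (N0 <= N)%nat -> tail_bound B (Fs N) (42 * sqrt (2 * m N)).
  move=> hN; have [h1 h2] := hsep N (Rlt_le _ _ (hN0 N hN)).
  exact: (tail_bound_of_separated a (Fs N) _ M hM h1 h2).
have hcpt : compact B.
  apply: compact_of_tails => d hd.
  have hd1 : 0 < (d / 42) ^ 2 / 2 by have : 0 < (d / 42) ^ 2 by [apply: pow_lt; lra]; lra.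
  have [N1 hN1] := hsmall _ hd1.
  set N := Nat.max N0 N1; exists (Fs N); split; first exact: (proj1 (hFs N)).
  have hle : 42 * sqrt (2 * m N) <= d.
    have : sqrt (2 * m N) <= d / 42.
      rewrite -(sqrt_Rsqr (d / 42)); last lra.
      apply: sqrt_le_1_alt; rewrite Rsqr_pow2; have := hN1 N ltac:(rewrite /N; lia); lra.
    lra.
  move=> y w hy hw; apply: Rle_trans (htail N ltac:(rewrite /N; lia) y w hy hw) _.
  apply: Rmult_le_compat_r => //; apply: Rmult_le_pos; exact: nrm_ge0.
have [sg [vv hss]] := singular_system B B hadj hcpt.
have hsg k : (2 * N0 <= k)%nat -> sg k <= 42 * sqrt (2 * m (Nat.div2 k)).
  move=> hk.
  have hdiv := Nat.div2_odd k.
  have hdb : (Nat.b2n (Nat.odd k) <= 1)%nat by case: Nat.odd => /=; lia.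
  have hN : (N0 <= Nat.div2 k)%nat by lia.
  set N := Nat.div2 k in hdiv hN *.
  have hs0 := sqrt_pos (2 * m N).
  apply: (sing_rank_bound B B sg vv (Fs N)) => //; try lra.
  - move=> v hv hBv.
    have := htail N hN v (B v) hv hBv.
    rewrite inner_self Cmod_R Rabs_pos_eq; last exact: nrm2_ge0.
    rewrite -nrm_sqr => h.
    have hn := nrm_ge0 (B v).
    case: (Req_dec (nrm (B v)) 0) => [->|ne].
      by apply: Rmult_le_pos; [lra | exact: nrm_ge0].
    apply: (Rmult_le_reg_r (nrm (B v))); lra.
  - by rewrite (proj2 (hFs N)); lia.
have hser : ex_series (fun n => rpow (sg n) p).
  apply/(ex_series_incr_n _ (2 * N0)).
  set c := Rpower 3528 (p / 2).
  have hb : ex_series (fun k => c * rpow (m (Nat.div2 k)) (p / 2)).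
    apply: (ex_series_scal_l c).
    exact: (ex_series_div2 (fun N => rpow (m N) (p / 2)) (fun n => rpow_ge0 _ _) hms).
  move/(ex_series_incr_n _ (2 * N0)): hb => hb.
  apply: (@ex_series_le R_AbsRing R_CompleteNormedModule _ _ _ hb) => k.
  rewrite /norm /= /abs /= Rabs_pos_eq; last exact: rpow_ge0.
  set j := (N0 + (N0 + 0) + k)%nat.
  have h1 := hsg j ltac:(rewrite /j; lia).
  apply: (Rle_trans _ (rpow (42 * sqrt (2 * m (Nat.div2 j))) p)); first by apply: rpow_le => //; lra.
  have hm1 := hm0 (Nat.div2 j).
  have hs0 := sqrt_pos (2 * m (Nat.div2 j)).
  rewrite -rpow_sqr; last lra.
  rewrite Rpow_mult_distr pow2_sqrt; last lra.
  have -> : 42 ^ 2 * (2 * m (Nat.div2 j)) = 3528 * m (Nat.div2 j) by ring.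
  by rewrite rpow_scal; [exact: Rle_refl | lra].
exists (seq_op B); split; last exact: (seq_op_schatten B p sg vv).
split; first exact: seq_op_bounded.
move=> i j; rewrite (seq_op_eq B (basis j)).
have -> : B (basis j) i = M i j by exact: op_basis.
by rewrite hM /gram_off (gram_eq alpha a).
Qed.

Theorem theorem1p1 (alpha : nat -> C) (p : R)
    (Halpha : blaschke_sequence alpha) (Hp : 2 <= p) :
  matrix_in_schatten p (fun i j => (gram alpha i j - id_matrix i j)%C) <->
  ex_series (fun n => rpow (1 - delta alpha n ^ 2) (p / 2)).
Proof.
have [hd _] := Halpha.
set a : nat -> Disc := fun j => exist _ (alpha j) (hd j).
by split; [apply: (schatten_implies_summable alpha a) | apply: (summable_implies_schatten alpha a)].
Qed.
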